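(* Let $p\ge 2$ be a prime number and $s\in\mathbb N$ with $p^s\ge 3$. Let $V=GF(p^s)=\{\mathbf 0,\mathbf u_1,\dots,\mathbf u_q,\mathbf a_1,\dots,\mathbf a_{p^s-q-1}\}$ ($1\le q\le p^s-1$) be regarded as a set of vertices, and let $T(V)$ be a rooted tree on the vertex set $V$ with root $\mathbf 0$ and first level vertices $\mathbf u_1,\dots,\mathbf u_q$. Let $\varphi$ be a function generated by the tree $T(V)$. Then $\varphi$ generates an orthogonal multiresolution analysis on $F^{(s)}$.
   Context: $\mathbb N=\{1,2,\dots\}$. $GF(p^s)$ is the finite field of $p^s$ elements, realized as vectors $\mathbf a=(a^{(0)},\dots,a^{(s-1)})$ with $a^{(l)}\in GF(p)=\{0,\dots,p-1\}$; addition is coordinatewise mod $p$, multiplication is multiplication of the polynomials $\sum_l a^{(l)}t^l$ over $GF(p)$ modulo a fixed irreducible polynomial of degree $s$; its zero is $\mathbf 0$ and its unit is $(1,0,\dots,0)$. $K=F^{(s)}$ is the local field of characteristic $p$ consisting of sequences $a=(\mathbf a_j)_{j\in\mathbb Z}$, $\mathbf a_j\in GF(p^s)$, with only finitely many nonzero $\mathbf a_j$ with $j<0$; addition $\dot+$ (subtraction $\dot-$) is coordinatewise and multiplication is convolution $(ab)_l=\sum_{i+j=l}\mathbf a_i\mathbf b_j$. $K_n=\{a\in K:\mathbf a_j=\mathbf 0\ \forall j<n\}$, $n\in\mathbb Z$, is a neighbourhood basis of zero consisting of compact subgroups of the additive group $K^+$. For $\lambda\in GF(p^s)$, $\lambda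 a=(\lambda\mathbf a_j)_j$. $g_n\in K$ has $(1,0,\dots,0)$ in position $n$ and $\mathbf 0$ elsewhere. The dilation operator is $(\mathcal A a)_n=\mathbf a_{n+1}$, i.e. $\mathcal A\sum\lambda_ng_n=\sum\lambda_ng_{n-1}$. $H_0=\{\mathbf a_{-1}g_{-1}\dot+\dots\dot+\mathbf a_{-l}g_{-l}: l\in\mathbb N,\ \mathbf a_j\in GF(p^s)\}$. $X$ is the group of continuous characters of $K^+$, $(\chi,x)=\chi(x)$. For $k\in\mathbb Z$, $\mathbf u\in GF(p^s)$, $\mathbf r_k^{\mathbf u}\in X$ is $\mathbf r_k^{\mathbf u}(x)=\prod_{l=0}^{s-1}\exp\left(\frac{2\pi i}{p}u^{(l)}x_k^{(l)}\right)$, where $x=(\mathbf x_k)$, $\mathbf x_k=(x_k^{(0)},\dots,x_k^{(s-1)})$. $K_n^\perp=\{\chi\in X:\chi(x)=1\ \forall x\in K_n\}$. For $\chi\in X$ and $n\in\mathbb Z$, $\chi\mathcal A^n$ is defined by $(\chi\mathcal A^n,x)=(\chi,\mathcal A^nx)$. $\mu,\nu$ are Haar measures on $K^+$ and $X$ with $\mu(K_0)=1$, $\nu(K_0^\perp)=1$; $\hat\varphi(\chi)=\int_K\varphi(x)\overline{(\chi,x)}\,d\mu(x)$. Function generated by a tree: let $\tilde E\subset K_1^\perp$ be the union of the coset $K_{-1}^\perp$ and of all cosets $K_{-1}^\perp\mathbf r_{-1}^{\mathbf i}\mathbf r_0^{\mathbf j}$ such that $\mathbf j\to\mathbf i$ is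 an edge of $T(V)$, directed away from the root (that is, for each path $\mathbf 0\to\mathbf u_j\to\alpha_{l-1}\to\dots\to\alpha_{-1}$ from the root one takes the cosets $K_{-1}^\perp\mathbf r_{-1}^{\mathbf u_j}$, $K_{-1}^\perp\mathbf r_{-1}^{\alpha_{l-1}}\mathbf r_0^{\mathbf u_j}$, $K_{-1}^\perp\mathbf r_{-1}^{\alpha_{l-2}}\mathbf r_0^{\alpha_{l-1}}$, ..., $K_{-1}^\perp\mathbf r_{-1}^{\alpha_{-1}}\mathbf r_0^{\alpha_0}$). Choose a function $m_0$, constant on cosets of $K_{-1}^\perp$, as follows: on $K_1^\perp$ put $m_0(K_{-1}^\perp)=1$ and $m_0(K_{-1}^\perp\mathbf r_{-1}^{\mathbf i}\mathbf r_0^{\mathbf j})=\lambda_{\mathbf i,\mathbf j}$, where $\lambda_{\mathbf i,\mathbf j}$ is any complex number with $|\lambda_{\mathbf i,\mathbf j}|=1$ if this coset lies in $\tilde E$, and $\lambda_{\mathbf i,\mathbf j}=0$ otherwise; extend $m_0$ to $X$ by $m_0(\chi\mathbf r_1^{\alpha_1}\cdots\mathbf r_l^{\alpha_l})=m_0(\chi)$ for all $l\in\mathbb N$, $\alpha_j\in GF(p^s)$. Then $T(V)$ is said to generate the mask $m_0$ and the function $\varphi\in L_2(K)$ with $\hat\varphi(\chi)=\prod_{n=0}^\infty m_0(\chi\mathcal A^{-n})$. MRA: a family of closed subspaces $V_n\subset L_2(K)$, $n\in\mathbb Z$, is a (orthogonal) multiresolution analysis if (A1) $V_n\subset V_{n+1}$;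 (A2) $\overline{\bigcup_nV_n}=L_2(K)$ and $\bigcap_nV_n=\{0\}$; (A3) $f(x)\in V_n\iff f(\mathcal Ax)\in V_{n+1}$; (A4) $f(x)\in V_0$ implies $f(x\dot-h)\in V_0$ for all $h\in H_0$; (A5) there is $\varphi\in L_2(K)$ such that $(\varphi(x\dot-h))_{h\in H_0}$ is an orthonormal basis of $V_0$. A function $\varphi$ generates an orthogonal MRA if $(\varphi(x\dot-h))_{h\in H_0}$ is orthonormal and the closed linear spans $V_n$ of $\{\varphi(\mathcal A^nx\dot-h):h\in H_0\}$ form an MRA. *)

(* Defs.v *)
From HB Require Import structures.
From mathcomp Require Import all_boot all_order all_algebra all_field.
From mathcomp Require Import all_classical all_reals all_analysis.
From mathcomp Require Import complex.

Set Implicit Arguments.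
Unset Strict Implicit.
Unset Printing Implicit Defensive.
Import Order.TTheory GRing.Theory Num.Theory.
Import numFieldNormedType.Exports.

Local Open Scope classical_set_scope.
Local Open Scope ring_scope.

Definition is_tree (V : finType) (e : rel V) : Prop :=
  [/\ symmetric e, irreflexive e, (forall x y, connect e x y)
    & forall c : seq V, (2 < size c)%N -> ~~ ucycleb e c].

(* j -> i directed away from the root: j and i are the last two vertices of a
   simple path starting at the root. *)
Definition away_edge (V : finType) (e : rel V) (root j i : V) : Prop :=
  exists q : seq V, [/\ path e root (rcons q i), uniq (root :: rcons q i)
                      & last root q = j].

(* The additive group of the local field: sequences indexed by int over a
   finite field F, vanishing far to the left.  Only the additive structure, the
   scalar multiplication by F and the topology are set up; the ring product
   (convolution) plays no role for multiresolution analyses. *)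

Section LocalField.
Variable F : finFieldType.

Definition left_finite : {pred (int -> F^o)} :=
  fun a => `[< exists n : int, forall j : int, j < n -> a j = 0 >].

Lemma left_finite_submod : submod_closed left_finite.
Proof.
split=> [|c a b /asboolP[n an] /asboolP[m bm]]; apply/asboolP.
  by exists 0.
exists (Num.min n m) => j; rewrite lt_min => /andP[jn jm].
by rewrite !fctE an// bm// scaler0 addr0.
Qed.

HB.instance Definition _ :=
  GRing.isSubmodClosed.Build F (int -> F^o) left_finite left_finite_submod.

Record local_field := LocalField {
  coordinate :> int -> F^o ;
  _ : left_finite coordinate }.

HB.instance Definition _ := [isSub for coordinate].
HB.instance Definition _ := [Choice of local_field by <:].
HB.instance Definition _ := [SubChoice_isSubLmodule of local_field by <:].

Implicit Types (a b x y : local_field) (n m j k : int).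

Lemma coordinateD a b : coordinate (a + b) = coordinate a + coordinate b.
Proof. by []. Qed.

Lemma coordinateB a b : coordinate (a - b) = coordinate a - coordinate b.
Proof. by []. Qed.

Lemma coordinate0 : coordinate 0 = 0.
Proof. by []. Qed.

Definition ballK n : set local_field := [set a | forall j, j < n -> a j = 0].

Lemma ballK0 n : ballK n 0.
Proof. by move=> j _; rewrite coordinate0. Qed.

Lemma ballKD n a b : ballK n a -> ballK n b -> ballK n (a + b).
Proof.
by move=> an bn j jn; rewrite coordinateD fctE an// bn// addr0.
Qed.

Lemma ballK_le n m : n <= m -> ballK m `<=` ballK n.
Proof. by move=> nm a am j jn; rewrite am// (lt_le_trans jn). Qed.

(* The topology for which the K_n form a neighbourhood basis of zero. *)
Definition nbhsK x : set_system local_field :=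
  [set A | exists n, forall y, ballK n (y - x) -> A y].

Lemma nbhsK_filter x : ProperFilter (nbhsK x).
Proof.
split; first by case=> n /(_ x); apply; rewrite subrr; exact: ballK0.
split; first by exists 0.
- move=> A B [n An] [m Bm]; exists (Num.max n m) => y xy; split.
    by apply: An; apply: ballK_le xy; rewrite le_max lexx.
  by apply: Bm; apply: ballK_le xy; rewrite le_max lexx orbT.
- by move=> A B AB [n An]; exists n => y /An /AB.
Qed.

Lemma nbhsK_singleton x (A : set local_field) : nbhsK x A -> A x.
Proof. by case=> n; apply; rewrite subrr; exact: ballK0. Qed.

Lemma nbhsK_nbhs x (A : set local_field) : nbhsK x A -> nbhsK x (nbhsK^~ A).
Proof.
case=> n An; exists n => y xy; exists n => z yz; apply: An.
by rewrite -(subrKA y); exact: ballKD.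
Qed.

HB.instance Definition _ := isPointed.Build local_field 0.
HB.instance Definition _ := hasNbhs.Build local_field nbhsK.
HB.instance Definition _ := Nbhs_isNbhsTopological.Build local_field
  nbhsK_filter nbhsK_singleton nbhsK_nbhs.

HB.instance Definition _ :=
  Measurable.copy local_field (g_sigma_algebraType (@open local_field)).

Fact g_subproof n : left_finite (fun j => (j == n)%:R).
Proof. by apply/asboolP; exists n => j /lt_eqF ->. Qed.

Definition g_ n : local_field := LocalField (g_subproof n).

Fact dilate_subproof n a : left_finite (fun k => a (k + n)).
Proof.
case: a => a /= /[dup] /asboolP[m am] _; apply/asboolP; exists (m - n) => j jmn.
by apply: am; rewrite -ltrBrDr.
Qed.

(* The n-th iterate (n in Z) of the dilation operator: A is dilate 1. *)
Definition dilate n a : local_field := LocalField (dilate_subproof n a).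

Lemma dilateD n x y : dilate n (x + y) = dilate n x + dilate n y.
Proof. exact/val_inj/funext. Qed.

Lemma dilate_ball n m x : ballK m x -> ballK (m - n) (dilate n x).
Proof. by move=> xm j jmn; rewrite /= xm// -ltrBrDr. Qed.

Definition H0 : set local_field :=
  [set h | exists (l : nat) (c : nat -> F),
    (0 < l)%N /\ h = \sum_(1 <= j < l.+1) c j *: g_ (- j%:Z)].

End LocalField.

Section Characters.
Variables (F : finFieldType) (R : realType).
Local Notation K := (local_field F).

Definition is_character (chi : K -> R[i]) : Prop :=
  [/\ continuous (chi : K -> R[i]^o), (forall x, `|chi x| = 1)
    & forall x y, chi (x + y) = chi x * chi y].

Record character := Character {
  char_fun :> K -> R[i] ;
  _ : `[< is_character char_fun >] }.

HB.instance Definition _ := [isSub for char_fun].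
HB.instance Definition _ := [Choice of character by <:].

Implicit Types (chi psi : character).

Lemma characterP chi : is_character chi.
Proof. by case: chi => f /= /asboolP. Qed.

Lemma character_neq0 chi x : chi x != 0.
Proof. by rewrite -normr_eq0; case: (characterP chi) => _ -> _; rewrite oner_eq0. Qed.

Fact char_one_subproof : `[< is_character (fun=> 1) >].
Proof.
apply/asboolP; split => [x|x|x y]; [exact: (@cvg_cst R[i]^o 1 _ (nbhs x) _)|exact: normr1|by rewrite mulr1].
Qed.

Fact char_mul_subproof chi psi : `[< is_character (fun x => chi x * psi x) >].
Proof.
apply/asboolP; have [cc nc mc] := characterP chi.
have [cp np mp] := characterP psi.
split => [x|x|x y].
- exact: (@cvgM _ _ _ _ (chi : K -> R[i]^o) (psi : K -> R[i]^o) _ _ (cc x) (cp x)).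
- by rewrite normrM nc np mulr1.
- by rewrite mc mp mulrACA.
Qed.

Fact char_inv_subproof chi : `[< is_character (fun x => (chi x)^-1) >].
Proof.
apply/asboolP; have [cc nc mc] := characterP chi; split => [x|x|x y].
- exact: (@cvgV _ _ _ _ (chi : K -> R[i]^o) _ (character_neq0 _ _) (cc x)).
- by rewrite normfV nc invr1.
- by rewrite mc invfM.
Qed.

Definition char_one := Character char_one_subproof.
Definition char_mul chi psi := Character (char_mul_subproof chi psi).
Definition char_inv chi := Character (char_inv_subproof chi).

Fact char_mulA : associative char_mul.
Proof. by move=> a b c; apply/val_inj/funext => x; exact: mulrA. Qed.
Fact char_mul1 : left_id char_one char_mul.
Proof. by move=> a; apply/val_inj/funext => x; exact: mul1r. Qed.
Fact char_mulr1 : right_id char_one char_mul.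
Proof. by move=> a; apply/val_inj/funext => x; exact: mulr1. Qed.
Fact char_mulV : left_inverse char_one char_inv char_mul.
Proof.
by move=> a; apply/val_inj/funext => x; exact/mulVf/character_neq0.
Qed.
Fact char_mulrV : right_inverse char_one char_inv char_mul.
Proof.
by move=> a; apply/val_inj/funext => x; exact/mulfV/character_neq0.
Qed.

HB.instance Definition _ :=
  isGroup.Build character char_mulA char_mul1 char_mulr1 char_mulV char_mulrV.

Lemma char_mulE chi psi x : (chi * psi)%g x = chi x * psi x.
Proof. by []. Qed.

Definition annihilator (n : int) : set character :=
  [set chi | forall x, ballK n x -> chi x = 1].

Lemma annihilator1 n : annihilator n 1%g.
Proof. by []. Qed.

Lemma annihilatorM n chi psi :
  annihilator n chi -> annihilator n psi -> annihilator n (chi * psi)%g.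
Proof. by move=> cn pn x xn; rewrite char_mulE cn// pn// mulr1. Qed.

Lemma annihilator_le n m : n <= m -> annihilator n `<=` annihilator m.
Proof. by move=> nm chi cn x /(ballK_le nm)/cn. Qed.

(* The dual topology: the annihilators of the compact open subgroups K_n form a
   neighbourhood basis of the trivial character. *)
Definition nbhsX chi : set_system character :=
  [set A | exists n, forall psi, annihilator n (psi * chi^-1)%g -> A psi].

Lemma nbhsX_filter chi : ProperFilter (nbhsX chi).
Proof.
split; first by case=> n /(_ chi); apply; rewrite mulgV; exact: annihilator1.
split; first by exists 0.
- move=> A B [n An] [m Bm]; exists (Num.min n m) => y xy; split.
    by apply: An; apply: annihilator_le xy; rewrite ge_min lexx.
  by apply: Bm; apply: annihilator_le xy; rewrite ge_min lexx orbT.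
- by move=> A B AB [n An]; exists n => y /An /AB.
Qed.

Lemma nbhsX_singleton chi (A : set character) : nbhsX chi A -> A chi.
Proof. by case=> n; apply; rewrite mulgV; exact: annihilator1. Qed.

Lemma nbhsX_nbhs chi (A : set character) :
  nbhsX chi A -> nbhsX chi (nbhsX^~ A).
Proof.
case=> n An; exists n => y xy; exists n => z yz; apply: An.
by rewrite -[z](mulgVK y) -mulgA; exact: annihilatorM.
Qed.

HB.instance Definition _ := isPointed.Build character 1%g.
HB.instance Definition _ := hasNbhs.Build character nbhsX.
HB.instance Definition _ := Nbhs_isNbhsTopological.Build character
  nbhsX_filter nbhsX_singleton nbhsX_nbhs.
HB.instance Definition _ :=
  Measurable.copy character (g_sigma_algebraType (@open character)).

Fact char_dilate_subproof chi n : `[< is_character (fun x => chi (dilate n x)) >].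
Proof.
apply/asboolP; have [cc nc mc] := characterP chi; split => [x A|x|x y].
- move=> /cc [m Am]; exists (m + n) => y xy; apply: Am.
  have -> : dilate n y - dilate n x = dilate n (y - x).
    exact/val_inj/funext.
  by rewrite -[m](addrK n); exact: dilate_ball.
- exact: nc.
- by rewrite dilateD mc.
Qed.

Definition char_dilate chi n := Character (char_dilate_subproof chi n).

End Characters.

Section Rademacher.
Variable R : realType.

Definition expi (t : R) : R[i] := (cos t +i* sin t)%C.

Lemma expi0 : expi 0 = 1.
Proof. by rewrite /expi cos0 sin0. Qed.

Lemma expiD s t : expi (s + t) = expi s * expi t.
Proof. by rewrite /expi cosD sinD; simpc; rewrite addrC [X in (_ +i* X)%C]addrC. Qed.

Lemma expi_norm t : `|expi t| = 1.
Proof. by rewrite normc_def /= cos2Dsin2 sqrtr1. Qed.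

Lemma expi2piM n : expi (2 * pi * n%:R) = 1.
Proof.
elim: n => [|n IH]; first by rewrite mulr0 expi0.
rewrite -[n.+1]addn1 natrD mulrDr expiD IH mul1r mulr1.
by rewrite /expi mulr_natl cos2pi sin2pi.
Qed.

Variables (p : nat) (p_pr : prime p).
Variables (h : {poly 'F_p}) (hI : monic_irreducible_poly h).

(* Polynomials of degree < s over GF(p) (s the degree of h), added
   coefficientwise and multiplied modulo h. *)
Definition GF : finFieldType := {poly %/ h with hI}.

Definition coord (u : GF) (l : nat) : 'F_p := (u : {poly %/ h})`_l.

Local Notation K := (local_field GF).
Local Notation X := (character GF R).

Definition rademacher (k : int) (u : GF) (x : K) : R[i] :=
  \prod_(l < (size h).-1)
    expi (2 * pi / p%:R * (coord u l : nat)%:R * (coord (x k) l : nat)%:R).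


Lemma coordD u v l : coord (u + v) l = coord u l + coord v l.
Proof. exact: coefD. Qed.

Fact rademacher_subproof k u : `[< is_character (rademacher k u) >].
Proof.
apply/asboolP; split => [x A nA|x|x y].
- exists (k + 1) => y xy; change (A (rademacher k u y)).
  have -> : rademacher k u y = rademacher k u x.
    suff yx : y k = x k by rewrite /rademacher yx.
    by apply/subr0_eq; apply: xy; rewrite ltrDl.
  exact: nbhs_singleton nA.
- by rewrite normr_prod big1// => l _; exact: expi_norm.
- rewrite /rademacher -big_split/=; apply: eq_bigr => l _.
  have -> : coord ((x + y) k) l = coord (x k) l + coord (y k) l by exact: coordD.
  move: (coord u l) => a; move: (coord (x k) l) (coord (y k) l) => b c.
  have p_neq0 : p%:R != 0 :> R by rewrite pnatr_eq0 -lt0n prime_gt0.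
  have bcE : (b + c = (b + c)%R + (b + c) %/ p * p :> nat)%N.
    have -> : nat_of_ord (b + c)%R = ((b + c) %% p)%N.
      exact: (congr1 (modn (b + c)%N) (Fp_cast p_pr)).
    by rewrite [RHS]addnC -divn_eq.
  rewrite -expiD -mulrDr -natrD bcE natrD (mulrDr (_ * (a : nat)%:R)) expiD.
  suff -> : expi (2 * pi / p%:R * (a : nat)%:R * ((b + c) %/ p * p)%N%:R) = 1.
    by rewrite mulr1.
  rewrite -(expi2piM (a * ((b + c) %/ p))); congr expi.
  rewrite !natrM; move: p_neq0; move: (p%:R : R) => q q0.
  rewrite -!mulrA; do 2 congr (_ * _).
  by rewrite (mulrA (a : nat)%:R) (mulrC _ q) mulKf.
Qed.

Definition r_ k u : X := Character (rademacher_subproof k u).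

(* The vertex set of the tree is GF and its root is 0; the product of two
   rademacher characters below stands for the coset of annihilator (-1) that it
   represents. *)
Definition tree_cosets (e : rel GF) : set X :=
  annihilator (-1) `|`
  [set chi | exists i j psi, [/\ away_edge e 0 j i, annihilator (-1) psi
                            & chi = (psi * r_ (-1) i * r_ 0 j)%g]].

Definition is_tree_mask (e : rel GF) (m0 : X -> R[i]) : Prop :=
  [/\ forall chi psi, annihilator (-1) psi -> m0 (psi * chi)%g = m0 chi,
      m0 1%g = 1,
      forall i j, if `[< tree_cosets e (r_ (-1) i * r_ 0 j)%g >]
                  then `|m0 (r_ (-1) i * r_ 0 j)%g| = 1
                  else m0 (r_ (-1) i * r_ 0 j)%g = 0
    & forall (l : nat) (alpha : nat -> GF) chi, (0 < l)%N ->
        m0 (chi * \prod_(1 <= j < l.+1) r_ j (alpha j))%g = m0 chi].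
End Rademacher.

(* Complex L_2 spaces; elements are functions, not classes modulo equality
   almost everywhere. *)

Section L2.
Context {d : measure_display} {T : measurableType d} {R : realType}.
Variable mu : {measure set T -> \bar R}.
Implicit Types (f g : T -> R[i]) (S V : set (T -> R[i])).

Definition Cintegral (D : set T) f : R[i] :=
  ((\int[mu]_(x in D) complex.Re (f x))%R +i*
   (\int[mu]_(x in D) complex.Im (f x))%R)%C.

Definition L2norm f : \bar R := ('N[mu]_2[(fun x => (Normc.normc (f x))%:E)])%E.

Definition L2 : set (T -> R[i]) :=
  [set f | [/\ measurable_fun setT (fun x => complex.Re (f x)),
               measurable_fun setT (fun x => complex.Im (f x))
             & (L2norm f < +oo)%E]].

Definition L2inner f g : R[i] := Cintegral setT (fun x => f x * (g x)^*%C).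

Definition L2closure S : set (T -> R[i]) :=
  [set f | L2 f /\ forall eps : R, 0 < eps ->
     exists2 g, S g & (L2norm (f - g)%R < eps%:E)%E].

Definition lin_span S : set (T -> R[i]) :=
  [set f | exists (n : nat) (c : 'I_n -> R[i]) (b : 'I_n -> T -> R[i]),
     (forall i, S (b i)) /\ f = fun x => \sum_(i < n) c i * b i x].

Definition closed_span S := L2closure (lin_span S).

Definition closed_subspace V : Prop :=
  [/\ V `<=` L2, V (cst 0),
      forall (c : R[i]) f g, V f -> V g -> V (fun x => c * f x + g x)
    & L2closure V `<=` V].

Definition orthonormal (I : choiceType) (D : set I) (b : I -> T -> R[i]) :=
  (forall i, D i -> L2 (b i)) /\
  forall i j, D i -> D j -> L2inner (b i) (b j) = (i == j)%:R.

Definition orthonormal_basis (I : choiceType) (D : set I) (b : I -> T -> R[i])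
    V := orthonormal D b /\ closed_span [set b i | i in D] = V.
End L2.

Section MRA.
Context {F : finFieldType} {R : realType}.
Local Notation K := (local_field F).
Local Notation X := (character F R).

(* Invariance and the normalization determine these Borel measures, because the
   topologies are second countable and locally compact. *)
Definition normalized_haarK (mu : {measure set K -> \bar R}) : Prop :=
  (forall (a : K) (A : set K),
     measurable A -> mu [set a + x | x in A] = mu A) /\ mu (ballK 0) = 1%E.

Definition normalized_haarX (nu : {measure set X -> \bar R}) : Prop :=
  (forall (chi : X) (A : set X),
     measurable A -> nu [set (chi * psi)%g | psi in A] = nu A) /\
  nu (annihilator 0) = 1%E.

Variable mu : {measure set K -> \bar R}.
Implicit Types (f phi : K -> R[i]) (V : int -> set (K -> R[i])).

Definition translate phi (h : K) : K -> R[i] := fun x => phi (x - h).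

Definition is_MRA V : Prop :=
  [/\ forall n, closed_subspace mu (V n),
      forall n, V n `<=` V (n + 1),
      L2closure mu (\bigcup_n V n) = L2 mu /\
               \bigcap_n V n = [set f | L2 mu f /\ {ae mu, forall x, f x = 0}],
      forall n f, V n f <-> V (n + 1) (f \o dilate 1)
    & (forall f h, V 0 f -> H0 h -> V 0 (translate f h)) /\
      exists2 phi, L2 mu phi &
                 orthonormal_basis mu (@H0 F) (translate phi) (V 0)].

Definition generates_orthogonal_MRA phi : Prop :=
  orthonormal mu (@H0 F) (translate phi) /\
  is_MRA (fun n => closed_span mu
                     [set (fun x => phi (dilate n x - h)) | h in @H0 F]).

(* Fourier transform on L_2(K): g is the limit in L_2(X) of the Fourier
   integrals of phi over the compact subgroups K_(-N).  If phi is integrable, g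
   is almost everywhere the Fourier integral of phi over K. *)
Definition is_fourier_transform (nu : {measure set X -> \bar R})
    phi (g : X -> R[i]) : Prop :=
  L2 nu g /\
  (fun N : nat => L2norm nu (fun chi : X =>
     Cintegral mu (ballK (- N%:Z)) (fun x => phi x * (chi x)^*%C) - g chi))
    @ \oo --> 0%E.
End MRA.

Definition generated_by_tree (R : realType) (p : nat) (p_pr : prime p)
    (h : {poly 'F_p}) (hI : monic_irreducible_poly h)
    (mu : {measure set (local_field (GF hI)) -> \bar R})
    (nu : {measure set (character (GF hI) R) -> \bar R})
    (e : rel (GF hI)) (phi : local_field (GF hI) -> R[i]) : Prop :=
  L2 mu phi /\
  exists (m0 g : character (GF hI) R -> R[i]),
    [/\ is_tree_mask p_pr e m0,
        forall chi, (fun N : nat =>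
          \prod_(n < N) m0 (char_dilate chi (- (n : nat)%:Z)) : R[i]^o)
            @ \oo --> (g chi : R[i]^o)
      & is_fourier_transform mu nu phi g].

(* Main.v *)
(* Since every vertex has exactly one tree path from the root, the Fourier
   transform of phi is unimodular on one coset of K_(-1)^perp for each vertex v,
   namely that of chi_v = prod_k r_(k-1)^(v_k), where v_0 = v, v_1, v_2, ... are
   the successive parents of v, and vanishes elsewhere. Hence, almost everywhere,
     phi = q^-1 1_(K_(-1)) sum_v c_v chi_v,   |c_v| = 1, q = p^s,
   and everything can be read off this step function: orthogonality of the
   characters of K_(-1) gives orthonormality of the shifts and the partition of
   unity sum_u phi(x - u g_(-1)) = 1_(K_(-1)); the recursion
   chi_v(x) = r_(-1)^v(x) chi_(pa v)(A x) gives the refinement equation. By the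
   partition of unity the V_n contain the indicators of all balls, which span a
   dense subspace, while elements of V_(-n) are constant on large balls, so that
   the intersection of the V_n is trivial. *)

Require Import Defs.
From mathcomp Require Import all_boot all_order all_algebra all_field.
From mathcomp Require Import all_classical all_reals all_analysis.
From mathcomp Require Import complex.
From mathcomp Require Import measurable_realfun.
From mathcomp Require Import ring lra zify.

Set Implicit Arguments.
Unset Strict Implicit.
Unset Printing Implicit Defensive.
Import Order.TTheory GRing.Theory Num.Theory.
Import numFieldNormedType.Exports.

Local Open Scope classical_set_scope.
Local Open Scope ring_scope.

(** * Complex L_2 spaces *)

(** The hypothesis on [phi] is an L_2(X) limit of truncated Fourier integrals, so identifying [phi]
    with the step function requires a uniqueness statement. It is obtained directly: passing from a
    ball to a sub-ball of the next level averages q Fourier coefficients ([ball_coefS]), so the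
    squared integral of a function over a small ball is controlled by the L_2 mass of its
    coefficients over a large ball K_(-N), and for the difference of [phi] and the step function
    that mass tends to zero. A function whose integrals over all balls vanish is null, because the
    balls form a pi-system generating the Borel sets. The infinite mask product raises no
    convergence question: on each annihilator it is constant after finitely many factors. The field
    enters only through a symmetric nondegenerate pairing [e] of F with itself, where
    [r k u x = e u (x k)]; exponentials and polynomials are confined to the proof that such a
    pairing exists. *)

Section ComplexL2.
Context {d : measure_display} {T : measurableType d} {R : realType}.
Variable mu : {measure set T -> \bar R}.
Implicit Types (f g : T -> R[i]) (S V W : set (T -> R[i])).

Definition sqnormc (z : R[i]) : R := complex.Re z ^+ 2 + complex.Im z ^+ 2.

Lemma sqnormc_ge0 z : 0 <= sqnormc z.
Proof. by rewrite addr_ge0// sqr_ge0. Qed.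

Lemma sqnormcE z : sqnormc z = Normc.normc z ^+ 2.
Proof. by case: z => a b; rewrite /sqnormc /= sqr_sqrtr// addr_ge0// sqr_ge0. Qed.

Lemma sqnormcM z w : sqnormc (z * w) = sqnormc z * sqnormc w.
Proof. by case: z w => [a b] [c e]; rewrite /sqnormc; simpc => /=; ring. Qed.

Lemma sqnormc0 : sqnormc 0 = 0.
Proof. by rewrite /sqnormc /=; ring. Qed.

Lemma sqnormcN z : sqnormc (- z) = sqnormc z.
Proof. by case: z => a b; rewrite /sqnormc /=; ring. Qed.

Lemma sqnormcB z w : sqnormc (z - w) = sqnormc (w - z).
Proof. by rewrite -sqnormcN opprB. Qed.

Lemma sqnormcD_le z w : sqnormc (z + w) <= 2 * sqnormc z + 2 * sqnormc w.
Proof.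
case: z w => [a b] [c e]; rewrite /sqnormc /= -subr_ge0.
have -> : 2 * (a ^+ 2 + b ^+ 2) + 2 * (c ^+ 2 + e ^+ 2) -
  ((a + c) ^+ 2 + (b + e) ^+ 2) = (a - c) ^+ 2 + (b - e) ^+ 2 by ring.
by rewrite addr_ge0// sqr_ge0.
Qed.

Lemma sqnormc_eq0 z : sqnormc z = 0 -> z = 0.
Proof.
case: z => a b; rewrite /sqnormc /= => /eqP.
by rewrite paddr_eq0 ?sqr_ge0// !sqrf_eq0 => /andP[/eqP -> /eqP ->].
Qed.

Lemma sqnormc_norm1 z : `|z| = 1 -> sqnormc z = 1.
Proof.
by rewrite sqnormcE normc_def => -[zE]; move: zE; case: z => a b /= ->; rewrite expr1n.
Qed.

Definition Cmeasurable f : Prop :=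
  measurable_fun setT (fun x => complex.Re (f x)) /\
  measurable_fun setT (fun x => complex.Im (f x)).

(** The working quantity throughout: its integrand is a polynomial in the real and imaginary parts,
    so no square root is handled under the integral. *)
Definition L2sq f : \bar R := (\int[mu]_x (sqnormc (f x))%:E)%E.

Lemma L2normE f : L2norm mu f = (L2sq f `^ 2^-1)%E.
Proof.
rewrite /L2norm unlock /L2sq; congr (_ `^ _)%E; apply: eq_integral => x _.
rewrite sqnormcE abse_EFin poweR_EFin powR_mulrn// ger0_norm//.
by case: (f x) => a b; exact: sqrtr_ge0.
Qed.

Lemma L2sq_ge0 f : (0 <= L2sq f)%E.
Proof. by apply: integral_ge0 => x _; rewrite lee_fin sqnormc_ge0. Qed.

Lemma L2norm_sq f : (L2norm mu f `^ 2)%E = L2sq f.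
Proof.
by rewrite L2normE -poweRrM ?mulVf// ?poweRe1// L2sq_ge0.
Qed.

Lemma L2norm_lt_pinfty f : (L2norm mu f < +oo)%E = (L2sq f < +oo)%E.
Proof.
apply/idP/idP => h; first by rewrite -L2norm_sq poweR_lty.
by rewrite L2normE poweR_lty.
Qed.

Lemma L2norm_lt f (e : R) : 0 < e -> (L2norm mu f < e%:E)%E = (L2sq f < (e ^+ 2)%:E)%E.
Proof.
move=> e0; rewrite L2normE; have := L2sq_ge0 f.
case: (L2sq f) => [r| |]//; last by rewrite poweRyr// invr_eq0.
rewrite lee_fin => r0; rewrite poweR_EFin !lte_fin.
rewrite powR12_sqrt// -[X in _ < X](gtr0_norm e0) -sqrtr_sqr ltr_sqrt//.
by rewrite exprn_gt0.
Qed.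

Lemma L2P f : L2 mu f <-> Cmeasurable f /\ (L2sq f < +oo)%E.
Proof.
by split => [[? ? ?]|[[? ?] ?]]; [split; [split|rewrite -L2norm_lt_pinfty]|
  split => //; rewrite L2norm_lt_pinfty].
Qed.

Lemma Cmeas_cst (c : R[i]) : Cmeasurable (fun=> c).
Proof. by split; exact: measurable_cst. Qed.

Lemma CmeasD f g : Cmeasurable f -> Cmeasurable g -> Cmeasurable (fun x => f x + g x).
Proof.
move=> [fr fi] [gr gi]; split.
  under eq_fun do rewrite raddfD/=. exact: measurable_funD.
under eq_fun do rewrite raddfD/=. exact: measurable_funD.
Qed.

Lemma CmeasM f g : Cmeasurable f -> Cmeasurable g -> Cmeasurable (fun x => f x * g x).
Proof.
move=> [fr fi] [gr gi]; split.
  have -> : (fun x => complex.Re (f x * g x)) = (fun x => complex.Re (f x) * complex.Re (g x)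
     - complex.Im (f x) * complex.Im (g x)).
    by apply/funext => x; case: (f x) (g x) => [a b] [c e].
  by apply: measurable_funB; exact: measurable_funM.
have -> : (fun x => complex.Im (f x * g x)) = (fun x => complex.Re (f x) * complex.Im (g x)
     + complex.Im (f x) * complex.Re (g x)).
  by apply/funext => x; case: (f x) (g x) => [a b] [c e].
by apply: measurable_funD; exact: measurable_funM.
Qed.

Lemma CmeasJ f : Cmeasurable f -> Cmeasurable (fun x => (f x)^*%C).
Proof.
move=> [fr fi]; split.
  rewrite [X in measurable_fun _ X](_ : _ = fun x => complex.Re (f x))//.
  by apply/funext => x; case: (f x).
rewrite [X in measurable_fun _ X](_ : _ = fun x => - complex.Im (f x)).
  exact: measurableT_comp.
by apply/funext => x; case: (f x).
Qed.

Lemma CmeasZ c f : Cmeasurable f -> Cmeasurable (fun x => c * f x).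
Proof. by apply: CmeasM; exact: Cmeas_cst. Qed.

Lemma CmeasB f g : Cmeasurable f -> Cmeasurable g -> Cmeasurable (f - g).
Proof.
move=> mf mg; have -> : f - g = (fun x => f x + (-1) * g x).
  by apply/funext => x; rewrite !fctE mulN1r.
by apply: CmeasD => //; exact: CmeasZ.
Qed.

Lemma Cmeas_indic (A : set T) : measurable A -> Cmeasurable (fun x => (\1_A x)%:C%C).
Proof.
move=> mA; split; last exact: measurable_cst.
exact: measurable_indic.
Qed.

Lemma measurable_sqnormc f : Cmeasurable f -> measurable_fun setT (fun x => sqnormc (f x)).
Proof. by move=> [fr fi]; apply: measurable_funD; exact: measurable_funX. Qed.

Lemma measurable_sqnormcE f (D : set T) : measurable D -> Cmeasurable f ->
  measurable_fun D (fun x => (sqnormc (f x))%:E).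
Proof.
move=> mD mf; apply/measurable_EFinP; apply: measurable_funTS.
exact: measurable_sqnormc.
Qed.

(* This quasi-triangle inequality is enough for closures, so that Minkowski's
   inequality is never needed. *)
Lemma L2sqD_le f g : Cmeasurable f -> Cmeasurable g ->
  (L2sq (fun x => f x + g x)%R <= 2%:E * L2sq f + 2%:E * L2sq g)%E.
Proof.
move=> mf mg.
have m2 h : Cmeasurable h -> measurable_fun setT (fun x => (2%:E * (sqnormc (h x))%:E)%E).
  move=> mh; apply: measurable_funeM; exact: measurable_sqnormcE.
have Z h : Cmeasurable h -> (2%:E * L2sq h = \int[mu]_x (2%:E * (sqnormc (h x))%:E))%E.
  move=> mh; rewrite ge0_integralZl// ?lee_fin//; first exact: measurable_sqnormcE.
  by move=> x _; rewrite lee_fin sqnormc_ge0.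
rewrite !Z//.
rewrite -ge0_integralD//; last first.
- exact: m2.
- by move=> x _; rewrite -EFinM lee_fin mulr_ge0// sqnormc_ge0.
- exact: m2.
- by move=> x _; rewrite -EFinM lee_fin mulr_ge0// sqnormc_ge0.
apply: ge0_le_integral => //.
- by move=> x _; rewrite lee_fin sqnormc_ge0.
- by apply: measurable_sqnormcE => //; exact: CmeasD.
- by apply: emeasurable_funD; exact: m2.
- by move=> x _; rewrite -!EFinM -EFinD lee_fin sqnormcD_le.
Qed.

Lemma L2sqZ c f : Cmeasurable f ->
  L2sq (fun x => c * f x) = ((sqnormc c)%:E * L2sq f)%E.
Proof.
move=> mf; rewrite /L2sq -ge0_integralZl// ?lee_fin ?sqnormc_ge0//; last first.
- by move=> x _; rewrite lee_fin sqnormc_ge0.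
- exact: measurable_sqnormcE.
by apply: eq_integral => x _; rewrite sqnormcM EFinM.
Qed.

Lemma L2sqB f g : L2sq (f - g) = L2sq (g - f).
Proof. by apply: eq_integral => x _; rewrite !fctE sqnormcB. Qed.

Lemma L2sqB_le f g h : Cmeasurable f -> Cmeasurable g -> Cmeasurable h ->
  (L2sq (f - h)%R <= 2%:E * L2sq (f - g)%R + 2%:E * L2sq (g - h)%R)%E.
Proof.
move=> mf mg mh; apply: le_trans (L2sqD_le (CmeasB mf mg) (CmeasB mg mh)).
rewrite [X in (L2sq X <= _)%E](_ : _ = fun x => (f - g) x + (g - h) x)//.
by apply/funext => x; rewrite !fctE subrKA.
Qed.

Lemma L2sq_ae f g : Cmeasurable f -> Cmeasurable g -> {ae mu, forall x, f x = g x} ->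
  L2sq f = L2sq g.
Proof.
move=> mf mg fg; apply: ge0_ae_eq_integral => //.
- exact: measurable_sqnormcE.
- exact: measurable_sqnormcE.
- by move=> x _; rewrite lee_fin sqnormc_ge0.
- by move=> x _; rewrite lee_fin sqnormc_ge0.
by apply: filterS fg => x -> _.
Qed.

Lemma L2sq0 : L2sq (fun=> 0) = 0%E.
Proof. by rewrite /L2sq; apply: integral0_eq => x _; rewrite sqnormc0. Qed.

Lemma L2_lin c f g : L2 mu f -> L2 mu g -> L2 mu (fun x => c * f x + g x).
Proof.
move=> /L2P[mf ff] /L2P[mg gf]; apply/L2P; split.
  by apply: CmeasD => //; exact: CmeasZ.
apply: le_lt_trans (L2sqD_le (CmeasZ c mf) mg) _.
rewrite L2sqZ//; move: ff gf (L2sq_ge0 f) (L2sq_ge0 g).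
by case: (L2sq f) (L2sq g) => [a| |]// [b| |]// _ _ _ _; rewrite ltry.
Qed.

Lemma L2_0 : L2 mu (cst 0).
Proof.
apply/L2P; split; first exact: Cmeas_cst.
by rewrite [L2sq _]L2sq0.
Qed.

Lemma L2closureP S f : L2closure mu S f <->
  L2 mu f /\ forall e : R, 0 < e -> exists2 g, S g & (L2sq (f - g)%R < e%:E)%E.
Proof.
split=> -[Lf H]; split => // e e0.
  have se0 : 0 < Num.sqrt e by rewrite sqrtr_gt0.
  have [g Sg] := H _ se0; rewrite L2norm_lt// sqr_sqrtr ?ltW// => ge.
  by exists g.
have [g Sg ge] := H _ (exprn_gt0 2 e0); exists g => //.
by rewrite L2norm_lt.
Qed.

Lemma closed_span_closed S : S `<=` L2 mu -> closed_subspace mu (closed_span mu S).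
Proof.
move=> SL2.
have spanL2 : lin_span S `<=` L2 mu.
  move=> f [n [c [b [Sb ->]]]]; elim: n c b Sb => [|n IH] c b Sb.
    by under eq_fun do rewrite big_ord0; exact: L2_0.
  under eq_fun do rewrite big_ord_recl; apply: L2_lin; first exact/SL2/Sb.
  by apply: IH => i; exact: Sb.
have span_lin c f g : lin_span S f -> lin_span S g -> lin_span S (fun x => c * f x + g x).
  move=> [n [cf [bf [Sf ->]]]] [m [cg [bg [Sg ->]]]].
  exists (n + m)%N, (fun i : 'I_(n + m) => match fintype.split i with inl j => c * cf j |
    inr j => cg j end),
    (fun i : 'I_(n + m) => match fintype.split i with inl j => bf j | inr j => bg j end); split.
    by move=> i; case: (fintype.split i).
  apply/funext => x; rewrite big_split_ord/= mulr_sumr; congr (_ + _).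
    by apply: eq_bigr => i _; rewrite (unsplitK (inl i)) mulrA.
  by apply: eq_bigr => i _; rewrite (unsplitK (inr i)).
split.
- by move=> f [].
- apply/L2closureP; split; first exact: L2_0.
  move=> e e0; exists (cst 0).
    by exists 0%N, (fun=> 0), (fun=> cst 0); split; [case|apply/funext => x; rewrite big_ord0].
  by rewrite subrr [L2sq _]L2sq0 lte_fin.
- move=> c f g /L2closureP[Lf Hf] /L2closureP[Lg Hg]; apply/L2closureP; split.
    exact: L2_lin.
  move=> e e0.
  (* If a < e / (4(|c|^2 + 1)) and b < e / 4, then 2|c|^2 a + 2b < e; the summand 1 covers c = 0. *)
  have k0 : 0 < 4 * (sqnormc c + 1) by rewrite mulr_gt0// ltr_wpDl// sqnormc_ge0.
  have [f' Sf' ff'] := Hf _ (divr_gt0 e0 k0).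
  have [g' Sg' gg'] := Hg _ (divr_gt0 e0 (ltr0n _ 4)).
  exists (fun x => c * f' x + g' x); first exact: span_lin.
  have mf : Cmeasurable (f - f') by apply: CmeasB; [have /L2P[] := Lf|have /L2P[] := spanL2
    _ Sf'].
  have mg : Cmeasurable (g - g') by apply: CmeasB; [have /L2P[] := Lg|have /L2P[] := spanL2
    _ Sg'].
  have -> : (fun x => c * f x + g x) - (fun x => c * f' x + g' x) =
            (fun x => c * (f - f') x + (g - g') x).
    by apply/funext => x; rewrite !fctE; ring.
  apply: le_lt_trans (L2sqD_le (CmeasZ c mf) mg) _; rewrite L2sqZ//.
  move: (L2sq_ge0 (f - f')) (L2sq_ge0 (g - g')) ff' gg'.
  case: (L2sq (f - f')) => [a| |]//; case: (L2sq (g - g')) => [b| |]//.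
  rewrite !lee_fin !lte_fin => a0 b0; rewrite ltr_pdivlMr// => ae be.
  have : (sqnormc c + 1) * a <= e / 4 by lra.
  have := sqnormc_ge0 c; nra.
- move=> f /L2closureP[Lf Hf]; apply/L2closureP; split => // e e0.
  have e4 : 0 < e / 4 by rewrite divr_gt0.
  have [g /L2closureP[Lg Hg] fg] := Hf _ e4.
  have [k Sk gk] := Hg _ e4; exists k => //.
  have /L2P[mf _] := Lf; have /L2P[mg _] := Lg; have /L2P[mk _] := spanL2 _ Sk.
  apply: le_lt_trans (L2sqB_le mf mg mk) _.
  move: (L2sq_ge0 (f - g)) (L2sq_ge0 (g - k)) fg gk.
  case: (L2sq (f - g)) => [a| |]//; case: (L2sq (g - k)) => [b| |]//.
  by rewrite !lee_fin !lte_fin => *; lra.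
Qed.

Lemma sub_closed_span S : S `<=` L2 mu -> S `<=` closed_span mu S.
Proof.
move=> SL f Sf; apply/L2closureP; split; first exact: SL.
move=> e e0; exists f; last by rewrite subrr [L2sq _]L2sq0 lte_fin.
exists 1%N, (fun=> 1), (fun=> f); split => //.
by apply/funext => x; rewrite big_ord1 mul1r.
Qed.

Lemma lin_span_sub S V : closed_subspace mu V -> S `<=` V -> lin_span S `<=` V.
Proof.
move=> [_ V0 Vlin _] SV f [n [c [b [Sb ->]]]]; elim: n c b Sb => [|n IH] c b Sb.
  by under eq_fun do rewrite big_ord0.
under eq_fun do rewrite big_ord_recl; apply: Vlin; first exact/SV/Sb.
by apply: IH => i; exact: Sb.
Qed.

Lemma L2closureS S V : S `<=` V -> L2closure mu S `<=` L2closure mu V.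
Proof.
move=> SV f [Lf Hf]; split => // e e0.
by have [g Sg fg] := Hf e e0; exists g => //; exact: SV.
Qed.

Lemma closed_span_sub S V : closed_subspace mu V -> S `<=` V -> closed_span mu S `<=` V.
Proof.
move=> cV SV; have [_ _ _ cl] := cV.
by apply: (subset_trans _ cl); apply: L2closureS; exact: lin_span_sub.
Qed.

(** Elements of L_2 are functions rather than classes; closedness absorbs a change on a null set,
    because the L_2 distance is then zero. *)
Lemma closed_subspace_ae V f g : closed_subspace mu V -> V f -> L2 mu g ->
  {ae mu, forall x, g x = f x} -> V g.
Proof.
move=> [VL _ _ cl] Vf Lg gf; apply/cl/L2closureP; split => // e e0; exists f => //.
have /L2P[mf _] := VL _ Vf; have /L2P[mg _] := Lg.
have gf0 : {ae mu, forall x, (g - f) x = 0}.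
  by apply: filterS gf => x; rewrite !fctE => ->; rewrite subrr.
rewrite (L2sq_ae (CmeasB mg mf) (Cmeas_cst 0) gf0) L2sq0 lte_fin//.
Qed.

Lemma closed_subspace_sum V (I : Type) (s : seq I) (c : I -> R[i]) (b : I -> T -> R[i]) :
  closed_subspace mu V -> (forall i, V (b i)) -> V (fun x => \sum_(i <- s) c i * b i x).
Proof.
move=> [_ V0 Vlin _] Vb; elim: s => [|i s IH].
  by under eq_fun do rewrite big_nil.
by under eq_fun do rewrite big_cons; exact: Vlin.
Qed.

End ComplexL2.

(** * Complex integrals and density *)

Section ComplexIntegral.
Context {d : measure_display} {T : measurableType d} {R : realType}.
Variable mu : {measure set T -> \bar R}.
Implicit Types (f g : T -> R[i]) (D E : set T).

Definition Cintegrable D f : Prop :=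
  mu.-integrable D (fun x => (complex.Re (f x))%:E) /\
  mu.-integrable D (fun x => (complex.Im (f x))%:E).

Lemma eq_Cintegral D f g : (forall x, D x -> f x = g x) ->
  Cintegral mu D f = Cintegral mu D g.
Proof.
by move=> fg; congr (_ +i* _)%C; apply: eq_Rintegral => x /set_mem Dx; rewrite fg.
Qed.

Lemma CintegrableD D f g : measurable D -> Cintegrable D f -> Cintegrable D g ->
  Cintegrable D (fun x => f x + g x).
Proof.
move=> mD [fr fi] [gr gi]; split.
  by under eq_fun do rewrite raddfD/= EFinD; exact: integrableD.
by under eq_fun do rewrite raddfD/= EFinD; exact: integrableD.
Qed.

Lemma CintegralD D f g : measurable D -> Cintegrable D f -> Cintegrable D g ->
  Cintegral mu D (fun x => f x + g x) = Cintegral mu D f + Cintegral mu D g.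
Proof.
move=> mD [fr fi] [gr gi]; rewrite /Cintegral; apply/eqP; rewrite eq_complex/=; apply/andP;
  split; apply/eqP.
  by under eq_Rintegral do rewrite raddfD/=; rewrite RintegralD.
by under eq_Rintegral do rewrite raddfD/=; rewrite RintegralD.
Qed.

Lemma ReM (z w : R[i]) : complex.Re (z * w) =
  complex.Re z * complex.Re w - complex.Im z * complex.Im w.
Proof. by case: z w => [a b] [c e]. Qed.

Lemma ImM (z w : R[i]) : complex.Im (z * w) =
  complex.Re z * complex.Im w + complex.Im z * complex.Re w.
Proof. by case: z w => [a b] [c e]. Qed.

Lemma CintegrableZ D c f : measurable D -> Cintegrable D f ->
  Cintegrable D (fun x => c * f x).
Proof.
move=> mD [fr fi]; split.
  under eq_fun do rewrite ReM EFinB !EFinM.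
  by apply: integrableB => //; exact: integrableZl.
under eq_fun do rewrite ImM EFinD !EFinM.
by apply: integrableD => //; exact: integrableZl.
Qed.

Lemma CintegralZ D c f : measurable D -> Cintegrable D f ->
  Cintegral mu D (fun x => c * f x) = c * Cintegral mu D f.
Proof.
move=> mD [fr fi]; rewrite /Cintegral.
have Zr k : mu.-integrable D (EFin \o (fun x => k * complex.Re (f x))).
  exact: (@integrableZl _ _ _ mu D mD k (fun x => (complex.Re (f x))%:E)).

have Zi k : mu.-integrable D (EFin \o (fun x => k * complex.Im (f x))).
  exact: (@integrableZl _ _ _ mu D mD k (fun x => (complex.Im (f x))%:E)).

apply/eqP; rewrite eq_complex ReM ImM /=; apply/andP; split; apply/eqP.
  under eq_Rintegral do rewrite ReM.
  by rewrite RintegralB// !RintegralZl.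
under eq_Rintegral do rewrite ImM.
by rewrite RintegralD// !RintegralZl.
Qed.

Lemma Cintegrable0 D : Cintegrable D (fun=> 0).
Proof. by split; exact: integrable0. Qed.

Lemma Cintegral0 D : Cintegral mu D (fun=> 0) = 0.
Proof. by rewrite /Cintegral /Rintegral integral0. Qed.

Lemma Cintegrable_sum (I : Type) (s : seq I) D (F : I -> T -> R[i]) : measurable D ->
  (forall i, Cintegrable D (F i)) -> Cintegrable D (fun x => \sum_(i <- s) F i x).
Proof.
move=> mD iF; elim: s => [|i s IH].
  by under eq_fun do rewrite big_nil; exact: Cintegrable0.
by under eq_fun do rewrite big_cons; exact: CintegrableD.
Qed.

Lemma Cintegral_sum (I : Type) (s : seq I) D (F : I -> T -> R[i]) : measurable D ->
  (forall i, Cintegrable D (F i)) ->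
  Cintegral mu D (fun x => \sum_(i <- s) F i x) = \sum_(i <- s) Cintegral mu D (F i).
Proof.
move=> mD iF; elim: s => [|i s IH].
  by under eq_fun do rewrite big_nil; rewrite big_nil Cintegral0.
under eq_fun do rewrite big_cons; rewrite big_cons CintegralD ?IH//.
exact: Cintegrable_sum.
Qed.

Lemma Cintegral_cst D c : measurable D -> 
  Cintegral mu D (fun=> c) = c * (fine (mu D))%:C%C.
Proof.
move=> mD; rewrite /Cintegral !Rintegral_cst//; case: c => a b /=.
by apply/eqP; rewrite eq_complex/= !mulr0 subr0 add0r !eqxx.
Qed.

Lemma Cintegral_mkcond D E f : D `<=` E ->
  Cintegral mu D f = Cintegral mu E (fun x => f x * (\1_D x)%:C%C).
Proof.
move=> DE; have restrict (h : T -> R) : \int[mu]_(x in D) h x = \int[mu]_(x in E) (h \_ D) x.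
  by rewrite -Rintegral_mkcondr (setIidr DE).
rewrite /Cintegral !restrict; congr (_ +i* _)%C; apply: eq_Rintegral => x _;
  by rewrite patchE indicE rmorph_nat; case: (x \in D); rewrite ?mulr1 ?mulr0.
Qed.

(** The domination is phrased with squares so that it can be fed directly with bounds on
    [sqnormc]. *)
Lemma le_Cintegrable D f (k : T -> R) : measurable D -> Cmeasurable f ->
  mu.-integrable D (EFin \o k) ->
  (forall x, D x -> 0 <= k x /\ sqnormc (f x) <= k x ^+ 2) -> Cintegrable D f.
Proof.
move=> mD [mr mi] ik fk.
have le a b : 0 <= b -> a ^+ 2 <= b ^+ 2 -> `|a| <= `|b| :> R.
  by move=> b0 ab; rewrite -ler_sqr ?nnegrE// !real_normK// num_real.
split; apply: (le_integrable mD _ _ ik).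
- by apply/measurable_EFinP/measurable_funTS.
- move=> x Dx; rewrite !abse_EFin lee_fin; have [k0 kx] := fk x Dx; apply: le => //.
  by apply: le_trans kx; rewrite /sqnormc lerDl sqr_ge0.
- by apply/measurable_EFinP/measurable_funTS.
- move=> x Dx; rewrite !abse_EFin lee_fin; have [k0 kx] := fk x Dx; apply: le => //.
  by apply: le_trans kx; rewrite /sqnormc lerDr sqr_ge0.
Qed.

Lemma integrable_cst_fin D (r : R) : measurable D -> (mu D < +oo)%E ->
  mu.-integrable D (fun=> r%:E).
Proof.
move=> mD Dfin; apply/integrableP; split; first exact: measurable_cst.
by rewrite (integral_cst mu mD `|r|%:E) lte_mul_pinfty.
Qed.

Lemma Cintegrable_bounded D f (M : R) : measurable D -> (mu D < +oo)%E -> Cmeasurable f ->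
  (forall x, D x -> sqnormc (f x) <= M) -> Cintegrable D f.
Proof.
move=> mD Dfin mf fM; apply: (@le_Cintegrable _ _ (fun=> 1 + `|M|)) => //.
  exact: integrable_cst_fin.
move=> x Dx; split; first by rewrite addr_ge0.
apply: (le_trans (fM x Dx)); apply: (le_trans (ler_norm _)).
have := normr_ge0 M; nra.
Qed.

Lemma integrable_sqnormc f : L2 mu f -> mu.-integrable setT (fun x => (sqnormc (f x))%:E).
Proof.
move=> /L2P[mf ff]; apply/integrableP; split; first exact: measurable_sqnormcE.
under eq_integral do rewrite abse_EFin ger0_norm ?sqnormc_ge0//.
exact: ff.
Qed.

Lemma Cintegrable_L2 D f : measurable D -> (mu D < +oo)%E -> L2 mu f -> Cintegrable D f.
Proof.
move=> mD Dfin Lf; have /L2P[mf _] := Lf.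
(* The bound is t <= (1 + t)^2; the constant 1 is integrable because [D] has finite measure. *)
apply: (@le_Cintegrable _ _ (fun x => 1 + sqnormc (f x))) => //.
  rewrite (_ : _ \o _ = cst 1%E \+ (fun x => (sqnormc (f x))%:E))%E//.
  apply: integrableD => //; last first.
    by apply: integrableS (integrable_sqnormc Lf).
  exact: (integrable_cst_fin 1).
move=> x _; have := sqnormc_ge0 (f x) => f0; split; first exact: addr_ge0.
nra.
Qed.

Lemma Cintegrable_inner f g : L2 mu f -> L2 mu g ->
  Cintegrable setT (fun x => f x * (g x)^*%C).
Proof.
move=> Lf Lg; have /L2P[mf _] := Lf; have /L2P[mg _] := Lg.
apply: (@le_Cintegrable _ _ (fun x => sqnormc (f x) + sqnormc (g x))) => //.
- by apply: CmeasM => //; exact: CmeasJ.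
- rewrite (_ : _ \o _ = (fun x => (sqnormc (f x))%:E) \+ (fun x => (sqnormc (g x))%:E))%E//.
  by apply: integrableD => //; exact: integrable_sqnormc.
move=> x _; have := sqnormc_ge0 (f x); have := sqnormc_ge0 (g x) => g0 f0.
split; first exact: addr_ge0.
have -> : sqnormc (f x * (g x)^*%C) = sqnormc (f x) * sqnormc (g x).
  by rewrite sqnormcM; congr (_ * _); case: (g x) => a b; rewrite /sqnormc /= sqrrN.
nra.
Qed.

Lemma Cintegral_ae f g : Cmeasurable f -> Cmeasurable g ->
  {ae mu, forall x, f x = g x} -> Cintegral mu setT f = Cintegral mu setT g.
Proof.
move=> [fr fi] [gr gi] fg; rewrite /Cintegral /Rintegral; congr (fine _ +i* fine _)%C.
  apply: ae_eq_integral => //; try exact/measurable_EFinP.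
  by apply: filterS fg => x -> _.
apply: ae_eq_integral => //; try exact/measurable_EFinP.
by apply: filterS fg => x -> _.
Qed.

(** For nonnegative functions this is integration against the pushforward measure, which equals
    [mu]; the general case splits into positive and negative parts. *)
Lemma integral_invariant (t : T -> T) D (f : T -> \bar R) : measurable_fun setT t ->
  (forall A, measurable A -> mu (t @^-1` A) = mu A) -> measurable D ->
  measurable_fun setT f ->
  (\int[mu]_(x in D) f x = \int[mu]_(x in t @^-1` D) f (t x))%E.
Proof.
move=> mt tmu mD mf.
have ge0 (h : T -> \bar R) : measurable_fun setT h -> (forall x, 0 <= h x)%E ->
    (\int[mu]_(x in D) h x = \int[mu]_(x in t @^-1` D) h (t x))%E.
  move=> mh h0; rewrite -[RHS]ge0_integral_pushforward//; last exact: measurable_funTS.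
  by apply: eq_measure_integral => A mA _; rewrite -[LHS]tmu.
rewrite integralE [RHS]integralE; congr (_ - _)%E.
  rewrite (ge0 f^\+%E (measurable_funepos mf) (fun x => funepos_ge0 f x)).
  by apply: eq_integral => x _; rewrite !funeposE.
rewrite (ge0 f^\-%E (measurable_funeneg mf) (fun x => funeneg_ge0 f x)).
by apply: eq_integral => x _; rewrite !funenegE.
Qed.

Lemma Cintegral_invariant (t : T -> T) D f : measurable_fun setT t ->
  (forall A, measurable A -> mu (t @^-1` A) = mu A) -> measurable D -> Cmeasurable f ->
  Cintegral mu D f = Cintegral mu (t @^-1` D) (f \o t).
Proof.
move=> mt tmu mD [mr mi]; rewrite /Cintegral /Rintegral; congr (fine _ +i* fine _)%C.
  by rewrite (integral_invariant mt tmu)//; exact/measurable_EFinP.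
by rewrite (integral_invariant mt tmu)//; exact/measurable_EFinP.
Qed.

End ComplexIntegral.

(** * Closed subspaces containing the indicators of a generating pi-system *)

Section Density.
Import HBSimple HBNNSimple.
Context {d : measure_display} {T : measurableType d} {R : realType}.
Variable mu : {measure set T -> \bar R}.
Variables (G : set (set T)) (E : nat -> set T).
Hypothesis GE : @measurable d T = <<s G >>.
Hypothesis GI : setI_closed G.
Hypothesis EG : forall n, G (E n).
Hypothesis Efin : forall n, (mu (E n) < +oo)%E.
Hypothesis Eincr : nondecreasing_seq E.
Hypothesis Ecover : \bigcup_n E n = setT.
Variable W : set (T -> R[i]).
Hypothesis cW : closed_subspace mu W.
Hypothesis WG : forall A, G A -> W (fun x => (\1_A x)%:C%C).

Let mG A : G A -> measurable A.
Proof. by move=> GA; rewrite GE; exact: sub_sigma_algebra. Qed.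

Let W0 : W (cst 0). Proof. by case: cW. Qed.

Let Wlin c f g : W f -> W g -> W (fun x => c * f x + g x).
Proof. by case: cW => _ _ h _; exact: h. Qed.

(** Dynkin induction on [A]. Intersecting with [E n] keeps all measures finite: complements become
    differences of indicators, and a countable disjoint union is an L_2 limit of finite ones by
    continuity of the measure from below. *)
Lemma closed_subspace_indic_trace n A : measurable A -> W (fun x => (\1_(A `&` E n) x)%:C%C).
Proof.
rewrite GE => sA; apply: (@dynkin_induction _ _ G (fun A => W (fun x => (\1_(A `&` E n)
  x)%:C%C)) GE GI _ _ _ _ A sA).
- by rewrite setTI; exact/WG.
- by move=> B GB; apply/WG/GI.
- move=> B mB WB.
  rewrite (_ : (fun _ => _) = (fun x => (-1) * (\1_(B `&` E n) x)%:C%C + (\1_(E n) x)%:C%C)).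
    by apply: Wlin => //; exact: WG.
  apply/funext => x; rewrite !indicE !in_setI in_setC.
  by case: (x \in B); case: (x \in E n) => //=; rewrite ?mulr0 ?mulr1 ?addr0 ?add0r// addNr.
move=> F mF tF WF.
have mE := mG (EG n).
set U := \bigcup_k F k `&` E n; pose B m := \bigcup_(k < m) F k `&` E n.
have mU : measurable U by apply: measurableI => //; exact: bigcup_measurable.
have mB m : measurable (B m) by apply: measurableI => //; exact: bigcup_measurable.
have WB m : W (fun x => (\1_(B m) x)%:C%C).
  elim: m => [|m IH].
    rewrite (_ : (fun _ => _) = cst 0)//; apply/funext => x.
    by rewrite /B bigcup_mkord big_ord0 set0I indic0.
  rewrite (_ : (fun _ => _) = fun x => 1 * (\1_(F m `&` E n) x)%:C%C + (\1_(B m) x)%:C%C).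
    exact: Wlin.
  apply/funext => x; rewrite mul1r /B !bigcup_mkord big_ord_recr/= -bigcup_mkord !indicE.
  rewrite !in_setI in_setU; have [xE|] := boolP (x \in E n); last by rewrite !andbF addr0.
  rewrite !andbT; have [xF|] := boolP (x \in F m); rewrite ?orbT ?orbF ?add0r//.
  case: (boolP (x \in \bigcup_(k < m) F k)) => [/set_mem[k /= km Fk]|]; last by rewrite addr0.
  have mk : m = k by apply: (tF m k I I); exists x; split => //; exact: set_mem.
  by rewrite mk ltnn in km.
have [_ _ _ cl] := cW; apply/cl/L2closureP.
have sqB (C : set T) : measurable C -> L2sq mu (fun x => (\1_C x)%:C%C) = mu C.
  move=> mC; rewrite -[in RHS](setIT C) -integral_indic//; apply: eq_integral => x _.
  by rewrite /sqnormc /= expr0n addr0 indicE; case: (x \in C); rewrite ?expr1n ?expr0n.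
have Ufin : (mu U < +oo)%E.
  by apply: le_lt_trans (Efin n); apply: le_measure; rewrite ?inE//; exact: subIsetr.
split.
  by apply/L2P; split; [exact: Cmeas_indic|rewrite sqB].
move=> e e0.
have cvgB : mu (B m) @[m --> \oo] --> mu (\bigcup_m B m).
  apply: nondecreasing_cvg_mu => //; first exact: bigcup_measurable.
  move=> a b ab; apply/subsetPset => x [[k /= ka Fk] Ex]; split => //; exists k => //=.
  exact: leq_trans ab.
have UB : \bigcup_m B m = U.
  apply/seteqP; split => x.
    by move=> [m _ [[k _ Fk] Ex]]; split => //; exists k.
  by move=> [[k _ Fk] Ex]; exists k.+1 => //; split => //; exists k => /=.
rewrite UB in cvgB.
have Uf : mu U \is a fin_num by rewrite ge0_fin_numE.
have : \forall m \near \oo, ((fine (mu U) - e)%:E < mu (B m))%E.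
  apply: (cvgB [set y | ((fine (mu U) - e)%:E < y)%E]); rewrite -[X in nbhs X](fineK Uf).
  by apply: (@nbhs_open_ereal_gt _ _ (fun x => x - e)); rewrite ltrBlDr ltrDl.
move=> [m _ /(_ m (leqnn m)) mBm]; exists (fun x => (\1_(B m) x)%:C%C); first exact: WB.
have BU : B m `<=` U by rewrite -UB; exact: bigcup_sup.
rewrite (_ : _ - _ = fun x => (\1_(U `\` B m) x)%:C%C); last first.
  apply/funext => x; rewrite !fctE !indicE in_setD.
  have [xB|] := boolP (x \in B m); rewrite ?andbT ?andbF ?subr0//.
  by rewrite (_ : x \in U = true) ?subrr//; apply/mem_set/BU/set_mem.
rewrite sqB; last exact: measurableD.
have -> : mu (U `\` B m) = (mu U - mu (B m))%E by rewrite measureD// (setIidr BU).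
have Bf : mu (B m) \is a fin_num.
  by rewrite ge0_fin_numE//; apply: le_lt_trans Ufin; apply: le_measure; rewrite ?inE.
move: Uf Bf mBm; case: (mu U) => [a| |]//; case: (mu (B m)) => [b| |]// _ _.
by rewrite -EFinB !lte_fin /=; lra.
Qed.

Lemma closed_subspace_nnsfun n (h : {nnsfun T >-> R}) :
  W (fun x => (h x * \1_(E n) x)%:C%C).
Proof.
rewrite (_ : (fun _ => _) = fun x => \sum_(y <- finmap.enum_fset (fset_set (range h)))
   y%:C%C * (\1_(h @^-1` [set y] `&` E n) x)%:C%C).
  elim: (X in W (fun x => \sum_(y <- X) _)) => [|y s IH].
    by under eq_fun do rewrite big_nil.
  under eq_fun do rewrite big_cons; apply: Wlin => //.
  exact: closed_subspace_indic_trace.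
apply/funext => x; rewrite {1}(fimfunE h x) fsbig_finite//= mulr_suml.
rewrite rmorph_sum; apply: eq_bigr => y _; rewrite -rmorphM/= -mulrA; congr (_%:C)%C.
by rewrite !indicE in_setI -natrM mulnb.
Qed.

(** Simple functions increasing to [g], cut off to [E n], satisfy 0 <= u <= g, so (g - u)^2 is
    dominated by the integrable g^2 and tends to zero pointwise. *)
Lemma closed_subspace_nneg (g : T -> R) : measurable_fun setT g -> (forall x, 0 <= g x) ->
  (\int[mu]_x (g x ^+ 2)%:E < +oo)%E -> W (fun x => (g x)%:C%C).
Proof.
move=> mg g0 gfin.
have mEg : measurable_fun setT (EFin \o g) by exact/measurable_EFinP.
have g0' x : (0 <= (EFin \o g) x)%E by rewrite lee_fin.
pose u (n : nat) x := nnsfun_approx measurableT mEg n x * \1_(E n) x.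
have Wu n : W (fun x => (u n x)%:C%C) by exact: closed_subspace_nnsfun.
have [_ _ _ cl] := cW; apply/cl/L2closureP; split.
  apply/L2P; split; first by split => //; exact: measurable_cst.
  rewrite /L2sq; under eq_integral do rewrite /sqnormc /= expr0n addr0.
  exact: gfin.
have apx n x : 0 <= nnsfun_approx measurableT mEg n x <= g x.
  rewrite fun_ge0/= -lee_fin nnsfun_approxE.
  exact: (le_approx n (fun y _ => g0' y)).
have ug n x : 0 <= u n x <= g x.
  have /andP[a b] := apx n x; rewrite /u indicE; case: (x \in E n); rewrite ?mulr1 ?a//.
  by rewrite mulr0 lexx g0.
have ucvg x : u n x @[n --> \oo] --> g x.
  have [k _ Ek] : (\bigcup_n E n) x by rewrite Ecover.
  have : nnsfun_approx measurableT mEg n x @[n --> \oo] --> g x.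
    have := @cvg_nnsfun_approx _ _ _ _ measurableT _ mEg (fun x _ => g0' x) x I.
    by move=> /fine_cvgP[].
  apply: cvg_trans; apply: near_eq_cvg; exists k => // n /= kn.
  rewrite /u indicE mem_set ?mulr1//.
  by have /subsetPset := Eincr kn; exact.
have : (\int[mu]_x ((g x - u n x) ^+ 2)%:E)%E @[n --> \oo] --> (\int[mu]_x 0)%E.
  have mE n := mG (EG n).
  apply: (@dominated_cvg _ _ _ mu setT measurableT (fun n x => ((g x - u n x) ^+ 2)%:E) _
    (fun x => (g x ^+ 2)%:E)) => //.
  - move=> n; apply/measurable_EFinP; apply: measurable_funX; apply: measurable_funB => //.
    exact: measurable_funM.
  - move=> x _; apply: cvg_EFin; first exact: nearW.
    have -> : 0 = (g x - g x) ^+ 2 :> R by rewrite subrr expr0n.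
    have cv : (fun n => g x - u n x) @ \oo --> g x - g x by apply: cvgB => //; exact: cvg_cst.
    exact: (cvgM cv cv).
  - apply/integrableP; split; first by apply/measurable_EFinP; exact: measurable_funX.
    by under eq_integral do rewrite abse_EFin ger0_norm ?sqr_ge0//.
  - move=> n x _; rewrite abse_EFin ger0_norm ?sqr_ge0// lee_fin.
    have /andP[a b] := ug n x; nra.
rewrite integral0 => cv e e0.
have [m _ /(_ m (leqnn m)) /= H] : \forall n \near \oo, (\int[mu]_x ((g x - u n x) ^+ 2)%:E
  < e%:E)%E.
  by apply: (cv [set y | (y < e%:E)%E]); exact: (@nbhs_open_ereal_lt _ 0 (fun=> e)).
exists (fun x => (u m x)%:C%C) => //.
rewrite /L2sq; under eq_integral do rewrite !fctE /sqnormc /= subrr expr0n addr0.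
exact: H.
Qed.

(** A complex function is a combination of its real and imaginary parts, and each of these is a
    difference of two nonnegative functions of no larger square. *)
Lemma closed_subspace_dense : W = L2 mu.
Proof.
apply/seteqP; split; first by case: cW.
move=> f /L2P[[mr mi] ff].
have fin (k : T -> R) : measurable_fun setT k -> (forall x, k x ^+ 2 <= sqnormc (f x)) ->
    (\int[mu]_x (k x ^+ 2)%:E < +oo)%E.
  move=> mk kf; apply: le_lt_trans ff; apply: ge0_le_integral => //.
  - by move=> x _; rewrite lee_fin sqr_ge0.
  - by apply/measurable_EFinP; exact: measurable_funX.
  - exact: measurable_sqnormcE.
  - by move=> x _; rewrite lee_fin.
pose r x := complex.Re (f x); pose i x := complex.Im (f x).
have real (k : T -> R) : measurable_fun setT k -> (forall x, k x ^+ 2 <= sqnormc (f x)) ->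
    W (fun x => (k x)%:C%C).
  move=> mk kf.
  have -> : (fun x => (k x)%:C%C) = fun x => (-1) * (Num.max (- k x) 0)%:C%C + (Num.max (k
    x) 0)%:C%C.
    apply/funext => x; rewrite mulN1r -rmorphN -rmorphD; congr (_%:C)%C.
    by case: (lerP 0 (k x)); case: (lerP 0 (- k x)); lra.
  apply: Wlin; apply: closed_subspace_nneg.
  - by apply: measurable_maxr => //; exact: measurableT_comp.
  - by move=> x; rewrite le_max lexx orbT.
  - apply: fin => [|x]; first by apply: measurable_maxr => //; exact: measurableT_comp.
    apply: le_trans (kf x); case: (lerP 0 (- k x)) => _; rewrite ?sqrrN// expr0n sqr_ge0//.
  - by apply: measurable_maxr.
  - by move=> x; rewrite le_max lexx orbT.
  - apply: fin => [|x]; first by apply: measurable_maxr.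
    apply: le_trans (kf x); case: (lerP 0 (k x)) => _; rewrite // expr0n sqr_ge0//.
have -> : f = fun x => 'i%C * (i x)%:C%C + (r x)%:C%C.
  apply/funext => x; rewrite /i /r; case: (f x) => a b /=; apply/eqP.
  by simpc.
apply: (@Wlin 'i%C (fun x => (i x)%:C%C) (fun x => (r x)%:C%C)); apply: real => // x;
  rewrite /sqnormc.
  by rewrite lerDr sqr_ge0.
by rewrite lerDl sqr_ge0.
Qed.

End Density.

(** * Orthogonality to a spanning set *)

Section Orthogonality.
Context {d : measure_display} {T : measurableType d} {R : realType}.
Variable mu : {measure set T -> \bar R}.
Implicit Types (f g : T -> R[i]) (S : set (T -> R[i])).

Lemma sqnormcB_expand (z w : R[i]) :
  sqnormc (z - w) = sqnormc z + (sqnormc w - 2 * complex.Re (z * w^*%C)).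
Proof. by case: z w => [a b] [c e]; rewrite /sqnormc /=; ring. Qed.

Lemma L2sq_pythagoras f g : L2 mu f -> L2 mu g ->
  Cintegral mu setT (fun x => f x * (g x)^*%C) = 0 -> (L2sq mu f <= L2sq mu (f - g)%R)%E.
Proof.
move=> Lf Lg fg0; have [ir _] := Cintegrable_inner Lf Lg.
have if_ := integrable_sqnormc Lf; have ig := integrable_sqnormc Lg.
have re0 : (\int[mu]_x (complex.Re (f x * (g x)^*%C))%:E = 0)%E.
  have [r0 _] : 0 = (Cintegral mu setT (fun x => f x * (g x)^*%C)) by rewrite fg0.
  by move: r0; rewrite /Rintegral -(fineK (integrable_fin_num measurableT ir)) /= => <-.
have -> : (L2sq mu (f - g)%R = L2sq mu f + L2sq mu g)%E.
  rewrite /L2sq.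
  have i2 : mu.-integrable setT (fun x => (2%:E * (complex.Re (f x * (g x)^*%C))%:E)%E).
    exact: integrableZl.
  under eq_integral do rewrite !fctE sqnormcB_expand EFinD EFinB EFinM.
  rewrite integralD//; last exact: integrableB.
  by rewrite integralB// integralZl// re0 mule0 sube0.
by rewrite leeDl// L2sq_ge0.
Qed.

Lemma conjCM (z w : R[i]) : (z * w)^*%C = z^*%C * w^*%C.
Proof. exact: rmorphM. Qed.

Lemma conjC_sum (I : Type) (s : seq I) (F : I -> R[i]) :
  (\sum_(i <- s) F i)^*%C = \sum_(i <- s) (F i)^*%C.
Proof. exact: rmorph_sum. Qed.

(** An [f] orthogonal to [S] is orthogonal to each approximant g from the linear span, so by
    Pythagoras its norm is at most that of f - g, which is arbitrarily small. *)
Lemma orthogonal_closed_span_ae0 S f : S `<=` L2 mu -> closed_span mu S f ->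
  (forall b, S b -> Cintegral mu setT (fun x => f x * (b x)^*%C) = 0) ->
  {ae mu, forall x, f x = 0}.
Proof.
move=> SL /L2closureP[Lf Hf] orth; have /L2P[mf _] := Lf.
have SL' : lin_span S `<=` L2 mu.
  have cL := closed_span_closed SL; have [VL _ _ _] := cL.
  apply: subset_trans VL; apply: lin_span_sub cL _.
  exact: sub_closed_span.
have f0 : L2sq mu f = 0%E.
  apply/eqP; rewrite eq_le L2sq_ge0 andbT; apply/lee_addgt0Pr => e e0; rewrite add0e.
  have [g Sg /ltW] := Hf e e0; apply: le_trans; apply: L2sq_pythagoras => //.
    exact: SL'.
  have [n [c [b [Sb ->]]]] := Sg.
  rewrite (eq_Cintegral mu (g := fun x => \sum_i f x * (c i * b i x)^*%C)); last first.
    by move=> x _; rewrite conjC_sum mulr_sumr.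
  have ib i : Cintegrable mu setT (fun x => f x * (b i x)^*%C).
    by apply: Cintegrable_inner => //; exact: SL.
  have E i x : f x * (c i * b i x)^*%C = (c i)^*%C * (f x * (b i x)^*%C).
    by rewrite conjCM mulrCA.
  rewrite Cintegral_sum//; last first.
    by move=> i; under eq_fun do rewrite E; exact: CintegrableZ.
  rewrite big1// => i _; rewrite (eq_Cintegral mu (g := fun x => (c i)^*%C * (f x * (b i
    x)^*%C))) => [|x _]; last exact: E.
  by rewrite CintegralZ// orth ?mulr0.
have := @ae_eq_integral_abs _ _ _ mu setT measurableT (fun x => (sqnormc (f x))%:E).
move=> /(_ (measurable_sqnormcE measurableT mf))[+ _].
have -> : (\int[mu]_x `|(sqnormc (f x))%:E| = L2sq mu f)%E.
  by apply: eq_integral => x _; rewrite abse_EFin ger0_norm ?sqnormc_ge0.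
move=> /(_ f0); apply: filterS => x /(_ I)[fx]; exact: sqnormc_eq0.
Qed.

End Orthogonality.

(** * Haar measure on the local field *)

Lemma measure_bigcup_finType (d : measure_display) (T : measurableType d) (R : realType)
    (mu : {measure set T -> \bar R}) (I : finType) (B : I -> set T) (c : \bar R) :
  (forall i, measurable (B i)) -> trivIset setT B -> (forall i, mu (B i) = c) ->
  mu (\bigcup_(i in setT) B i) = (#|I|%:R%:E * c)%E.
Proof.
move=> mB tB Bc; rewrite measure_fin_bigcup//; last exact: finite_finset.
have -> : [set: I] = [set` enum I].
  by apply/seteqP; split => i //= _; rewrite mem_enum.
rewrite -fsbig_seq ?enum_uniq//= (eq_bigr (fun=> c)) => [|i _]; last exact: Bc.
by rewrite big_enum sumr_const mule_natl.
Qed.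

(** The recursion is solved in both directions from 0. With [b] the cardinality q it computes the
    Haar measures of the balls and of the annihilators. *)
Lemma geometric_int (R : realFieldType) (b : R) (f : int -> \bar R) : b != 0 ->
  f 0 = 1%E -> (forall n, f n = b%:E * f (n + 1)%R)%E -> forall n, f n = (b ^ (- n))%:E.
Proof.
move=> b0 f0 fS.
have bE k : b ^ (- k) = b * b ^ (- (k + 1)).
  by rewrite -{2}[b]expr1z -expfzDr// opprD addrCA subrr addr0.
have down k : f k = (b ^ (- k))%:E -> f (k + 1) = (b ^ (- (k + 1)))%:E.
  rewrite fS bE => /(congr1 (mule (b^-1)%:E)).
  by rewrite muleA -!EFinM mulrA mulVf// mul1e mul1r.
elim/int_rect => [|n IH|n IH]; first by rewrite oppr0 expr0z.
  by rewrite -[n.+1]addn1 PoszD; exact: down.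
by rewrite fS bE EFinM; congr (_ * _)%E; rewrite -[n.+1]addn1 PoszD opprD subrK.
Qed.

Lemma card_neq0 (F : finFieldType) (R : numDomainType) : (#|F|%:R : R) != 0.
Proof. by rewrite pnatr_eq0 -lt0n; apply/card_gt0P; exists 0. Qed.

Section LocalFieldMeasure.
Variable F : finFieldType.
Local Notation K := (local_field F).
Local Notation q := #|F|.
Implicit Types (x y z a h : K) (n m k j : int) (u v w : F).

Lemma coordinateN a j : (- a) j = - a j.
Proof. by []. Qed.

Lemma coordB a b j : (a - b) j = a j - b j.
Proof. by []. Qed.

Lemma coordDE a b j : (a + b) j = a j + b j.
Proof. by []. Qed.

Lemma coordZ u a j : (u *: a) j = u * a j.
Proof. by []. Qed.

Lemma gE n j : g_ F n j = (j == n)%:R.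
Proof. by []. Qed.

Lemma local_fieldP x y : (forall j, x j = y j) -> x = y.
Proof. by move=> xy; apply/val_inj/funext. Qed.

Lemma dilateE n x j : dilate n x j = x (j + n).
Proof. by []. Qed.

Lemma dilate0 x : dilate 0 x = x.
Proof. by apply: local_fieldP => j; rewrite dilateE addr0. Qed.

Lemma dilate_dilate n m x : dilate n (dilate m x) = dilate (n + m) x.
Proof. by apply: local_fieldP => j; rewrite !dilateE addrA. Qed.

Lemma dilateVK n : cancel (@dilate F (- n)) (dilate n).
Proof. by move=> x; rewrite dilate_dilate subrr dilate0. Qed.

Lemma dilateB n x y : dilate n (x - y) = dilate n x - dilate n y.
Proof. exact/local_fieldP. Qed.

Lemma ballKN n x : ballK n x -> ballK n (- x).
Proof. by move=> xn j jn; rewrite coordinateN xn ?oppr0. Qed.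

Lemma ballKB n x y : ballK n x -> ballK n y -> ballK n (x - y).
Proof. by move=> xn yn; apply: ballKD => //; exact: ballKN. Qed.

Lemma ballK_sub n x y : ballK n (x - y) <-> forall j, j < n -> x j = y j.
Proof.
split=> xy j jn; first by apply: subr0_eq; exact: xy.
by rewrite coordB xy ?subrr.
Qed.

Lemma ballK_dilate n m x : ballK n (dilate m x) <-> ballK (n + m) x.
Proof.
split=> h j jn; first by rewrite -(subrK m j) -dilateE h// ltrBlDr.
by rewrite dilateE h// ltrD2r.
Qed.

Lemma ballKZg n u : ballK n (u *: g_ F n).
Proof. by move=> j jn; rewrite coordZ gE lt_eqF// mulr0. Qed.

Definition ball_at n y : set K := [set x | ballK n (x - y)].

Lemma ball_at0 n : ball_at n 0 = ballK n.
Proof. by apply/funext => x; rewrite /ball_at /= subr0. Qed.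

Lemma ball_at_eq n x y : ballK n (x - y) -> ball_at n x = ball_at n y.
Proof.
move/ballK_sub => xy; apply/seteqP; split => z /ballK_sub zx; apply/ballK_sub => j jn.
  by rewrite zx// xy.
by rewrite zx// xy.
Qed.

Definition locally_constant (U : Type) n (f : K -> U) : Prop :=
  forall x y, ballK n (x - y) -> f x = f y.

(** The preimage is a union of cosets of K_n, hence open, whatever the set [A] is. *)
Lemma locally_constant_measurable (U : Type) n (f : K -> U) (A : set U) :
  locally_constant n f -> measurable (f @^-1` A).
Proof.
move=> lf; apply: sub_sigma_algebra; rewrite openE => x /= Ax; exists n => y yx.
by rewrite /= (lf y x).
Qed.

Lemma locally_constant_Cmeasurable (R : realType) n (f : K -> R[i]) :
  locally_constant n f -> Cmeasurable f.
Proof.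
by move=> lf; split => _ B _; rewrite setTI;
  apply: (@locally_constant_measurable _ n) => x y /lf ->.
Qed.

Lemma measurable_ball_at n y : measurable (ball_at n y).
Proof.
(* A ball is a fibre of the locally constant map that sends a point to its ball. *)
rewrite (_ : ball_at n y = ball_at n @^-1` [set ball_at n y]).
  by apply: (@locally_constant_measurable _ n) => x z; exact: ball_at_eq.
apply/seteqP; split => x /=; first exact: ball_at_eq.
by move=> <-; rewrite /ball_at /= subrr; exact: ballK0.
Qed.

Lemma measurable_ballK n : measurable (@ballK F n).
Proof. by rewrite -ball_at0; exact: measurable_ball_at. Qed.

Definition ball_sets : set (set K) :=
  [set A | A = set0 \/ exists n y, A = ball_at n y].

Lemma ball_sets_at n y : ball_sets (ball_at n y).
Proof. by right; exists n, y. Qed.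

Lemma ball_atI n m x y : (n <= m)%R ->
  ball_at n x `&` ball_at m y = set0 \/ ball_at n x `&` ball_at m y = ball_at m y.
Proof.
move=> nm; have [/ballK_sub xy|nxy] := pselect (ballK n (y - x)).
  right; apply/setIidr => z /ballK_sub zy; apply/ballK_sub => j jn.
  by rewrite zy ?xy// (lt_le_trans jn).
left; rewrite -subset0 => z [/ballK_sub zx /ballK_sub zy]; apply: nxy.
by apply/ballK_sub => j jn; rewrite -zx// zy// (lt_le_trans jn).
Qed.

Lemma ball_sets_setI : setI_closed ball_sets.
Proof.
move=> A B [->|[n [x ->]]]; first by rewrite set0I; left.
move=> [->|[m [y ->]]]; first by rewrite setI0; left.
have [nm|/ltW mn] := leP n m.
  by have [->|->] := ball_atI x y nm; [left|exact: ball_sets_at].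
by rewrite setIC; have [->|->] := ball_atI y x mn; [left|exact: ball_sets_at].
Qed.

Fact center_subproof n (s : seq F) :
  left_finite (fun j => if j < n then s`_`|(n - 1 - j)%R|%N else 0).
Proof.
apply/asboolP; exists (n - (size s)%:Z) => j jn; case: ifP => // jn'.
by rewrite nth_default//; move: (size s) jn => k; lia.
Qed.

(** The digits of [s] are written leftwards from position n - 1. These centres form a countable
    family meeting every ball of level n. *)
Definition center n s : K := LocalField (center_subproof n s).

Lemma center_dense n y : exists s, ballK n (y - center n s).
Proof.
case: y => y /= /[dup] /asboolP[m ym] yf.
exists (mkseq (fun i => y (n - 1 - i%:Z)) `|(n - m)%R|); apply/ballK_sub => j jn /=.
rewrite jn; have [js|sj] := ltnP `|(n - 1 - j)%R| `|(n - m)%R|.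
  by rewrite nth_mkseq//; congr y; lia.
by rewrite nth_default ?size_mkseq// ym//; lia.
Qed.

(** Every open set is the union of the balls contained in it that have a level and a centre from a
    countable list; [C] enumerates these through [unpickle]. *)
Lemma measurable_local_field : @measurable _ K = <<s ball_sets >>.
Proof.
apply/seteqP; split.
  apply: smallest_sub; first exact: smallest_sigma_algebra.
  move=> U oU; pose B (i : int * seq F) := ball_at i.1 (center i.1 i.2).
  pose C (k : nat) := if unpickle k is Some i then
    if `[< B i `<=` U >] then B i else set0 else set0.
  have -> : U = \bigcup_k C k.
    apply/seteqP; split => [x Ux|x [k _]]; last first.
      by rewrite /C; case: unpickle => // i; case: asboolP => // BU /BU.
    have [n nU] : nbhs x U by move: oU; rewrite openE; apply.
    have [s xs] := center_dense n x.
    exists (pickle (n, s)) => //; rewrite /C pickleK asboolT// => z.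
    rewrite /B/= -(ball_at_eq xs); exact: nU.
  have : sigma_algebra setT <<s ball_sets >> by exact: smallest_sigma_algebra.
  move=> [s0 _ sU]; apply: sU => k; rewrite /C.
  case: unpickle => // i; case: asboolP => // _; apply: sub_sigma_algebra.
  exact: ball_sets_at.
apply: smallest_sub; first exact: sigma_algebra_measurable.
move=> _ [->|[n [y ->]]]; [exact: measurable0|exact: measurable_ball_at].
Qed.

Lemma measurable_fun_balls (t : K -> K) :
  (forall n y, measurable (t @^-1` ball_at n y)) -> measurable_fun setT t.
Proof.
move=> mt; apply: (@measurability _ _ _ _ _ _ ball_sets measurable_local_field).
move=> _ [A GA <-]; rewrite setTI.
case: GA => [->|[n [y ->]]]; [by rewrite preimage_set0|exact: mt].
Qed.

Lemma measurable_translate a : measurable_fun setT (fun x : K => x + a).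
Proof.
apply: measurable_fun_balls => n y.
rewrite (_ : _ @^-1` _ = ball_at n (y - a)); first exact: measurable_ball_at.
by apply/funext => x; rewrite /ball_at /= opprB addrA.
Qed.

Lemma preimage_dilate_ball m n y :
  dilate m @^-1` ball_at n y = ball_at (n + m) (dilate (- m) y).
Proof.
apply/seteqP; split => x /=; rewrite /ball_at /=.
  by rewrite -{1}(dilateVK m y) -dilateB => /ballK_dilate.
by move=> h; rewrite -{1}(dilateVK m y) -dilateB; apply/ballK_dilate.
Qed.

Lemma measurable_dilate m : measurable_fun setT (@dilate F m).
Proof.
apply: measurable_fun_balls => n y; rewrite preimage_dilate_ball.
exact: measurable_ball_at.
Qed.

(** * Haar measure of balls, and its behaviour under translation and dilation *)

Section Haar.
Context {R : realType}.
Variable mu : {measure set K -> \bar R}.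
Hypothesis haar_mu : normalized_haarK mu.

Lemma haar_translate a A : measurable A -> mu ((fun x => x + a) @^-1` A) = mu A.
Proof.
move=> mA; have [inv _] := haar_mu; rewrite -(inv (- a) A mA); congr (mu _).
apply/seteqP; split => [x Ax|_ [x Ax <-]] /=; last by rewrite addrC addNKr.
by exists (x + a) => //; rewrite addrC addrK.
Qed.

Lemma haar_ball_at n y : mu (ball_at n y) = mu (ballK n).
Proof.
rewrite -[RHS](haar_translate (- y)); last exact: measurable_ballK.
by congr (mu _).
Qed.

Lemma ballKS_partition n : @ballK F n = \bigcup_(u in [set: F]) ball_at (n + 1) (u *: g_ F n).
Proof.
apply/seteqP; split => [x xn|x [u _ /ballK_sub xu] j jn].
  exists (x n) => //; apply/ballK_sub => j; rewrite ltzD1 le_eqVlt => /predU1P[->|jn].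
    by rewrite coordZ gE eqxx mulr1.
  by rewrite xn// ballKZg.
by rewrite xu ?ballKZg// (lt_trans jn)// ltrDl.
Qed.

(** The digit at position n splits K_n into q translates of K_(n+1). *)
Lemma haar_ballKS n : (mu (ballK n) = q%:R%:E * mu (ballK (n + 1)))%E.
Proof.
rewrite ballKS_partition; apply: measure_bigcup_finType => [u||u].
- exact: measurable_ball_at.
- move=> u v _ _ [x [/ballK_sub xu /ballK_sub xv]].
  by have := xu n; rewrite xv ?ltrDl// !coordZ !gE eqxx !mulr1 => ->.
- exact: haar_ball_at.
Qed.

Lemma haar_ballK n : mu (ballK n) = ((q%:R : R) ^ (- n))%:E.
Proof.
apply: (geometric_int (f := fun n => mu (ballK n))) => //; last exact: haar_ballKS.
  exact: card_neq0.
by have [_ ->] := haar_mu.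
Qed.

Lemma haar_ball_fin n y : (mu (ball_at n y) < +oo)%E.
Proof. by rewrite haar_ball_at haar_ballK ltry. Qed.

Lemma ballK_cover : \bigcup_n @ballK F (- (n : nat)%:Z) = setT.
Proof.
apply/seteqP; split => // x _; case: x => x /= /[dup] /asboolP[m xm] xf.
by exists `|m|%N => // j jm; rewrite /= xm//; lia.
Qed.

(** Both sides are measures in [A]. They agree on balls, since the preimage of a ball of level n has
    level n + m, and balls form a pi-system with an exhaustion of finite measure. *)
Lemma haar_dilate m A : measurable A ->
  (mu (dilate m @^-1` A) = ((q%:R : R) ^ (- m))%:E * mu A)%E.
Proof.
move=> mA.
have c0 : 0 <= (q%:R : R) ^ (- m) by rewrite exprz_ge0.
have md := measurable_dilate m.
have := @g_sigma_algebra_measure_unique _ R K ball_sets _ (fun i : nat => ballK (- i%:Z)) _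
  ballK_cover
  (pushforward mu (dilate m)) (mscale (NngNum c0) mu) ball_sets_setI.
apply.
- by rewrite measurable_local_field; exact: sub_sigma_algebra.
- by move=> n; rewrite -ball_at0; exact: ball_sets_at.
- move=> _ [->|[n [y ->]]]; first by rewrite !measure0.
  change (mu (dilate m @^-1` ball_at n y) = ((q%:R : R) ^ (- m))%:E * mu (ball_at n y))%E.
  rewrite preimage_dilate_ball !haar_ball_at !haar_ballK.
  by rewrite -EFinM -expfzDr ?card_neq0// opprD addrC.
- move=> i; change (mu (dilate m @^-1` ballK (- i%:Z)) < +oo)%E.
  rewrite -ball_at0 preimage_dilate_ball.
  exact: haar_ball_fin.
- by rewrite -measurable_local_field.
Qed.

Lemma L2sq_dilate m (f : K -> R[i]) : Cmeasurable f ->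
  L2sq mu (f \o dilate m) = (((q%:R : R) ^ (- m))%:E * L2sq mu f)%E.
Proof.
move=> mf; have c0 : 0 <= (q%:R : R) ^ (- m) by rewrite exprz_ge0.
rewrite /L2sq -(ge0_integral_mscale mu measurableT (NngNum c0)); last 2 first.
- exact: measurable_sqnormcE.
- by move=> x _; rewrite lee_fin sqnormc_ge0.
rewrite -[LHS](@ge0_integral_pushforward _ _ _ _ _ _ (measurable_dilate m) mu setT
  (fun x => (sqnormc (f x))%:E))//; last 2 first.
- exact: measurable_sqnormcE.
- by move=> x _; rewrite lee_fin sqnormc_ge0.
apply: eq_measure_integral; first exact: measurable_dilate.
by move=> md A mA _; exact: haar_dilate.
Qed.

Lemma Cmeas_comp (f : K -> R[i]) (t : K -> K) : measurable_fun setT t ->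
  Cmeasurable f -> Cmeasurable (f \o t).
Proof. by move=> mt [fr fi]; split; [exact: (measurableT_comp fr mt)|exact:
  (measurableT_comp fi mt)]. Qed.

Lemma L2sq_translate a (f : K -> R[i]) : Cmeasurable f ->
  L2sq mu (fun x => f (x + a)) = L2sq mu f.
Proof.
move=> mf; rewrite /L2sq [RHS](integral_invariant (measurable_translate a) (haar_translate
  a))//.
exact: measurable_sqnormcE.
Qed.

End Haar.
End LocalFieldMeasure.

(** * Characters and Fourier coefficients *)

(** Cauchy-Schwarz against the constant vector, from the nonnegativity of the double sum of (a_i -
    a_j)^2, applied to real and imaginary parts. *)
Lemma sqnormc_sum_le (R : realType) (I : finType) (z : I -> R[i]) :
  sqnormc (\sum_i z i) <= #|I|%:R * \sum_i sqnormc (z i).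
Proof.
have real (a : I -> R) : (\sum_i a i) ^+ 2 <= #|I|%:R * \sum_i a i ^+ 2.
  have : 0 <= \sum_i \sum_j (a i - a j) ^+ 2.
    by apply: sumr_ge0 => i _; apply: sumr_ge0 => j _; exact: sqr_ge0.
  set S := \sum_i a i; set Q := \sum_i a i ^+ 2.
  have inner i : \sum_j (a i - a j) ^+ 2 = #|I|%:R * a i ^+ 2 + (Q - 2 * a i * S).
    rewrite (eq_bigr (fun j => a i ^+ 2 + (a j ^+ 2 - 2 * a i * a j))); last by move=> j _;
      ring.
    by rewrite big_split/= sumr_const -[_ *+ _]mulr_natl big_split/= sumrN -mulr_sumr.
  rewrite (eq_bigr _ (fun i _ => inner i)) big_split/= -mulr_sumr big_split/= sumr_const.
  rewrite sumrN -mulr_suml -mulr_sumr -/S -/Q -mulr_natl.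
  by lra.
rewrite /sqnormc raddf_sum [X in _ + X ^+ 2]raddf_sum/= big_split/= mulrDr.
by apply: lerD; exact: real.
Qed.

Section Characters.
Context {F : finFieldType} {R : realType}.
Local Notation K := (local_field F).
Local Notation X := (character F R).
Local Notation q := #|F|.
Implicit Types (x y : K) (n m k : int) (u v w : F) (chi psi rho : X).

Lemma characterEP chi psi : (forall x, chi x = psi x) -> chi = psi.
Proof. by move=> cp; apply/val_inj/funext. Qed.

Lemma char_norm chi x : `|chi x| = 1.
Proof. by case: (characterP chi). Qed.

Lemma charD chi x y : chi (x + y) = chi x * chi y.
Proof. by case: (characterP chi). Qed.

Lemma char0 chi : chi 0 = 1.
Proof. by apply: (mulfI (character_neq0 chi 0)); rewrite -charD addr0 mulr1. Qed.

Lemma charN chi x : chi (- x) = (chi x)^-1.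
Proof.
by apply: (mulfI (character_neq0 chi x)); rewrite -charD subrr char0 mulfV// character_neq0.
Qed.

Lemma conjC_norm1 (z : R[i]) : `|z| = 1 -> z^*%C = z^-1.
Proof.
move=> z1; have z0 : z != 0 by rewrite -normr_eq0 z1 oner_eq0.
by apply: (mulfI z0); rewrite mulfV// -sqr_normc z1 expr1n.
Qed.

Lemma char_conj chi x : (chi x)^*%C = (chi x)^-1.
Proof. exact/conjC_norm1/char_norm. Qed.

Lemma char_mulC chi psi : (chi * psi)%g = (psi * chi)%g.
Proof. by apply: characterEP => x; rewrite !char_mulE mulrC. Qed.

Lemma char_invE chi x : (chi^-1)%g x = (chi x)^-1.
Proof. by []. Qed.

Lemma char_oneE x : (1%g : X) x = 1.
Proof. by []. Qed.

Lemma char_invM chi psi : ((chi * psi)^-1)%g = (chi^-1 * psi^-1)%g.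
Proof. by apply: characterEP => x; rewrite !(char_mulE, char_invE) invfM. Qed.

Lemma annihilatorV n chi : annihilator n chi -> annihilator n (chi^-1)%g.
Proof. by move=> cn x xn; rewrite char_invE cn// invr1. Qed.

Lemma char_ball n chi x y : annihilator n chi -> ballK n (x - y) -> chi x = chi y.
Proof. by move=> cn xy; rewrite -[x](subrK y) charD cn// mul1r. Qed.

Lemma char_locally_constant n chi : annihilator n chi -> locally_constant n chi.
Proof. by move=> cn x y; exact: char_ball. Qed.

Definition coset_at n chi : set X := [set psi | annihilator n (psi * chi^-1)%g].

Lemma coset_at_refl n chi : coset_at n chi chi.
Proof. by rewrite /coset_at /= mulgV. Qed.

Lemma coset_at1 n : coset_at n 1%g = annihilator n.
Proof. by apply/funext => psi; rewrite /coset_at /= invg1 mulg1. Qed.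

Lemma coset_at_eq n chi psi : annihilator n (chi * psi^-1)%g -> coset_at n chi = coset_at n psi.
Proof.
move=> cp; apply/seteqP; split => rho; rewrite /coset_at /= => h.
  by rewrite -[rho](mulgVK chi) -mulgA; exact: annihilatorM.
rewrite -[rho](mulgVK psi) -mulgA; apply: annihilatorM => //.
by rewrite -invgF; exact: annihilatorV.
Qed.

Lemma coset_invariant_measurable (U : Type) n (f : X -> U) (A : set U) :
  (forall chi psi, coset_at n chi psi -> f psi = f chi) -> measurable (f @^-1` A).
Proof.
move=> lf; apply: sub_sigma_algebra; rewrite openE => chi /= Achi; exists n => psi ps.
by rewrite /= (lf _ _ ps).
Qed.

Lemma measurable_coset_at n chi : measurable (coset_at n chi).
Proof.
rewrite (_ : coset_at n chi = coset_at n @^-1` [set coset_at n chi]).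
  by apply: (@coset_invariant_measurable _ n) => a b; exact: coset_at_eq.
apply/seteqP; split => psi /=; first exact: coset_at_eq.
by move=> <-; exact: coset_at_refl.
Qed.

Section CharacterIntegral.
Variable mu : {measure set K -> \bar R}.
Hypothesis haar_mu : normalized_haarK mu.

Lemma Cintegrable_ballK n (f : K -> R[i]) (M : R) : Cmeasurable f ->
  (forall x, sqnormc (f x) <= M) -> Cintegrable mu (ballK n) f.
Proof.
move=> mf fM; apply: (Cintegrable_bounded (M := M)) => //.
- exact: measurable_ballK.
- by rewrite -ball_at0; exact: haar_ball_fin.
Qed.

(** If chi(a) differs from 1 for some a in K_n, translation by a leaves the integral invariant and
    multiplies it by chi(a), so it vanishes. *)
Lemma Cintegral_char n chi : Cmeasurable chi -> Cintegral mu (ballK n) chi =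
  if `[< annihilator n chi >] then ((q%:R : R) ^ (- n))%:C%C else 0.
Proof.
move=> mchi; have mB := @measurable_ballK F n; case: asboolP => cn.
  rewrite (eq_Cintegral _ (g := fun=> 1)) => [|x xn]; last exact: cn.
  by rewrite Cintegral_cst// mul1r (haar_ballK haar_mu).
have [a [an /eqP ca1]] : exists a, ballK n a /\ chi a <> 1.
  by apply: contra_notP cn => h x xn; apply: contra_notP h => cx; exists x.
have ichi : Cintegrable mu (ballK n) chi.
  by apply: (@Cintegrable_ballK n chi 1) => // x; rewrite sqnormc_norm1 ?char_norm.
have : Cintegral mu (ballK n) chi = chi a * Cintegral mu (ballK n) chi.
  rewrite {1}(Cintegral_invariant (measurable_translate a) (haar_translate haar_mu a) mB mchi).
  rewrite -CintegralZ//.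
  have -> : (fun x : K => x + a) @^-1` ballK n = ballK n.
    apply/seteqP; split => x /= xn; last exact: ballKD.
    by rewrite -(addrK a x); exact: ballKB.
  by apply: eq_Cintegral => x _ /=; rewrite charD mulrC.
move/eqP; rewrite -subr_eq0 -{1}[Cintegral _ _ _]mul1r -mulrBl mulf_eq0 subr_eq0.
by rewrite eq_sym (negPf ca1) => /eqP.
Qed.

End CharacterIntegral.

(** * Characters read through a nondegenerate symmetric pairing of the residue field *)

Section Pairing.
Variable e : F -> F -> R[i].
Hypothesis e_norm : forall u w, `|e u w| = 1.
Hypothesis eDr : forall u v w, e u (v + w) = e u v * e u w.
Hypothesis eC : forall u w, e u w = e w u.
Hypothesis e_sum : forall w, w != 0 -> \sum_u e u w = 0.
Variable r : int -> F -> X.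
Hypothesis rE : forall k u x, r k u x = e u (x k).

Lemma eDl u v w : e (u + v) w = e u w * e v w.
Proof. by rewrite !(eC _ w) eDr. Qed.

Lemma e_neq0 u w : e u w != 0.
Proof. by rewrite -normr_eq0 e_norm oner_eq0. Qed.

Lemma e0r u : e u 0 = 1.
Proof. by apply: (mulfI (e_neq0 u 0)); rewrite -eDr addr0 mulr1. Qed.

Lemma e0l u : e 0 u = 1.
Proof. by rewrite eC e0r. Qed.

Lemma eNr u w : e u (- w) = (e u w)^-1.
Proof. by apply: (mulfI (e_neq0 u w)); rewrite -eDr subrr e0r mulfV ?e_neq0. Qed.

Lemma eBr u v w : e u (v - w) = e u v / e u w.
Proof. by rewrite eDr eNr. Qed.

Lemma e_sumE w : \sum_u e u w = (q * (w == 0))%:R.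
Proof.
have [->|w0] := eqVneq w 0; last by rewrite e_sum ?muln0.
by under eq_bigr do rewrite e0r; rewrite sumr_const muln1.
Qed.

Lemma r0 k : r k 0 = 1%g.
Proof. by apply: characterEP => x; rewrite rE e0l. Qed.

Lemma r_annihilator k u n : k < n -> annihilator n (r k u).
Proof. by move=> kn x xn; rewrite rE xn// e0r. Qed.

Lemma e_inj u v : (forall w, e u w = e v w) -> u = v.
Proof.
move=> uv; apply/eqP; rewrite -subr_eq0; apply/negPn/negP => h.
have := e_sum h; under eq_bigr do rewrite eC eDl (eC (- v)) eNr (eC _ v) -uv mulfV ?e_neq0//.
by move/eqP; rewrite sumr_const (negPf (card_neq0 F _)).
Qed.

Lemma r_annihilator_eq0 n u : annihilator n (r n u) -> u = 0.
Proof.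
move=> un; apply: e_inj => w; rewrite e0l -(un (w *: g_ F n)); last exact: ballKZg.
by rewrite rE coordZ gE eqxx mulr1.
Qed.

(* If no u worked, then orthogonality on K_n / K_(n+1) would make all the
   Fourier coefficients of chi vanish, hence chi(0) = 0. *)
Lemma annihilatorS n chi : annihilator (n + 1) chi ->
  exists u, annihilator n (chi * (r n u)^-1)%g.
Proof.
move=> cn; pose S u := \sum_w chi (w *: g_ F n) * e u (- w).
have SE u w0 : S u = (chi (w0 *: g_ F n) / e u w0) * S u.
  rewrite {1}/S (reindex_inj (addrI w0)) mulr_sumr; apply: eq_bigr => w _.
  by rewrite scalerDl charD opprD eDr !eNr; ring.
have [u Su] : exists u, S u != 0.
  have : \sum_u S u != 0.
    rewrite exchange_big/= (bigD1 0)//= [X in _ + X]big1 => [|w w0].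
      rewrite addr0 oppr0 -mulr_sumr e_sumE eqxx muln1 scale0r char0 mul1r.
      by rewrite card_neq0.
    by rewrite -mulr_sumr e_sum ?oppr_eq0 ?mulr0.
  by move=> h; apply: contrapT => nex; move: h; rewrite big1 ?eqxx// => u _;
    apply/eqP/negPn/negP => Su; apply: nex; exists u.
exists u => x xn.
have E : chi ((x n : F) *: g_ F n) = e u (x n).
  have /eqP := SE u (x n); rewrite -{1}[S u]mul1r -subr_eq0 -mulrBl mulf_eq0 (negPf Su) orbF.
  rewrite subr_eq0 eq_sym => /eqP h.
  by rewrite -[LHS](mulfVK (e_neq0 u (x n))) h mul1r.
rewrite char_mulE char_invE rE.
have -> : chi x = chi ((x n : F) *: g_ F n).
  apply: (char_ball cn); apply/ballK_sub => j; rewrite ltzD1 le_eqVlt => /predU1P[->|jn].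
    by rewrite coordZ gE eqxx mulr1.
  by rewrite xn// ballKZg.
by rewrite E mulfV ?e_neq0.
Qed.

Lemma coset_atS n chi : coset_at (n + 1) chi = \bigcup_(u in [set: F]) coset_at n (chi * r
  n u)%g.
Proof.
apply/seteqP; split => [psi /annihilatorS[u pu]|psi [u _ pu]].
  exists u => //; by rewrite /coset_at /= char_invM mulgA.
rewrite /coset_at /= -[psi](mulgVK (chi * r n u)%g) -mulgA; apply: annihilatorM.
  by apply: annihilator_le pu; rewrite lerDl.
by rewrite (char_mulC _ (chi^-1)%g) mulgA mulVg mul1g; apply: r_annihilator; rewrite ltrDl.
Qed.

Lemma coset_at_trivIset n chi : trivIset setT (fun u => coset_at n (chi * r n u)%g).
Proof.
move=> u v _ _ [psi [pu pv]]; apply/eqP; rewrite -subr_eq0; apply/eqP.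
apply: (@r_annihilator_eq0 n).
have -> : r n (u - v) = ((psi * (chi * r n v)^-1) * (psi * (chi * r n u)^-1)^-1)%g.
  apply: characterEP => x; rewrite !(char_mulE, char_invE) rE eDl (eC (- v)) eNr !rE.
  have := character_neq0 psi x; have := character_neq0 chi x; have := e_neq0 u (x n).
  by have := e_neq0 v (x n); rewrite (eC _ v) => *; field; do ?[apply/andP; split].
by apply: annihilatorM => //; exact: annihilatorV.
Qed.

(** * Haar measure on the character group and uniqueness of Fourier coefficients *)

Section DualHaar.
Variable nu : {measure set X -> \bar R}.
Hypothesis haar_nu : normalized_haarX nu.

Lemma haar_coset_at n chi : nu (coset_at n chi) = nu (annihilator n).
Proof.
have [inv _] := haar_nu; rewrite -[RHS](inv chi); last first.
  by rewrite -coset_at1; exact: measurable_coset_at.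
congr (nu _); apply/seteqP; split => [psi pc|_ [psi pc <-]].
  by exists (psi * chi^-1)%g => //; rewrite char_mulC mulgVK.
by rewrite /coset_at /= (char_mulC _ (chi^-1)%g) mulgA mulVg mul1g.
Qed.

Lemma haar_annihilatorS n : nu (annihilator (n + 1)) = (q%:R%:E * nu (annihilator n))%E.
Proof.
rewrite -[in LHS]coset_at1 coset_atS; apply: measure_bigcup_finType => [u||u].
- exact: measurable_coset_at.
- exact: coset_at_trivIset.
- exact: haar_coset_at.
Qed.

Lemma haar_annihilator n : nu (annihilator n) = ((q%:R : R) ^ n)%:E.
Proof.
rewrite -[in LHS](opprK n) -[in RHS](opprK n); move: (- n) => {}n.
apply: (geometric_int (f := fun n => nu (annihilator (- n)))) => //.
- exact: card_neq0.
- by rewrite oppr0; have [_ ->] := haar_nu.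
- by move=> k; rewrite -haar_annihilatorS opprD subrK.
Qed.

Variable mu : {measure set K -> \bar R}.
Hypothesis haar_mu : normalized_haarK mu.
Variable f : K -> R[i].
Hypothesis Lf : L2 mu f.

Definition ball_coef n y chi : R[i] :=
  Cintegral mu (ball_at n y) (fun x => f x * (chi x)^*%C).

Lemma Cintegrable_coef n y chi : Cmeasurable chi ->
  Cintegrable mu (ball_at n y) (fun x => f x * (chi x)^*%C).
Proof.
move=> mchi; have [mf ff] := (L2P _ _).1 Lf; apply: Cintegrable_L2.
- exact: measurable_ball_at.
- exact: haar_ball_fin.
- apply/L2P; split; first by apply: CmeasM => //; exact: CmeasJ.
  rewrite /L2sq; under eq_integral do
    rewrite char_conj sqnormcM (@sqnormc_norm1 _ (_^-1)) ?normfV ?char_norm ?invr1// mulr1.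
  exact: ff.
Qed.

Lemma Cmeas_r k u : Cmeasurable (r k u).
Proof.
apply: (@locally_constant_Cmeasurable _ _ (k + 1)); apply: char_locally_constant.
by apply: r_annihilator; rewrite ltrDl.
Qed.

(** Summing e(u, y_n - x_n) over u gives q when x_n = y_n and 0 otherwise, which cuts the ball of
    level n down to the sub-ball of level n + 1. *)
Lemma ball_coefS n y chi : Cmeasurable chi ->
  q%:R * ball_coef (n + 1) y chi = \sum_u e u (y n) * ball_coef n y (chi * r n u)%g.
Proof.
move=> mchi.
have mcr u : Cmeasurable (chi * r n u)%g by apply: CmeasM => //; exact: Cmeas_r.
under eq_bigr => u _.
  rewrite /ball_coef -CintegralZ; [|exact: measurable_ball_at|exact: Cintegrable_coef].
  over.
rewrite -Cintegral_sum; [|exact: measurable_ball_at|]; last first.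
  by move=> u; apply: CintegrableZ; [exact: measurable_ball_at|exact: Cintegrable_coef].
rewrite /ball_coef -CintegralZ; [|exact: measurable_ball_at|exact: Cintegrable_coef].
have sub : ball_at (n + 1) y `<=` ball_at n y.
  by move=> x; apply: ballK_le; rewrite lerDl.
rewrite (Cintegral_mkcond _ _ sub); apply: eq_Cintegral => x xn.
under eq_bigr => u _.
  rewrite char_mulE conjCM (char_conj (r n u)) rE -eNr.
  rewrite [X in _ * X](_ : _ = (f x * (chi x)^*%C) * e u (- x n)); last by rewrite mulrA.
  rewrite mulrCA -eDr.
  over.
rewrite -mulr_sumr e_sumE natrM [RHS]mulrCA -[LHS]mulrA; congr (_ * (_ * _)).
rewrite indicE rmorph_nat subr_eq0 eq_sym; congr (nat_of_bool _)%:R.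
apply/idP/eqP => [/set_mem /ballK_sub ->//|xy]; first by rewrite ltrDl.
apply/mem_set/ballK_sub => j; rewrite ltzD1 le_eqVlt => /predU1P[->//|jn].
by move/ballK_sub : xn; exact.
Qed.

(** Since y lies in K_n, so does the whole ball, and there two characters of the same coset
    agree. *)
Lemma ball_coef_coset n y chi psi : ballK n y -> coset_at n chi psi ->
  ball_coef n y psi = ball_coef n y chi.
Proof.
move=> yn cp; apply: eq_Cintegral => x xn; congr (_ * _^*%C).
have xn0 : ballK n x by rewrite -(subrK y x); exact: ballKD.
by rewrite -[psi](mulgVK chi) char_mulE cp// mul1r.
Qed.

Lemma measurable_ball_coef n y (D : set X) : measurable D -> ballK n y ->
  measurable_fun D (fun psi => (sqnormc (ball_coef n y psi))%:E).
Proof.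
move=> mD yn; apply: measurable_funTS => _ B _; rewrite setTI.
apply: (@coset_invariant_measurable _ n) => chi psi cp.
by rewrite (ball_coef_coset yn cp).
Qed.

(* By ball_coefS, shrinking the ball by one step averages q coefficients; the convexity of the
   square then gives the inequality by induction on j. *)
Lemma ball_coef_bound n y (j : nat) chi : ballK n y -> Cmeasurable chi ->
  ((sqnormc (ball_coef (n + j%:Z) y chi))%:E * nu (annihilator (n + j%:Z)) <=
   \int[nu]_(psi in coset_at (n + j%:Z) chi) (sqnormc (ball_coef n y psi))%:E)%E.
Proof.
move=> yn; elim: j chi => [|j IH] chi mchi.
  rewrite addr0 (eq_integral (fun=> (sqnormc (ball_coef n y chi))%:E)) => [|psi /set_mem pc].
    by rewrite integral_cst ?haar_coset_at//; exact: measurable_coset_at.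
  by rewrite (ball_coef_coset yn pc).
rewrite -[j.+1]addn1 PoszD addrA; move: (n + j%:Z) IH => m IH.
rewrite coset_atS.
have mcr u : Cmeasurable (chi * r m u)%g by apply: CmeasM => //; exact: Cmeas_r.
have -> : \bigcup_(u in [set: F]) coset_at m (chi * r m u)%g =
    \big[setU/set0]_(u <- enum F) coset_at m (chi * r m u)%g.
  apply/seteqP; split => psi.
    by move=> [u _ pu]; rewrite -bigcup_seq; exists u => //=; rewrite mem_enum.
  by rewrite -bigcup_seq => -[u _ pu]; exists u.
rewrite ge0_integral_bigsetU//; last 5 first.
- by move=> u; exact: measurable_coset_at.
- exact: enum_uniq.
- by move=> u v _ _; exact: (@coset_at_trivIset m chi u v I I).
- apply: measurable_ball_coef => //; apply: bigsetU_measurable => u _.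
  exact: measurable_coset_at.
- by move=> psi _; rewrite lee_fin sqnormc_ge0.
apply: (@le_trans _ _ (\sum_(u <- enum F) (sqnormc (ball_coef m y (chi * r m u)%g))%:E *
   nu (annihilator m)))%E; last by apply: lee_sum => u _; exact: IH.
rewrite haar_annihilatorS haar_annihilator.
under eq_bigr do rewrite -EFinM.
rewrite sumEFin -!EFinM lee_fin -mulr_suml mulrA ler_wpM2r ?exprz_ge0//.
rewrite big_enum/=.
have q0 : 0 < (q%:R : R) by rewrite lt_neqAle eq_sym card_neq0/=.
rewrite -(ler_pM2l q0).
apply: le_trans (_ : sqnormc (q%:R * ball_coef (m + 1) y chi) <= _).
  rewrite sqnormcM [sqnormc q%:R](_ : _ = q%:R ^+ 2); last first.
    by rewrite -[q%:R]/((q%:R : R[i])) -(rmorph_nat (real_complex R)) /sqnormc /= expr0n addr0.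
  by rewrite [X in X <= _]mulrCA [X in X <= _]mulrC -expr2.
rewrite ball_coefS//; apply: le_trans (sqnormc_sum_le _) _.
rewrite ler_pM2l//; apply: ler_sum => u _.
by rewrite sqnormcM (sqnormc_norm1 (e_norm _ _)) mul1r.
Qed.

(** The hypothesis makes the coefficients over K_(-N) small in L_2 on each annihilator, for
    arbitrarily large N. By [ball_coef_bound] for the trivial character, this mass bounds the
    squared integral over the ball times nu(K_n^perp). *)
Lemma fourier_uniqueness :
  (forall (M N0 : nat) (eps : R), 0 < eps -> exists2 N : nat, (N0 <= N)%N &
    (\int[nu]_(psi in annihilator M) (sqnormc (ball_coef (- N%:Z) 0 psi))%:E < eps%:E)%E) ->
  forall n y, Cintegral mu (ball_at n y) f = 0.
Proof.
move=> small n y.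
suff s0 : sqnormc (Cintegral mu (ball_at n y) f) = 0 by exact: sqnormc_eq0.
have c0 : 0 < (q%:R : R) ^ n.
  by rewrite exprz_gt0// lt_neqAle eq_sym card_neq0/=.
apply/eqP; rewrite eq_le sqnormc_ge0 andbT; apply/ler_addgt0Pr => eps e0; rewrite add0r.
have [a ya] : exists a : nat, ballK (- a%:Z) y.
  have : (\bigcup_i @ballK F (- (i : nat)%:Z)) y by rewrite ballK_cover.
  by move=> [a _ ya]; exists a.
(* N >= a puts y in K_(-N), and N >= |n| gives n >= -N; the factor q^n is nu(K_n^perp). *)
have [N aN] := small `|n|%N (maxn a `|n|%N) _ (mulr_gt0 e0 c0).
rewrite geq_max in aN; case/andP: aN => aN nN.
have yN : ballK (- N%:Z) y by apply: ballK_le ya; lia.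
have [j nj] : exists j : nat, n = - N%:Z + j%:Z by exists `|(n + N%:Z)%R|%N; lia.
move=> sm; rewrite -(ler_pM2r c0) -lee_fin; apply: le_trans (ltW sm).
have mX : measurable (@annihilator F R `|n|%N) by rewrite -coset_at1; exact:
  measurable_coset_at.
apply: (@le_trans _ _ (\int[nu]_(psi in annihilator n) (sqnormc (ball_coef (- N%:Z) y
  psi))%:E)%E).
  have := @ball_coef_bound (- N%:Z) y j 1%g yN (@Cmeas_cst _ K R 1).
  rewrite -nj coset_at1 haar_annihilator EFinM.
  rewrite [ball_coef _ _ _](_ : _ = Cintegral mu (ball_at n y) f)//.
  by apply: eq_Cintegral => x _; rewrite char_oneE rmorph1 mulr1.
have -> : ball_coef (- N%:Z) y = ball_coef (- N%:Z) 0.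
  by rewrite /ball_coef (@ball_at_eq _ _ y 0) ?subr0.
apply: ge0_subset_integral => //.
- by rewrite -coset_at1; exact: measurable_coset_at.
- by apply: measurable_ball_coef => //; exact: ballK0.
- by move=> psi _; rewrite lee_fin sqnormc_ge0.
- by apply: annihilator_le; lia.
Qed.

End DualHaar.
End Pairing.
End Characters.

(** * The step function of a tree *)

Section Mask.
Context {F : finFieldType} {R : realType}.
Local Notation K := (local_field F).
Local Notation X := (character F R).
Local Notation q := #|F|.
Implicit Types (x y : K) (n m k : int) (u v w : F) (chi psi rho : X).
Variable e : F -> F -> R[i].
Hypothesis e_norm : forall u w, `|e u w| = 1.
Hypothesis eDr : forall u v w, e u (v + w) = e u v * e u w.
Hypothesis eC : forall u w, e u w = e w u.
Hypothesis e_sum : forall w, w != 0 -> \sum_u e u w = 0.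
Variable r : int -> F -> X.
Hypothesis rE : forall k u x, r k u x = e u (x k).
Variables (pa : F -> F) (lam : F -> R[i]) (D : nat).
Hypothesis pa0 : pa 0 = 0.
Hypothesis paD : forall v, iter D pa v = 0.
Hypothesis lam0 : lam 0 = 1.
Hypothesis lam_norm : forall v, `|lam v| = 1.

(* Here pa is the parent function, with pa 0 = 0, D bounds the depth of the tree
   and lam v is the value of the mask on the coset of the edge from pa v to v. *)
Definition path_char v : X := (\prod_(k < D) r (k%:Z - 1) (iter k pa v))%g.
Definition path_coef v : R[i] := \prod_(k < D) lam (iter k pa v).

Lemma char_prodE (I : Type) (s : seq I) (f : I -> X) x :
  (\prod_(i <- s) f i)%g x = \prod_(i <- s) f i x.
Proof. by elim: s => [|i s IH]; rewrite ?big_nil// !big_cons char_mulE IH. Qed.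

Lemma path_charE v x : path_char v x = \prod_(k < D) e (iter k pa v) (x (k%:Z - 1)).
Proof. by rewrite /path_char char_prodE; apply: eq_bigr => k _; rewrite rE. Qed.

(** After [D] steps the walk has reached the root, so appending one more factor multiplies by
    [lam 0 = 1]; the longer product then splits at its first factor. The same device proves
    [path_charS]. *)
Lemma path_coefS v : path_coef v = lam v * path_coef (pa v).
Proof.
have <- : \prod_(k < D.+1) lam (iter k pa v) = path_coef v.
  by rewrite big_ord_recr /= paD lam0 mulr1.
by rewrite big_ord_recl; congr (_ * _); apply: eq_bigr => k _; rewrite lift0 iterSr.
Qed.

Lemma path_charS v x : path_char v x = e v (x (-1)) * path_char (pa v) (dilate 1 x).
Proof.
have <- : \prod_(k < D.+1) e (iter k pa v) (x (Posz k - 1)) = path_char v x.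
  by rewrite big_ord_recr /= paD (e0l e_norm eDr eC) mulr1 path_charE.
rewrite big_ord_recl path_charE; congr (_ * _); apply: eq_bigr => k _.
by rewrite lift0 iterSr; congr (e _ (x _)); lia.
Qed.

Lemma iter_pa0 (k : nat) : iter k pa 0 = 0.
Proof. by elim: k => //= k ->. Qed.

Lemma path_char0 : path_char 0 = 1%g.
Proof.
apply: characterEP => x; rewrite path_charE big1// => k _.
by rewrite iter_pa0 (e0l e_norm eDr eC).
Qed.

Lemma path_coef0 : path_coef 0 = 1.
Proof. by rewrite /path_coef big1// => k _; rewrite iter_pa0. Qed.

Lemma path_coef_norm v : `|path_coef v| = 1.
Proof. by rewrite normr_prod big1. Qed.

Lemma path_char_annihilator v : annihilator D (path_char v).
Proof.
move=> x xD; rewrite path_charE big1// => k _.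
by rewrite xD ?(e0r e_norm eDr)//; have := ltn_ord k; lia.
Qed.

Lemma Cmeas_path_char v : Cmeasurable (path_char v).
Proof.
apply: (@locally_constant_Cmeasurable _ _ D); apply: char_locally_constant.
exact: path_char_annihilator.
Qed.

(** Only coordinates of index at least -1 enter the product; in particular a shift along g_(-2) is
    invisible to [path_char]. *)
Lemma path_char_low v x : (forall k, -1 <= k -> x k = 0) -> path_char v x = 1.
Proof.
move=> x0; rewrite path_charE big1// => k _; rewrite x0 ?(e0r e_norm eDr)//; lia.
Qed.

(** Only the factor k = 0 sees the line through g_(-1). The vertex can thus be read off its
    character, which separates the cosets of different vertices. *)
Lemma path_char_g v u : path_char v (u *: g_ F (-1)) = e v u.
Proof.
rewrite path_charS coordZ gE eqxx mulr1 path_char_low ?mulr1// => k k1.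
by rewrite dilateE coordZ gE; case: eqVneq => [|_]; rewrite ?mulr0//; lia.
Qed.

Lemma path_char_gg v u w : path_char v (u *: g_ F (-1) + w *: g_ F 0) = e v u * e (pa v) w.
Proof.
rewrite charD path_char_g; congr (_ * _).
rewrite path_charS coordZ gE /= mulr0 (e0r e_norm eDr) mul1r -path_char_g.
by congr (path_char _ _); apply: local_fieldP => j; rewrite dilateE !coordZ !gE; congr (_ *
  (nat_of_bool _)%:R); apply/eqP/eqP; lia.
Qed.

Definition scaling_fun x : R[i] :=
  q%:R^-1 * (\1_(ballK (-1)) x)%:C%C * \sum_v path_coef v * path_char v x.

Lemma scaling_fun_locally_constant : locally_constant D scaling_fun.
Proof.
move=> x y xy; rewrite /scaling_fun; congr (_ * _ * _).
  rewrite !indicE; congr (nat_of_bool _)%:R%:C%C.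
  have xy1 : ballK (-1) (x - y) by apply: ballK_le xy; lia.
  apply/idP/idP => /set_mem h; apply/mem_set.
    by rewrite -[y](subKr x); exact: ballKB.
  by rewrite -[x](subrK y); exact: ballKD.
apply: eq_bigr => v _; congr (_ * _).
exact: (char_ball (path_char_annihilator v) xy).
Qed.

Lemma scaling_fun_support x : ~ ballK (-1) x -> scaling_fun x = 0.
Proof.
move=> nx; rewrite /scaling_fun indicE memNset// mulr0 mul0r//.
Qed.

Lemma scaling_fun_shift x u : scaling_fun (x - u *: g_ F (-1)) =
  q%:R^-1 * (\1_(ballK (-1)) x)%:C%C * \sum_v path_coef v * path_char v x / e v u.
Proof.
rewrite /scaling_fun; congr (_ * _ * _).
  rewrite !indicE; congr (nat_of_bool _)%:R%:C%C.
  apply/idP/idP => /set_mem h; apply/mem_set.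
    by rewrite -[x](subrK (u *: g_ F (-1))); apply: ballKD => //; exact: ballKZg.
  by apply: ballKB => //; exact: ballKZg.
by apply: eq_bigr => v _; rewrite charD charN path_char_g mulrA.
Qed.

(** Summation over u annihilates every vertex except the root, whose character and coefficient are
    trivial. *)
Lemma scaling_fun_partition x :
  \sum_u scaling_fun (x - u *: g_ F (-1)) = (\1_(ballK (-1)) x)%:C%C.
Proof.
under eq_bigr do rewrite scaling_fun_shift.
rewrite -mulr_sumr exchange_big/= (bigD1 0)//= [X in _ + X]big1 => [|v v0].
  under eq_bigr do rewrite path_coef0 path_char0 char_oneE (e0l e_norm eDr eC) !mul1r invr1.
  by rewrite sumr_const addr0 mulrAC mulVf ?mul1r// card_neq0.
rewrite -mulr_sumr (reindex_inj (@oppr_inj F)).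
under eq_bigr do rewrite (eNr e_norm eDr) invrK eC.
by rewrite e_sum// mulr0.
Qed.

(* Fourier coefficients of the mask on the dual of span(g_(-1), g_(-2)). *)
Definition mask_coef u w : R[i] :=
  q%:R^-1 * \sum_v lam v * e (pa v) u * e v w.

(** Summing over u first selects z = pa v. In the refinement equation [P z] is the summand of the
    step function at z, evaluated at the dilated point. *)
Lemma mask_coef_inversion (P : F -> R[i]) w :
  \sum_u mask_coef u w * (\sum_z P z / e z u) = \sum_v lam v * e v w * P (pa v).
Proof.
have inner u z v : q%:R^-1 * (lam v * e (pa v) u * e v w) * (P z / e z u) =
    q%:R^-1 * (lam v * e v w * P z) * e u (pa v - z).
  by rewrite (eBr e_norm eDr) (eC u z) (eC u (pa v)); ring.
transitivity (\sum_u \sum_z \sum_v q%:R^-1 * (lam v * e v w * P z) * e u (pa v - z)).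
  apply: eq_bigr => u _; rewrite mulr_sumr; apply: eq_bigr => z _.
  rewrite /mask_coef mulr_sumr mulr_suml; apply: eq_bigr => v _; exact: inner.
rewrite exchange_big/=; under eq_bigr do rewrite exchange_big/=.
rewrite exchange_big/=; apply: eq_bigr => v _.
under eq_bigr do rewrite -mulr_sumr (e_sumE e_norm eDr e_sum).
rewrite (bigD1 (pa v))//= [X in _ + X]big1 => [|z zv]; last first.
  by rewrite subr_eq0 eq_sym (negPf zv) muln0 mulr0.
by rewrite subrr eqxx muln1 addr0 mulrAC mulVf ?mul1r// card_neq0.
Qed.

(** The characters do not see g_(-2), so the shift by w only moves the support, to the part of
    K_(-2) whose digit at -2 is w. *)
Lemma scaling_fun_shift2 x u w :
  scaling_fun (x - (u *: g_ F (-1) + w *: g_ F (-2))) =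
  (x (-2) == w)%:R * (\1_(ballK (-2)) x)%:C%C * q%:R^-1 *
  \sum_v path_coef v * path_char v x / e v u.
Proof.
rewrite opprD addrCA [X in scaling_fun X]addrC scaling_fun_shift mulrC [RHS]mulrC.
congr (_ * _); last first.
  rewrite [LHS]mulrC; congr (_ * _).
  rewrite !indicE !rmorph_nat -natrM mulnb; congr (nat_of_bool _)%:R.
  apply/idP/andP => [/set_mem h|[/eqP xw /set_mem h]].
    split; last first.
      apply/mem_set; rewrite -[x](subrK (w *: g_ F (-2))); apply: ballKD.
        by apply: ballK_le h; lia.
      exact: ballKZg.
    by have := h (-2) isT; rewrite coordB coordZ gE eqxx mulr1 => /eqP; rewrite subr_eq0.
  apply/mem_set/ballK_sub => j j1; have [->|j2] := eqVneq j (-2).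
    by rewrite coordZ gE eqxx mulr1.
  by rewrite h ?coordZ ?gE ?(negPf j2) ?mulr0//; lia.
apply: eq_bigr => v _; congr (_ * _ / _); rewrite charD charN [path_char v (_ *:
  _)]path_char_low ?invr1 ?mulr1//.
by move=> k k1; rewrite coordZ gE; case: eqVneq => [|_]; rewrite ?mulr0//; lia.
Qed.

Lemma scaling_fun_refinement x : scaling_fun x = \sum_u \sum_w
  mask_coef u w * scaling_fun (dilate 1 x - (u *: g_ F (-1) + w *: g_ F (-2))).
Proof.
have q0 : (q%:R : R[i]) != 0 by rewrite card_neq0.
have -> : scaling_fun x = (\1_(ballK (-1)) x)%:C%C * q%:R^-1 *
    \sum_v lam v * e v (x (-1)) * (path_coef (pa v) * path_char (pa v) (dilate 1 x)).
  rewrite /scaling_fun; congr (_ * _); first by rewrite mulrC.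
  by apply: eq_bigr => v _; rewrite path_coefS path_charS; ring.
under [RHS]eq_bigr => u _.
  under eq_bigr do rewrite scaling_fun_shift2.
  (* The digit of [dilate 1 x] at -2 is [x (-1)], hence a single w contributes. *)
  rewrite (bigD1 (x (-1)))//= [X in _ + X]big1; last first.
    move=> w wx; case: eqP => [h|_]; last by rewrite !mul0r mulr0.
    by case/eqP: wx; rewrite -h.
  rewrite [_ == _]eqxx mul1r addr0 mulrCA.
  over.
rewrite -mulr_sumr; congr (_ * _ * _).
  rewrite !indicE; congr (nat_of_bool _)%:R%:C%C.
  by apply/idP/idP => /set_mem h; apply/mem_set; [apply/ballK_dilate|move/ballK_dilate : h].
exact/esym/mask_coef_inversion.
Qed.

Lemma path_char_coset v w : annihilator (-1) (path_char v * (path_char w)^-1)%g -> v = w.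
Proof.
move=> vw; apply: (e_inj e_norm eDr eC e_sum) => u.
have := vw _ (@ballKZg F (-1) u); rewrite char_mulE char_invE !path_char_g => h.
by rewrite -[LHS](mulfVK (e_neq0 e_norm w u)) h mul1r.
Qed.

(** * Fourier transform and orthonormal shifts of the step function *)

Section MaskIntegral.
Variable mu : {measure set K -> \bar R}.
Hypothesis haar_mu : normalized_haarK mu.

Lemma L2_sum (I : Type) (s : seq I) (c : I -> R[i]) (f : I -> K -> R[i]) :
  (forall i, L2 mu (f i)) -> L2 mu (fun x => \sum_(i <- s) c i * f i x).
Proof.
move=> Lf; elim: s => [|i s IH].
  by under eq_fun do rewrite big_nil; exact: L2_0.
by under eq_fun do rewrite big_cons; exact: L2_lin.
Qed.

Lemma L2_ball_indic n y : L2 mu (fun x => (\1_(ball_at n y) x)%:C%C).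
Proof.
have mB := @measurable_ball_at F n y; apply/L2P; split; first exact: Cmeas_indic.
rewrite /L2sq (_ : (\int[mu]_x _)%E = \int[mu]_x (\1_(ball_at n y) x)%:E)%E.
  by rewrite integral_indic// setIT; exact: haar_ball_fin.
apply: eq_integral => x _; rewrite /sqnormc /= expr0n addr0 indicE.
by case: (x \in _); rewrite ?expr1n ?expr0n.
Qed.

Lemma L2_scaling_fun : L2 mu scaling_fun.
Proof.
have -> : scaling_fun = fun x => \sum_v (q%:R^-1 * path_coef v) *
    ((\1_(ball_at (-1) 0) x)%:C%C * path_char v x).
  apply/funext => x; rewrite ball_at0 /scaling_fun mulr_sumr; apply: eq_bigr => v _.
  by rewrite mulrACA mulrA.
apply: L2_sum => v; have /L2P[mB fB] := L2_ball_indic (-1) 0; apply/L2P; split.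
  by apply: CmeasM => //; exact: Cmeas_path_char.
rewrite /L2sq; under eq_integral do
  rewrite sqnormcM (sqnormc_norm1 (char_norm _ _)) mulr1.
exact: fB.
Qed.

(** On K_(-1), which has measure q, only the terms with [rho i] trivial there survive. The enclosing
    set [E] serves both for larger balls and for the whole space. *)
Lemma Cintegral_scaling_fun (I : finType) (E : set K) (psi : K -> R[i])
    (c : I -> R[i]) (rho : I -> X) :
  measurable E -> ballK (-1) `<=` E ->
  (forall i, Cmeasurable (rho i)) ->
  (forall x, ballK (-1) x -> psi x = \sum_i c i * rho i x) ->
  (forall x, E x -> ~ ballK (-1) x -> psi x = 0) ->
  Cintegral mu E psi = \sum_i c i * (if `[< annihilator (-1) (rho i) >] then q%:R else 0).
Proof.
move=> mE BE mrho psi1 psi0; have mB := @measurable_ballK F (-1).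
transitivity (Cintegral mu (ballK (-1)) (fun x => \sum_i c i * rho i x)).
  rewrite (Cintegral_mkcond _ _ BE); apply: eq_Cintegral => x Ex; rewrite indicE rmorph_nat.
  have [/set_mem xB|xB] := boolP (x \in ballK (-1)); first by rewrite mulr1 psi1.
  by rewrite mulr0 psi0// => xB'; move: xB; rewrite mem_set.
have irho i : Cintegrable mu (ballK (-1)) (rho i).
  apply: (@Cintegrable_ballK _ _ _ haar_mu _ _ 1) => // x.
  by rewrite sqnormc_norm1 ?char_norm.
rewrite Cintegral_sum// => [|i]; last exact: CintegrableZ.
apply: eq_bigr => i _; rewrite CintegralZ// (Cintegral_char haar_mu)//.
by rewrite opprK expr1z rmorph_nat.
Qed.

(* The Fourier transform of scaling_fun; at most one summand is nonzero. *)
Definition scaling_hat chi : R[i] :=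
  \sum_v path_coef v * (if `[< annihilator (-1) (path_char v * chi^-1)%g >] then 1 else 0).

(** The support lies in K_(-1), so the truncated integrals no longer depend on n <= -1; the measure
    q of K_(-1) cancels the normalization. *)
Lemma fourier_scaling_fun n chi : n <= -1 -> Cmeasurable chi ->
  Cintegral mu (ballK n) (fun x => scaling_fun x * (chi x)^*%C) = scaling_hat chi.
Proof.
move=> n1 mchi; rewrite (@Cintegral_scaling_fun F _ _ (fun v => q%:R^-1 * path_coef v)
    (fun v => path_char v * chi^-1)%g).
- rewrite /scaling_hat; apply: eq_bigr => v _; case: asboolP => _; last by rewrite !mulr0.
  by rewrite mulr1 mulrAC mulVf ?mul1r// card_neq0.
- exact: measurable_ballK.
- exact: ballK_le.
- move=> v; apply: CmeasM; first exact: Cmeas_path_char.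
  rewrite [X in Cmeasurable X](_ : _ = fun x => (chi x)^*%C); first exact: CmeasJ.
  by apply/funext => x; rewrite char_conj.
- move=> x xB; rewrite /scaling_fun indicE mem_set// mulr1 mulr_sumr mulr_suml.
  by apply: eq_bigr => v _; rewrite char_mulE char_invE char_conj !mulrA.
- by move=> x _ /scaling_fun_support ->; rewrite mul0r.
Qed.

Lemma coord_sum (I : Type) (s : seq I) (P : pred I) (f : I -> K) k :
  (\sum_(i <- s | P i) f i) k = \sum_(i <- s | P i) f i k.
Proof. by elim/big_rec2: _ => // i y z _ <-. Qed.

Lemma H0_coord (h : K) k : H0 h -> 0 <= k -> h k = 0.
Proof.
move=> [l [c [_ ->]]] k0; rewrite coord_sum big_nat big1// => j /andP[j1 _].
by rewrite coordZ gE; case: eqVneq => [|_]; rewrite ?mulr0//; lia.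
Qed.

(** Translation reduces to a single difference h - h'. Outside K_(-1) the supports are disjoint;
    inside, the inner product becomes a character sum over the vertices. *)
Lemma scaling_fun_orthonormal (h h' : K) : H0 h -> H0 h' ->
  L2inner mu (translate scaling_fun h) (translate scaling_fun h') = (h == h')%:R.
Proof.
move=> Hh Hh'; rewrite /L2inner /translate; have /L2P[mphi _] := L2_scaling_fun.
have mshift a : Cmeasurable (fun x => scaling_fun (x - a)).
  exact: (Cmeas_comp (measurable_translate (- a)) mphi).
rewrite (Cintegral_invariant (measurable_translate h) (haar_translate haar_mu h)) //; last
  first.
  by apply: CmeasM => //; exact: CmeasJ.
rewrite preimage_setT.
rewrite (@eq_Cintegral _ _ _ _ _ _ (fun x => scaling_fun x * (scaling_fun (x + (h -
  h')))^*%C)); last first.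
  by move=> x _; rewrite /= addrK addrA.
have [hB|nB] := pselect (ballK (-1) (h - h')); last first.
  rewrite (@eq_Cintegral _ _ _ _ _ _ (fun=> 0)) ?Cintegral0 => [|x _].
    by case: eqP nB => // ->; rewrite subrr => -[]; exact: ballK0.
  have [xB|/scaling_fun_support ->] := pselect (ballK (-1) x); last by rewrite mul0r.
  rewrite [scaling_fun (_ + _)]scaling_fun_support ?conjc0 ?mulr0//.
  by move=> h1; apply: nB; rewrite -[h - h'](addKr x) addrC; apply: ballKD => //; exact: ballKN.
pose u : F := (h - h') (-1).
(* Elements of [H0] have no coordinates of index >= 0, so a difference lying in K_(-1) has only its
   coordinate at -1. *)
have hE : h - h' = u *: g_ F (-1).
  apply: local_fieldP => k; rewrite coordZ gE; case: eqVneq => [->|k1].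
    by rewrite mulr1.
  rewrite mulr0; have [k0|k0] := ltP k (-1); first exact: hB.
  by rewrite coordB !H0_coord ?subrr//; lia.
have -> : h - h' = - ((- u) *: g_ F (-1)) by rewrite scaleNr opprK.
have -> : (h == h') = (u == 0).
  rewrite -subr_eq0 hE; apply/eqP/eqP => [h0|->]; last by rewrite scale0r.
  by have := congr1 (fun x : K => x (-1)) h0; rewrite coordZ gE eqxx mulr1.
pose cc (vw : F * F) := q%:R^-1 * q%:R^-1 * path_coef vw.1 * (path_coef vw.2 / e vw.2 (-
  u))^*%C.
rewrite (@Cintegral_scaling_fun _ _ _ cc (fun vw => path_char vw.1 * (path_char
  vw.2)^-1)%g) //; last 3 first.
- move=> vw; apply: CmeasM; first exact: Cmeas_path_char.
  rewrite [X in Cmeasurable X](_ : _ = fun x => (path_char vw.2 x)^*%C).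
    exact/CmeasJ/Cmeas_path_char.
  by apply/funext => x; rewrite char_conj.
- move=> x xB; rewrite scaling_fun_shift /scaling_fun indicE mem_set// !mulr1 conjCM conjC_sum.
  rewrite mulrACA; rewrite [(q%:R^-1)^*%C](_ : _ = q%:R^-1); last first.
    by rewrite -[q%:R in LHS](rmorph_nat (real_complex R)) -fmorphV conjc_real fmorphV
      rmorph_nat.
  rewrite mulr_suml mulr_sumr -(pair_bigA _ (fun v w => cc (v, w) * (path_char v *
    (path_char w)^-1)%g x))/=.
  apply: eq_bigr => v _; rewrite !mulr_sumr; apply: eq_bigr => w _.
  rewrite /cc /= !conjCM (char_conj (path_char w)); ring.
- by move=> x _ /scaling_fun_support ->; rewrite mul0r.
rewrite -(pair_bigA _ (fun v w => cc (v, w) * (if `[< annihilator (-1) (path_char v *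
  (path_char w)^-1)%g >] then q%:R else 0)))/=.
(* Distinct vertices lie in distinct cosets, so the double sum reduces to its diagonal, where the
   unimodular coefficients cancel. *)
transitivity (q%:R^-1 * \sum_v e v (- u)).
  rewrite mulr_sumr; apply: eq_bigr => v _.
  rewrite (bigD1 v)//= big1 => [|w wv]; last first.
    by case: asboolP => [/path_char_coset vw|]; [rewrite vw eqxx in wv|rewrite mulr0].
  rewrite addr0 asboolT; last by rewrite mulgV; exact: annihilator1.
  rewrite /cc/= conjCM (conjC_norm1 (path_coef_norm v)).
  rewrite [((e v (- u))^-1)^*%C]conjC_norm1 ?normfV ?e_norm ?invr1// invrK.
  have c0 : path_coef v != 0 by rewrite -normr_eq0 path_coef_norm oner_eq0.
  have q0 : (q%:R : R[i]) != 0 by rewrite card_neq0.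
  by field; apply/andP.
rewrite (e_sumE e_norm eDr e_sum) oppr_eq0; case: eqP => _.
  by rewrite muln1 mulVf// card_neq0.
by rewrite muln0 mulr0.
Qed.

End MaskIntegral.

(** * The infinite product of the mask *)

Section MaskLimit.
Variable m0 : X -> R[i].
Hypothesis m0_coset : forall chi psi, annihilator (-1) psi -> m0 (psi * chi)%g = m0 chi.
Hypothesis m0_one : m0 1%g = 1.
Hypothesis m0_edge : forall u v,
  m0 (r (-1) u * r 0 v)%g = if v == pa u then lam u else 0.
Hypothesis m0_periodic : forall (l : nat) (alpha : nat -> F) chi, (0 < l)%N ->
  m0 (chi * \prod_(1 <= j < l.+1) r j (alpha j))%g = m0 chi.

Lemma annihilator_decomp (M : nat) chi : annihilator (M%:Z + 1) chi ->
  exists alpha : nat -> F,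
    annihilator 1 (chi * (\prod_(1 <= j < M.+1) r j (alpha j))^-1)%g.
Proof.
elim: M chi => [|M IH] chi cM.
  by exists (fun=> 0); rewrite big_geq// invg1 mulg1.
have [u cu] := annihilatorS e_norm eDr e_sum rE cM.
have [|alpha ca] := IH (chi * (r M.+1 u)^-1)%g; first by rewrite -PoszD addn1.
exists (fun j => if j == M.+1 then u else alpha j).
rewrite big_nat_recr//= eqxx.
rewrite (eq_big_nat _ _ (F2 := fun j : nat => r j (alpha j))) => [|j /andP[_ jM]]; last first.
  by rewrite ltn_eqF.
by move: ca; rewrite -mulgA -char_invM (char_mulC (r M.+1 u)).
Qed.

(** Peeling off Rademacher factors writes chi as psi r_(-1)^u r_0^v P, with psi in K_(-1)^perp and P
    a product of factors of positive index. The mask ignores psi and P, and both are trivial on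
    g_(-1) and g_0, so u and v are visible there. *)
Lemma mask_decomp (M : nat) chi : annihilator M%:Z chi -> exists u v,
  m0 chi = (if v == pa u then lam u else 0) /\
  forall a b, chi (a *: g_ F (-1) + b *: g_ F 0) = e u a * e v b.
Proof.
move=> cM; have [|alpha ca] := @annihilator_decomp M chi.
  by apply: annihilator_le cM; rewrite lerDl.
set P := (\prod_(1 <= j < M.+1) r j (alpha j))%g in ca.
have [v cv] := annihilatorS e_norm eDr e_sum rE (n := 0) ca.
have [u cu] := annihilatorS e_norm eDr e_sum rE (n := -1) cv.
set psi := (_ * (r (-1) u)^-1)%g in cu.
have chiE : chi = (psi * (r (-1) u * r 0 v) * P)%g.
  rewrite /psi; apply: characterEP => x; rewrite !(char_mulE, char_invE).
  have := character_neq0 P x; have := character_neq0 (r (-1) u) x.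
  by have := character_neq0 (r 0 v) x => *; field; do ?[apply/andP; split].
clearbody psi; exists u, v; split.
  rewrite chiE (_ : m0 (_ * P)%g = m0 (psi * (r (-1) u * r 0 v))%g); last first.
    (* Periodicity is assumed for products of positive length; the empty product is treated
       apart. *)
    rewrite /P; case: (M) => [|l]; first by rewrite big_geq// mulg1.
    exact: m0_periodic.
  by rewrite m0_coset// m0_edge.
move=> a b; rewrite chiE !char_mulE cu ?mul1r; last first.
  by apply: ballKD; [|apply: (@ballK_le _ _ 0) => //]; exact: ballKZg.
rewrite !rE !coordDE !coordZ !gE /= !mulr1 !mulr0 addr0 add0r.
rewrite [P _](_ : _ = 1) ?mulr1// /P char_prodE big_nat big1// => j /andP[j1 _].
rewrite rE coordDE !coordZ !gE; do 2 (case: eqVneq => [|_]; first by lia).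
by rewrite !mulr0 addr0 (e0r e_norm eDr).
Qed.

Lemma path_char_eq u v chi : (forall a b, chi (a *: g_ F (-1) + b *: g_ F 0) = e u a * e v b) ->
  forall w, annihilator (-1) (path_char w * chi^-1)%g -> w = u /\ pa w = v.
Proof.
move=> chiE w cw; have E a b : e w a * e (pa w) b = e u a * e v b.
  rewrite -chiE -path_char_gg; set x := _ + _.
  have := cw x; rewrite char_mulE char_invE => h.
  rewrite -[LHS](mulfVK (character_neq0 chi x)) h ?mul1r//.
  by apply: ballKD; [|apply: (@ballK_le _ _ 0) => //]; exact: ballKZg.
split; apply: (e_inj e_norm eDr eC e_sum) => a.
  by have := E a 0; rewrite !(e0r e_norm eDr) !mulr1.
by have := E 0 a; rewrite !(e0r e_norm eDr) !mul1r.
Qed.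

Lemma char_dilateE chi n x : char_dilate chi n x = chi (dilate n x).
Proof. by []. Qed.

(** A point of K_(-1) is a g_(-1) + y with y in K_0. On the first summand the two characters agree
    by hypothesis; on y, [path_charS] passes to the parent and to the dilated point. *)
Lemma path_char_coset_dilate u chi : (forall a, chi (a *: g_ F (-1)) = e u a) ->
  annihilator (-1) (path_char u * chi^-1)%g <->
  annihilator (-1) (path_char (pa u) * (char_dilate chi (-1))^-1)%g.
Proof.
move=> chiE; split=> h x xn; rewrite char_mulE char_invE.
  have x0 : ballK 0 (dilate (-1) x) by apply/ballK_dilate.
  have := h (dilate (-1) x) (ballK_le (n := -1) (m := 0) isT x0).
  rewrite char_mulE char_invE char_dilateE path_charS x0// (e0r e_norm eDr) mul1r.
  by rewrite dilate_dilate subrr dilate0.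
set a := x (-1) : F; set y := x - a *: g_ F (-1).
have y0 : ballK 0 y.
  apply/ballK_sub => j j0; rewrite coordZ gE; case: eqVneq => [->|j1]; first by rewrite mulr1.
  by rewrite mulr0 xn//; lia.
have -> : x = a *: g_ F (-1) + y by rewrite addrC subrK.
clearbody y; rewrite !charD path_char_g chiE path_charS y0// (e0r e_norm eDr) mul1r invfM.
rewrite mulrACA mulfV ?(e_neq0 e_norm)// mul1r.
have yn : ballK (-1) (dilate 1 y) by apply/ballK_dilate.
have := h (dilate 1 y) yn; rewrite char_mulE char_invE char_dilateE dilate_dilate.
by rewrite addNr dilate0.
Qed.

(** The refinement equation on the Fourier side. The digits u, v of chi leave u as the only
    candidate vertex; both sides vanish unless v is its parent, and otherwise one factor of the path
    coefficient splits off. *)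
Lemma scaling_hat_mask (M : nat) chi : annihilator M%:Z chi ->
  scaling_hat chi = m0 chi * scaling_hat (char_dilate chi (-1)).
Proof.
move=> cM; have [u [v [-> chiE]]] := mask_decomp cM.
have chiE1 a : chi (a *: g_ F (-1)) = e u a.
  by rewrite -[RHS]mulr1 -(e0r e_norm eDr v) -chiE scale0r addr0.
have chiE2 a : char_dilate chi (-1) (a *: g_ F (-1)) = e v a.
  rewrite char_dilateE -[RHS]mul1r -(e0r e_norm eDr u) -chiE scale0r add0r.
  by congr (chi _); apply: local_fieldP => j; rewrite dilateE !coordZ !gE; congr (_ *
    (nat_of_bool _)%:R); apply/eqP/eqP; lia.
have only w : w != u -> ~ annihilator (-1) (path_char w * chi^-1)%g.
  by move=> wu h; have [E _] := path_char_eq chiE h; rewrite E eqxx in wu.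
rewrite {1}/scaling_hat (bigD1 u)//= [X in _ + X]big1 ?addr0 => [|w wu]; last first.
  by rewrite asboolF ?mulr0//; exact: only.
have [vE|vu] := eqVneq v (pa u); last first.
  rewrite mul0r asboolF ?mulr0// => h; have [_ E] := path_char_eq chiE h.
  by rewrite -E eqxx in vu.
rewrite /scaling_hat (bigD1 v)//= [X in _ + X]big1 ?addr0 => [|w wv]; last first.
  rewrite asboolF ?mulr0// => h.
  case/eqP: wv; apply: (e_inj e_norm eDr eC e_sum) => a; rewrite -(chiE2 a).
  have := h _ (@ballKZg F (-1) a); rewrite char_mulE char_invE path_char_g => E.
  by rewrite -[LHS](mulfVK (character_neq0 (char_dilate chi (-1)) (a *: g_ F (-1)))) E mul1r.
by rewrite (asbool_equiv_eq (path_char_coset_dilate chiE1)) mulrA vE -path_coefS.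
Qed.

Lemma annihilator_dilate n k chi : annihilator n chi -> annihilator (n + k) (char_dilate chi k).
Proof. by move=> cn x /ballK_dilate xn; rewrite char_dilateE cn. Qed.

(** For n >= M the character chi A^(-n) lies in K_(-1)^perp, where the mask is 1, so the partial
    products are stationary from N = M on. *)
Lemma mask_product (M N : nat) chi : (M <= N)%N -> annihilator (M%:Z - 1) chi ->
  \prod_(n < N) m0 (char_dilate chi (- (n : nat)%:Z)) = scaling_hat chi.
Proof.
elim: M N chi => [|M IH] N chi MN cM.
  rewrite big1 => [|n _].
    rewrite /scaling_hat (bigD1 0)//= [X in _ + X]big1 => [|v v0].
      rewrite path_coef0 path_char0 mul1g asboolT ?mulr1 ?addr0//.
      exact: annihilatorV.
    rewrite asboolF ?mulr0// => h; case/eqP: v0; apply: path_char_coset.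
    rewrite path_char0 invg1 mulg1 -[path_char v](mulgVK chi); exact: annihilatorM.
  rewrite -[char_dilate _ _]mulg1 m0_coset//.
  by apply: annihilator_le (annihilator_dilate (k := - (n : nat)%:Z) cM); lia.
case: N MN => // N MN; rewrite big_ord_recl.
have cM' : annihilator M%:Z chi by move: cM; rewrite -addn1 PoszD addrK.
rewrite (scaling_hat_mask cM'); congr (_ * _).
  by congr m0; apply: characterEP => x; rewrite char_dilateE oppr0 dilate0.
rewrite -(IH N) //; last exact: annihilator_dilate.
apply: eq_bigr => n _; congr m0; apply: characterEP => x.
by rewrite !char_dilateE dilate_dilate lift0; congr (chi (dilate _ x)); lia.
Qed.

End MaskLimit.
End Mask.

(** * Multiresolution analyses *)

Section Transport.
Context {F : finFieldType} {R : realType}.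
Local Notation K := (local_field F).
Local Notation X := (character F R).
Local Notation q := #|F|.
Implicit Types (x y a h : K) (n m k : int) (f g : K -> R[i]).
Variable mu : {measure set K -> \bar R}.
Hypothesis haar_mu : normalized_haarK mu.

(** A substitution that scales all squared norms by one constant carries approximants to
    approximants. This handles dilations in both directions as well as translations. *)
Lemma closed_span_comp (t : K -> K) (c : R) (S S' : set (K -> R[i])) f :
  measurable_fun setT t -> 0 < c ->
  (forall g, Cmeasurable g -> L2sq mu (g \o t) = (c%:E * L2sq mu g)%E) ->
  S `<=` L2 mu -> (forall b, S b -> S' (b \o t)) ->
  closed_span mu S f -> closed_span mu S' (f \o t).
Proof.
move=> mt c0 tsq SL SS' /L2closureP[/L2P[mf ff] Hf]; apply/L2closureP; split.
  apply/L2P; split; first exact: Cmeas_comp.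
  by rewrite tsq// lte_mul_pinfty// lee_fin ltW.
move=> e e0; have [g Sg fg] := Hf _ (divr_gt0 e0 c0).
have Lg : L2 mu g.
  have cL := closed_span_closed SL; have [VL _ _ _] := cL.
  by apply/VL; apply: (lin_span_sub cL) Sg; exact: sub_closed_span.
have /L2P[mg _] := Lg.
exists (g \o t).
  have [n [cf [b [Sb ->]]]] := Sg; exists n, cf, (fun i => b i \o t); split => //.
  by move=> i; exact: SS'.
have -> : (f \o t) - (g \o t) = (f - g) \o t by [].
rewrite tsq; last exact: CmeasB.
move: fg (L2sq_ge0 mu (f - g)); case: (L2sq mu (f - g)) => [r| |]//.
by rewrite -EFinM !lte_fin ltr_pdivlMr// mulrC.
Qed.

Lemma measurable_translateB h : measurable_fun setT (fun x : K => x - h).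
Proof. exact: (measurable_translate (- h)). Qed.

Lemma L2_translate h f : L2 mu f -> L2 mu (fun x => f (x - h)).
Proof.
move=> /L2P[mf ff]; apply/L2P; split; last by rewrite (L2sq_translate haar_mu).
exact: (Cmeas_comp (measurable_translateB h) mf).
Qed.

Lemma q_exp_gt0 n : 0 < (q%:R : R) ^ n.
Proof. by rewrite exprz_gt0// lt_neqAle eq_sym card_neq0/=. Qed.

Lemma L2_dilate n f : L2 mu f -> L2 mu (fun x => f (dilate n x)).
Proof.
move=> /L2P[mf ff]; apply/L2P; split.
  exact: (Cmeas_comp (measurable_dilate n) mf).
by rewrite (L2sq_dilate haar_mu)// lte_mul_pinfty// lee_fin ltW// q_exp_gt0.
Qed.

Lemma ae_comp (t : K -> K) (c : \bar R) (P : set K) : measurable_fun setT t ->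
  (forall A, measurable A -> mu (t @^-1` A) = (c * mu A)%E) ->
  {ae mu, forall x, P x} -> {ae mu, forall x, P (t x)}.
Proof.
move=> mt tmu [A [mA A0 PA]]; exists (t @^-1` A); split.
- by rewrite -[_ @^-1` _]setTI; exact: mt.
- by rewrite tmu// A0 mule0.
- by move=> x /= nP; apply: PA.
Qed.

Lemma ae_translate h (P : set K) : {ae mu, forall x, P x} -> {ae mu, forall x, P (x - h)}.
Proof.
apply: (ae_comp (c := 1%E) (measurable_translateB h)) => A mA.
by rewrite mul1e; exact: (haar_translate haar_mu (- h)).
Qed.

Lemma ae_dilate n (P : set K) : {ae mu, forall x, P x} -> {ae mu, forall x, P (dilate n x)}.
Proof. exact: (ae_comp (measurable_dilate n) (fun A => haar_dilate haar_mu n (A := A))). Qed.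

Lemma H0P h : H0 h <-> forall k, 0 <= k -> h k = 0.
Proof.
split=> [Hh k|h0]; first exact: H0_coord.
case: h h0 => a /= /[dup] /asboolP[m am] af h0.
(* Coordinates below [m] vanish, so these digits suffice; the successor also secures the positive
   length required in [H0]. *)
exists `|m|.+1, (fun j : nat => a (- j%:Z)); split => //.
apply: local_fieldP => k; rewrite coord_sum.
under eq_big_nat do rewrite coordZ gE.
have [k0|k0] := leP 0 k.
  rewrite /= h0// big_nat big1// => j /andP[j1 _].
  by case: eqVneq => [|_]; rewrite ?mulr0//; lia.
have [km|km] := leP `|m|.+2 `|k|%N.
  rewrite /= am; last by lia.
  rewrite big_nat big1// => j /andP[j1 jm].
  by case: eqVneq => [|_]; rewrite ?mulr0//; lia.
rewrite (bigD1_seq `|k|%N) ?iota_uniq ?mem_index_iota//=; last by apply/andP; split; lia.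
rewrite big1 => [|j jk]; last by case: eqVneq => [|_]; rewrite ?mulr0//; lia.
rewrite (_ : - `|k|%N%:Z = k); last by lia.
by rewrite eqxx mulr1 addr0.
Qed.

Lemma H0D h h' : H0 h -> H0 h' -> H0 (h + h').
Proof. by move=> /H0P a /H0P b; apply/H0P => k k0; rewrite coordDE a// b// addr0. Qed.

Lemma H0_dilate h (k : nat) : H0 h -> H0 (dilate k%:Z h).
Proof. by move=> /H0P a; apply/H0P => j j0; rewrite dilateE a//; lia. Qed.

Lemma H0Zg u k : k < 0 -> H0 (u *: g_ F k).
Proof.
by move=> k0; apply/H0P => j j0; rewrite coordZ gE; case: eqVneq => [|_]; rewrite ?mulr0//; lia.
Qed.

Definition ball_indics : set (K -> R[i]) :=
  [set (fun x => (\1_A x)%:C%C) | A in @ball_sets F].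

Lemma indic_set0 : (fun x : K => (\1_set0 x)%:C%C) = cst (0 : R[i]).
Proof. by apply/funext => x; rewrite indicE in_set0. Qed.

Lemma ball_indics_L2 : ball_indics `<=` L2 mu.
Proof.
move=> _ [A [->|[n [y ->]]] <-]; last exact: L2_ball_indic.
by rewrite indic_set0; exact: L2_0.
Qed.

Lemma closed_span_balls : closed_span mu ball_indics = L2 mu.
Proof.
have SL := ball_indics_L2.
apply: (@closed_subspace_dense _ _ _ mu (@ball_sets F) (fun i : nat => ballK (- i%:Z))).
- exact: measurable_local_field.
- exact: ball_sets_setI.
- by move=> i; rewrite -ball_at0; exact: ball_sets_at.
- by move=> i; rewrite -ball_at0; exact: haar_ball_fin.
- by move=> i j ij; apply/subsetPset; apply: ballK_le; lia.
- exact: ballK_cover.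
- exact: closed_span_closed.
- by move=> A GA; apply: sub_closed_span => //; exists A.
Qed.

Variable nu : {measure set X -> \bar R}.
Hypothesis haar_nu : normalized_haarX nu.
Variable e : F -> F -> R[i].
Hypothesis e_norm : forall u w : F, `|e u w| = 1.
Hypothesis eDr : forall u v w : F, e u (v + w) = e u v * e u w.
Hypothesis eC : forall u w : F, e u w = e w u.
Hypothesis e_sum : forall w : F, w != 0 -> \sum_u e u w = 0.
Variable r : int -> F -> X.
Hypothesis rE : forall k u x, r k u x = e u (x k).

(** For N >= 1 the coefficients of f - f0 over K_(-N) coincide on each annihilator with the
    truncated transform of f minus g, which tends to zero in L_2. Hence f - f0 has zero integral
    over every ball and is orthogonal to a spanning set. *)
Lemma fourier_transform_ae f f0 (g : X -> R[i]) : L2 mu f -> L2 mu f0 ->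
  is_fourier_transform mu nu f g ->
  (forall M n chi, n <= -1 -> annihilator M chi ->
    Cintegral mu (ballK n) (fun x => f0 x * (chi x)^*%C) = g chi) ->
  {ae mu, forall x, f x = f0 x}.
Proof.
move=> Lf Lf0 [Lg cvgf] f0g.
pose d x := (-1) * f0 x + f x; have Ld : L2 mu d by exact: L2_lin.
pose A (N : nat) (chi : X) := Cintegral mu (ballK (- N%:Z)) (fun x => f x * (chi x)^*%C).
have mA N : Cmeasurable (A N).
  have AE chi psi : coset_at (- N%:Z) chi psi -> A N psi = A N chi.
    by move=> cp; rewrite /A -ball_at0; apply: ball_coef_coset cp; exact: ballK0.
  by split=> _ B _; rewrite setTI;
    apply: (@coset_invariant_measurable _ _ _ (- N%:Z)) => chi psi /AE ->.
have mAg N : Cmeasurable (A N - g) by apply: CmeasB => //; have /L2P[] := Lg.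
have d0 n y : Cintegral mu (ball_at n y) d = 0.
  apply: (fourier_uniqueness e_norm eDr eC e_sum rE haar_nu haar_mu Ld) => M N0 eps eps0.
  have se0 : 0 < Num.sqrt eps by rewrite sqrtr_gt0.
  have [N1 _ small] : \forall N \near \oo, (L2norm nu (A N - g)%R < (Num.sqrt eps)%:E)%E.
    apply: (cvgf [set y | (y < (Num.sqrt eps)%:E)%E]).
    exact: (@nbhs_open_ereal_lt _ 0 (fun=> Num.sqrt eps)).
  exists (maxn 1 (maxn N0 N1)); first by lia.
  have /small : (N1 <= maxn 1 (maxn N0 N1))%N by lia.
  have : (1 <= maxn 1 (maxn N0 N1))%N by lia.
  move: (maxn _ _) => N N_ge1; rewrite /= L2norm_lt// sqr_sqrtr ?ltW//; apply: le_lt_trans.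
  have mM : measurable (@annihilator F R M) by rewrite -coset_at1; exact: measurable_coset_at.
  rewrite (eq_integral (fun chi => (sqnormc ((A N - g) chi))%:E)) => [|chi /set_mem cM].
    apply: ge0_subset_integral => //; first exact: measurable_sqnormcE.
    by move=> chi _; rewrite lee_fin sqnormc_ge0.
  have mchi : Cmeasurable chi.
    exact/(locally_constant_Cmeasurable (n := M))/char_locally_constant.
  have icoef (b : K -> R[i]) : L2 mu b ->
      Cintegrable mu (ballK (- N%:Z)) (fun x => b x * (chi x)^*%C).
    by move=> Lh; rewrite -ball_at0; exact: Cintegrable_coef.
  have mB := @measurable_ballK F (- N%:Z).
  congr (sqnormc _)%:E; rewrite /ball_coef ball_at0 !fctE -(f0g M (- N%:Z) chi)//; last by lia.
  rewrite -[- Cintegral _ _ _]mulN1r -CintegralZ//; last exact: icoef.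
  rewrite [RHS]addrC -CintegralD//; last 2 first.
  - by apply: CintegrableZ => //; exact: icoef.
  - exact: icoef.
  by apply: eq_Cintegral => x _; rewrite /d mulrDl mulrA.
have : {ae mu, forall x, d x = 0}.
  apply: (orthogonal_closed_span_ae0 ball_indics_L2); first by rewrite closed_span_balls.
  move=> _ [B GB <-].
  have -> : Cintegral mu setT (fun x => d x * ((\1_B x)%:C%C)^*%C) = Cintegral mu B d.
    rewrite (@Cintegral_mkcond _ _ _ _ B setT)//; apply: eq_Cintegral => x _.
    by rewrite conjc_real.
  case: GB => [->|[n [y ->]]]; last exact: d0.
  by rewrite /Cintegral !Rintegral_set0.
by apply: filterS => x /eqP; rewrite /d mulN1r addrC subr_eq0 => /eqP.
Qed.

End Transport.

(** * From partition of unity and refinement to the multiresolution axioms *)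

Section Multiresolution.
Context {F : finFieldType} {R : realType}.
Local Notation K := (local_field F).
Local Notation q := #|F|.
Implicit Types (x y a h : K) (n m k : int) (f g : K -> R[i]).
Variable mu : {measure set K -> \bar R}.
Hypothesis haar_mu : normalized_haarK mu.

Definition generators f n : set (K -> R[i]) :=
  [set (fun x => f (dilate n x - h)) | h in @H0 F].

Lemma generators_L2 f n : L2 mu f -> generators f n `<=` L2 mu.
Proof.
move=> Lf _ [h _ <-].
exact: (L2_dilate haar_mu n (L2_translate haar_mu h Lf)).
Qed.

(** Translations and dilations preserve null sets, so corresponding generators agree almost
    everywhere and closed subspaces absorb the difference. *)
Lemma closed_span_generators_ae f g n : L2 mu f -> L2 mu g ->
  {ae mu, forall x, f x = g x} ->
  closed_span mu (generators f n) = closed_span mu (generators g n).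
Proof.
wlog suff : f g / L2 mu f -> L2 mu g -> {ae mu, forall x, f x = g x} ->
    closed_span mu (generators f n) `<=` closed_span mu (generators g n).
  move=> H Lf Lg fg; apply/seteqP; split; first exact: H.
  by apply: H => //; apply: filterS fg => x ->.
move=> Lf Lg fg; have Sg := generators_L2 (n := n) Lg.
have cg := closed_span_closed Sg; apply: closed_span_sub => // _ [h Hh <-].
apply: (@closed_subspace_ae _ _ _ mu _ (fun x => g (dilate n x - h))) => //.
- by apply: sub_closed_span => //; exists h.
- exact: (L2_dilate haar_mu n (L2_translate haar_mu h Lf)).
- exact: (ae_dilate haar_mu n (P := fun x => f (x - h) = g (x - h))
    (ae_translate haar_mu h (P := fun x => f x = g x) fg)).
Qed.

Variables (f : K -> R[i]) (D : nat) (beta : F -> F -> R[i]).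
Hypothesis Lf : L2 mu f.
Hypothesis f_orthonormal : forall h h' : K, H0 h -> H0 h' ->
  L2inner mu (translate f h) (translate f h') = (h == h')%:R.
Hypothesis f_partition : forall x,
  \sum_u f (x - u *: g_ F (-1)) = (\1_(ballK (-1)) x)%:C%C.
Hypothesis f_refinement : forall x, f x = \sum_u \sum_w
  beta u w * f (dilate 1 x - (u *: g_ F (-1) + w *: g_ F (-2))).
Hypothesis f_constant : locally_constant D f.

Let V n := closed_span mu (generators f n).

Let cV n : closed_subspace mu (V n).
Proof. exact/closed_span_closed/generators_L2. Qed.

Let sub_V n : generators f n `<=` V n.
Proof. exact/sub_closed_span/generators_L2. Qed.

Lemma mra_incr n : V n `<=` V (n + 1).
Proof.
apply: closed_span_sub => // _ [h Hh <-].
pose k u w : K := dilate 1 h + (u *: g_ F (-1) + w *: g_ F (-2)).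
have -> : (fun x => f (dilate n x - h)) = fun x => \sum_u 1 *
    (\sum_w beta u w * f (dilate (n + 1) x - k u w)).
  apply/funext => x; rewrite f_refinement; apply: eq_bigr => u _; rewrite mul1r.
  apply: eq_bigr => w _; congr (_ * f _).
  by rewrite dilateB dilate_dilate [1 + n]addrC /k [in RHS]opprD [in RHS]addrA.
apply: closed_subspace_sum => // u; apply: closed_subspace_sum => // w.
apply: sub_V; exists (k u w) => //; apply: H0D; first exact: (H0_dilate 1).
by apply: H0D; exact: H0Zg.
Qed.

Lemma mra_le n m : n <= m -> V n `<=` V m.
Proof.
move=> nm; have -> : m = n + `|m - n|%N%:Z by lia.
elim: `|_|%N => [|k IH]; first by rewrite addr0.
by rewrite -[k.+1]addn1 PoszD addrA; apply: subset_trans IH _; exact: mra_incr.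
Qed.

(** Dropping the coordinates of index >= 0 from A^(m+1) y gives a shift in [H0], to which the
    partition of unity is applied. The level is m + 1 because the partition sums to the indicator of
    K_(-1), not of K_0. *)
Lemma mra_ball m y : V (m + 1) (fun x => (\1_(ball_at m y) x)%:C%C).
Proof.
have [s ys] := center_dense 0 (dilate (m + 1) y).
set h := center 0 s in ys.
have Hh : H0 h by apply/H0P => k k0 /=; rewrite ltNge k0.
have -> : (fun x => (\1_(ball_at m y) x)%:C%C) = fun x => \sum_u 1 *
    f (dilate (m + 1) x - (h + u *: g_ F (-1))) :> R[i].
  apply/funext => x; under eq_bigr do rewrite mul1r opprD addrA.
  rewrite f_partition !indicE; congr (nat_of_bool _)%:R%:C%C.
  have E : ballK (-1) (dilate (m + 1) x - h) <-> ballK m (x - y).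
    have h1 : ballK (-1) (dilate (m + 1) y - h) by apply: ballK_le ys.
    rewrite -[ballK _ _]/(ball_at (-1) h (dilate (m + 1) x)) -(ball_at_eq h1) /ball_at /=.
    by rewrite -dilateB ballK_dilate addrC addrK.
  by apply/idP/idP => /set_mem hx; apply/mem_set; apply/E.
apply: closed_subspace_sum => // u; apply: sub_V; exists (h + u *: g_ F (-1)) => //.
by apply: H0D => //; exact: H0Zg.
Qed.

Lemma mra_union_span : lin_span (\bigcup_n V n) `<=` \bigcup_n V n.
Proof.
move=> _ [n [c [b [Vb ->]]]]; elim: n c b Vb => [|n IH] c b Vb.
  by exists 0 => //; under eq_fun do rewrite big_ord0; case: (cV 0).
rewrite (_ : (fun x => _) = fun x => c ord0 * b ord0 x +
    \sum_(i < n) c (lift ord0 i) * b (lift ord0 i) x); last first.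
  by apply/funext => x; rewrite big_ord_recl.
have [k _ Vk] := IH (fun i => c (lift ord0 i)) _ (fun i => Vb (lift ord0 i)).
have [m _ Vm] := Vb ord0; exists (Num.max k m) => //.
have [_ _ Vlin _] := cV (Num.max k m); apply: Vlin.
  by apply: mra_le Vm; rewrite le_max lexx orbT.
by apply: mra_le Vk; rewrite le_max lexx.
Qed.

Lemma mra_dense : L2closure mu (\bigcup_n V n) = L2 mu.
Proof.
apply/seteqP; split; first by move=> g [].
rewrite -(closed_span_balls haar_mu).
have UL : \bigcup_n V n `<=` L2 mu by move=> g [n _]; case: (cV n) => + _ _ _; exact.
apply: (@subset_trans _ (closed_span mu (\bigcup_n V n))); last exact/L2closureS/mra_union_span.
have cU := closed_span_closed UL; apply: closed_span_sub => // _ [A [->|[m [y ->]]] <-].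
  by rewrite indic_set0; case: cU.
by apply: sub_closed_span => //; exists (m + 1) => //; exact: mra_ball.
Qed.

Lemma mra_locally_constant n g : lin_span (generators f n) g -> locally_constant (D%:Z + n) g.
Proof.
move=> [k [c [b [Sb ->]]]] x y xy; apply: eq_bigr => i _; congr (_ * _).
have [h _ <-] := Sb i; apply: f_constant.
rewrite opprB addrA subrK -dilateB; apply/ballK_dilate; exact: xy.
Qed.

(** K_(-a) lies in K_L, on which g is constant, so its share of the mass there is the ratio of
    measures q^(L + a). *)
Lemma locally_constant_small (a : nat) L g : Cmeasurable g -> locally_constant L g -> L <=
  - a%:Z ->
  (\int[mu]_(x in ballK (- a%:Z)) (sqnormc (g x))%:E <=
   ((q%:R : R) ^ (L + a%:Z))%:E * L2sq mu g)%E.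
Proof.
move=> mg cg La; set c := sqnormc (g 0).
have const n : L <= n ->
    (\int[mu]_(x in ballK n) (sqnormc (g x))%:E = c%:E * ((q%:R : R) ^ (- n))%:E)%E.
  move=> Ln; rewrite -(haar_ballK haar_mu) -integral_cst; last exact: measurable_ballK.
  apply: eq_integral => x /set_mem xn; rewrite /c (cg x 0)// subr0.
  exact: ballK_le xn.
apply: (@le_trans _ _ (((q%:R : R) ^ (L + a%:Z))%:E * \int[mu]_(x in ballK L) (sqnormc (g
  x))%:E)%E).
  rewrite !const// -!EFinM lee_fin mulrCA -expfzDr ?card_neq0//.
  by rewrite addrAC subrr add0r opprK.
apply: lee_wpmul2l; first by rewrite lee_fin ltW ?q_exp_gt0.
rewrite /L2sq; apply: ge0_subset_integral => //.
- exact: measurable_ballK.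
- exact: measurable_sqnormcE.
- by move=> x _; rewrite lee_fin sqnormc_ge0.
Qed.

Lemma L2sq_mkcond (E : set K) g : measurable E ->
  L2sq mu (fun x => g x * (\1_E x)%:C%C) = (\int[mu]_(x in E) (sqnormc (g x))%:E)%E.
Proof.
move=> mE; rewrite [RHS]integral_mkcond; apply: eq_integral => x _.
by rewrite patchE indicE rmorph_nat; case: (x \in E); rewrite ?mulr1 ?mulr0 ?sqnormc0.
Qed.

(** Approximants of very negative level are constant on a huge ball, so a bounded norm leaves them
    little mass on the fixed ball K_(-a). *)
Lemma mra_ball_small (a : nat) g : (forall n, V n g) ->
  (\int[mu]_(x in ballK (- a%:Z)) (sqnormc (g x))%:E = 0)%E.
Proof.
move=> Vg; have Lg : L2 mu g by case: (cV 0) => + _ _ _; apply; exact: Vg.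
have /L2P[mg fg] := Lg; have mB := @measurable_ballK F (- a%:Z).
have [b b0 gb] : exists2 b : R, 0 <= b & L2sq mu g = b%:E.
  have := L2sq_ge0 mu g; move: fg; case: (L2sq mu g) => [b| |]// _.
  by rewrite lee_fin => b0; exists b.
apply/eqP; rewrite eq_le integral_ge0 ?andbT => [|x _]; last by rewrite lee_fin sqnormc_ge0.
apply/lee_addgt0Pr => eps e0; rewrite add0e.
(* The mass of g on K_(-a) is at most 2|g - w|^2 + 2 q^(-t) |w|^2, with |w|^2 <= eps/2 + 2b; q^t >=
   [C] makes the second term at most eps/2. *)
pose C := 2 * (eps + 4 * b) / eps; pose t := (Num.truncn C).+1.
have Ct : C <= (q%:R : R) ^+ t.
  have q2 : (1 < q)%N by apply/card_gt1P; exists 0, 1; rewrite // eq_sym oner_eq0.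
  apply: le_trans (ltW (truncnS_gt C)) _.
  by rewrite -natrX ler_nat ltnW// ltn_expl.
(* Generators of level L - D are constant on cosets of K_L, of which K_(-a) occupies the fraction
   q^(-t). *)
set L := - (t%:Z) - a%:Z; have [w Sw gw] : exists2 w,
    lin_span (generators f (L - D%:Z)) w & (L2sq mu (g - w)%R < (eps / 4)%:E)%E.
  have /L2closureP[_] := Vg (L - D%:Z); apply; exact: divr_gt0.
have /L2P[mw _] : L2 mu w.
  by have [VL _ _ _] := cV (L - D%:Z); apply: VL; apply: (lin_span_sub (cV _)) Sw; exact: sub_V.
have cw : locally_constant L w.
  by have := mra_locally_constant Sw; rewrite addrC subrK.
have restrict_le (h : K -> R[i]) : Cmeasurable h ->
    (L2sq mu (fun x => (h x * (\1_(ballK (- a%:Z)) x)%:C%C)%R) <= L2sq mu h)%E.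
  move=> mh; rewrite L2sq_mkcond// /L2sq; apply: ge0_subset_integral => //.
    exact: measurable_sqnormcE.
  by move=> x _; rewrite lee_fin sqnormc_ge0.
rewrite -L2sq_mkcond//.
rewrite (_ : (fun x => _) = fun x => (g - w) x * (\1_(ballK (- a%:Z)) x)%:C%C +
    w x * (\1_(ballK (- a%:Z)) x)%:C%C); last first.
  by apply/funext => x; rewrite !fctE -mulrDl subrK.
have mI := Cmeas_indic (R := R) mB; have mgw := CmeasB mg mw.
apply: le_trans (L2sqD_le mu (CmeasM mgw mI) (CmeasM mw mI)) _.
have := restrict_le _ mgw.
have := locally_constant_small mw cw (a := a); rewrite -L2sq_mkcond// => /(_ _) sw.
have {}sw := sw ltac:(rewrite /L; lia).
have := L2sqB_le mu mw mg (Cmeas_cst 0).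
rewrite (_ : w - cst 0 = w); last by apply/funext => x; rewrite !fctE subr0.
rewrite (_ : g - cst 0 = g); last by apply/funext => x; rewrite !fctE subr0.
rewrite L2sqB gb; move: sw gw.
have -> : L + a%:Z = - t%:Z by rewrite /L; lia.
have Cinv : (q%:R : R) ^ (- t%:Z) * C <= 1.
  rewrite -exprnN mulrC ler_pdivrMr ?mul1r//.
  exact: (q_exp_gt0 (R := R) (F := F) t%:Z).
have := q_exp_gt0 (R := R) (F := F) (- t%:Z); move: (_ ^ _) Cinv => kap Cinv kap0.
have := L2sq_ge0 mu (fun x => (w x * (\1_(ballK (- a%:Z)) x)%:C%C)%R).
have := L2sq_ge0 mu (fun x => ((g - w) x * (\1_(ballK (- a%:Z)) x)%:C%C)%R).
have := L2sq_ge0 mu (g - w); have := L2sq_ge0 mu w.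
case: (L2sq mu w) => [w2| |]//; case: (L2sq mu (g - w)) => [gw2| |]//;
case: (L2sq mu (fun x => (w x * _)%R)) => [wB| |]//;
case: (L2sq mu (fun x => ((g - w) x * _)%R)) => [gwB| |]//.
rewrite -!EFinM -!EFinD !lee_fin !lte_fin => w20 gw20 gwB0 wB0 sw gw wle gwle.
have CE : kap * (2 * (eps + 4 * b)) <= eps.
  by rewrite -[X in _ <= X]mul1r -ler_pdivrMr// -mulrA.
have : kap * w2 <= kap * (eps / 2 + 2 * b) by rewrite ler_pM2l//; lra.
lra.
Qed.

Lemma mra_cap : \bigcap_n V n = [set g | L2 mu g /\ {ae mu, forall x, g x = 0}].
Proof.
apply/seteqP; split => [g Vg|g [Lg g0] n _]; last first.
  by apply: (@closed_subspace_ae _ _ _ mu _ (cst 0)) => //; case: (cV n).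
have Lg : L2 mu g by case: (cV 0) => + _ _ _; apply; exact: Vg.
have /L2P[mg _] := Lg; split => //.
have ball0 (a : nat) : {ae mu, forall x, ballK (- a%:Z) x -> g x = 0}.
  have mB := @measurable_ballK F (- a%:Z).
  have := @ae_eq_integral_abs _ _ _ mu (ballK (- a%:Z)) mB (fun x => (sqnormc (g x))%:E).
  move=> /(_ (measurable_sqnormcE mB mg))[+ _].
  rewrite (_ : (\int[mu]_(x in _) _ = \int[mu]_(x in ballK (- a%:Z)) (sqnormc (g
    x))%:E)%E); last first.
    by apply: eq_integral => x _; rewrite abse_EFin ger0_norm ?sqnormc_ge0.
  rewrite mra_ball_small => [|n]; last exact: Vg.
  by move=> /(_ erefl); apply: filterS => x h xa; apply: sqnormc_eq0; have [] := h xa.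
have := ae_foralln ball0; apply: filterS => x h.
have [a _ xa] : (\bigcup_i @ballK F (- (i : nat)%:Z)) x by rewrite ballK_cover.
exact: h xa.
Qed.

Lemma generators_dilate n m b : generators f n b -> generators f (n + m) (b \o dilate m).
Proof. by move=> [h Hh <-]; exists h => //; apply/funext => x; rewrite /= dilate_dilate. Qed.

Lemma mra_dilate n g : V n g <-> V (n + 1) (g \o dilate 1).
Proof.
split.
  apply: (closed_span_comp (c := (q%:R : R) ^ (- (1 : int))) (measurable_dilate 1)).
  - exact: q_exp_gt0.
  - by move=> *; exact: L2sq_dilate.
  - exact: generators_L2.
  - by move=> b; exact: generators_dilate.
rewrite -{2}[g](_ : (g \o dilate 1) \o dilate (-1) = g); last first.
  by apply/funext => x; rewrite /= dilateVK.
apply: (closed_span_comp (c := (q%:R : R) ^ (- (-1 : int))) (measurable_dilate (-1))).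
- exact: q_exp_gt0.
- by move=> *; exact: L2sq_dilate.
- exact: generators_L2.
- by move=> b /(@generators_dilate _ (-1)); rewrite addrK.
Qed.

Lemma mra_translate g h : V 0 g -> H0 h -> V 0 (translate g h).
Proof.
move=> Vg Hh; apply: (closed_span_comp (c := 1) (measurable_translateB h)) Vg => //.
- by move=> b mb; rewrite mul1e; exact: (L2sq_translate haar_mu (- h)).
- exact: generators_L2.
- move=> _ [h' Hh' <-]; exists (h + h'); first exact: H0D.
  by apply/funext => x /=; rewrite !dilate0 opprD addrA.
Qed.

Lemma generates_MRA phi : L2 mu phi -> {ae mu, forall x, phi x = f x} ->
  generates_orthogonal_MRA mu phi.
Proof.
move=> Lphi phif; have VE n : closed_span mu (generators phi n) = V n.
  exact: closed_span_generators_ae.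
have orth : Defs.orthonormal mu (@H0 F) (translate phi).
  split=> [h _|h h' Hh Hh']; first exact: L2_translate.
  rewrite -f_orthonormal//; apply: Cintegral_ae.
  - apply: CmeasM; first by have /L2P[] := L2_translate haar_mu h Lphi.
    by apply: CmeasJ; have /L2P[] := L2_translate haar_mu h' Lphi.
  - apply: CmeasM; first by have /L2P[] := L2_translate haar_mu h Lf.
    by apply: CmeasJ; have /L2P[] := L2_translate haar_mu h' Lf.
  have a1 := ae_translate haar_mu h (P := fun x => phi x = f x) phif.
  have a2 := ae_translate haar_mu h' (P := fun x => phi x = f x) phif.
  by apply: filterS2 a1 a2 => x; rewrite /translate => -> ->.
split => //.
rewrite (_ : (fun n => _) = V); last by apply/funext => n; exact: VE.
split.
- exact: cV.
- exact: mra_incr.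
- by split; [exact: mra_dense|exact: mra_cap].
- exact: mra_dilate.
- split; first by move=> g h; exact: mra_translate.
  exists phi => //; split => //; rewrite -VE; congr closed_span.
  by apply/seteqP; split => _ [h Hh <-]; exists h => //; apply/funext => x; rewrite
    /translate dilate0.
Qed.

End Multiresolution.

(** * Trees and the pairing of GF(p^s) *)

Section Tree.
Context {V : finType}.
Variables (e : rel V) (root : V).
Hypothesis tree_e : is_tree e.

Lemma path_avoid (i x : V) (s : seq V) : path e x s -> i \notin x :: s ->
  path [rel y z | [&& e y z, y != i & z != i]] x s.
Proof.
elim: s x => //= y s IH x /andP[xy ys]; rewrite !inE !negb_or => /and3P[ix iy isn].
rewrite xy ![_ == i]eq_sym ix iy/=; apply: IH => //.
by rewrite inE negb_or iy.
Qed.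

(* Two simple paths from the root arriving at i through different neighbours
   would be joined, away from i, into a cycle through i. *)
Lemma away_edge_uniq (i j j' : V) : away_edge e root j i -> away_edge e root j' i -> j = j'.
Proof.
have [se ie _ acyclic] := tree_e.
pose e' := [rel y z | [&& e y z, y != i & z != i]].
have away k : away_edge e root k i -> [/\ e k i, k != i & connect e' root k].
  move=> [s []]; rewrite rcons_path -rcons_cons rcons_uniq => /andP[ps si] /andP[ins _] <-.
  split=> //; last by apply/connectP; exists s => //; exact: path_avoid.
  by apply: contraNneq ins => <-; exact: mem_last.
move=> /away[ji jni cj] /away[ji' jni' cj'].
apply/eqP/negPn/negP => jj'.
have se' : connect_sym e'.
  apply: sym_connect_sym => x y /=; rewrite se; congr (_ && _); exact: andbC.
have : connect e' j j' by apply: connect_trans cj'; rewrite se'.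
move=> /connectP[s0 ps0 j'E]; move: j'E jj' ji' jni'; case/shortenP: ps0 => s ps us _ ->
  jj' ji' jni'.
have avoid x t : path e' x t -> i \notin t.
  elim: t x => //= y t IH x /andP[/and3P[_ _ yi] pt].
  by rewrite inE negb_or eq_sym yi; exact: IH pt.
have sube x t : path e' x t -> path e x t.
  by apply: sub_path => y z /and3P[].
have := acyclic (i :: j :: s); case: s ps us jj' ji' jni' => [|z s] ps us jj' ji' jni'.
  by rewrite eqxx in jj'.
move=> /(_ isT)/negP; apply; apply/andP; split; last first.
  rewrite cons_uniq us andbT inE negb_or eq_sym jni; exact: avoid ps.
have : path e j (z :: s) by exact: sube.
by rewrite /= rcons_path (se i j) ji => /andP[-> ->].
Qed.

Lemma away_edge_neq_root (i j : V) : away_edge e root j i -> i != root.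
Proof.
move=> [s [_]]; rewrite cons_uniq mem_rcons inE negb_or eq_sym => /andP[/andP[ri _] _ _].
by [].
Qed.

(* The root is its own parent. *)
Definition parent (i : V) : V := odflt root [pick j | `[< away_edge e root j i >]].

(** Existence of a parent comes from shortening a walk from the root to a simple path and taking its
    last edge; uniqueness is acyclicity. *)
Lemma parentP (i j : V) : away_edge e root j i <-> i != root /\ j = parent i.
Proof.
have [_ _ conn _] := tree_e; split => [ji|[ir ->]].
  split; first exact: away_edge_neq_root ji.
  rewrite /parent; case: pickP => [k /asboolP ki|/(_ j)/asboolP//].
  exact: away_edge_uniq ji ki.
rewrite /parent; case: pickP => [k /asboolP//|none]; exfalso.
have /connectP[s0 ps0 iE] := conn root i; move: iE ir none; case/shortenP: ps0 => s ps us _ ->.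
case/lastP: s ps us => [|s i']; first by rewrite eqxx.
move=> ps us _ /(_ (last root s))/asboolP; apply; rewrite last_rcons.
by exists s.
Qed.

Lemma parent_root : parent root = root.
Proof.
rewrite /parent; case: pickP => [k /asboolP/parentP[]|//].
by rewrite eqxx.
Qed.

(** [parent] retraces the simple path from the root, which has fewer than #|V| edges; surplus
    iterations stay at the root. *)
Lemma iter_parent (i : V) : iter #|V| parent i = root.
Proof.
have [_ _ conn _] := tree_e.
have walk (s : seq V) : path e root s -> uniq (root :: s) ->
    iter (size s) parent (last root s) = root.
  elim/last_ind: s => // s x IH ps us; rewrite last_rcons size_rcons iterSr.
  have /parentP[_ <-] : away_edge e root (last root s) x by exists s.
  apply: IH; first by move: ps; rewrite rcons_path => /andP[].
  by move: us; rewrite -rcons_cons rcons_uniq => /andP[].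
have /connectP[s0 ps0 ->] := conn root i; case/shortenP: ps0 => s ps us _.
have sV : (size s <= #|V|)%N.
  by apply: ltnW; rewrite -[X in (X <= _)%N]/(size (root :: s)) -(card_uniqP us) max_card.
rewrite -(subnK sV) iterD walk//.
by elim: (_ - _)%N => //= k ->; exact: parent_root.
Qed.

End Tree.

(** * The exponential pairing of GF(p^s) and the cosets of a tree *)

Section Pairing.
Variable R : realType.
Variables (p : nat) (p_pr : prime p).
Variables (h : {poly 'F_p}) (hI : monic_irreducible_poly h).
Local Notation GF := (GF hI).
Local Notation s := (size h).-1.

Definition pairing (u w : GF) : R[i] :=
  \prod_(l < s) expi (2 * pi / p%:R * (Defs.coord u l : nat)%:R * (Defs.coord w l : nat)%:R).

Lemma r_pairing k u (x : local_field GF) : r_ R p_pr k u x = pairing u (x k).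
Proof. by []. Qed.

Lemma pairing_norm u w : `|pairing u w| = 1.
Proof. by rewrite normr_prod big1// => l _; exact: expi_norm. Qed.

Lemma pairingC u w : pairing u w = pairing w u.
Proof. by apply: eq_bigr => l _; rewrite mulrAC. Qed.

(** Inherited from the Rademacher character of index 0, whose values on the multiples of g_0 are
    those of the pairing. *)
Lemma pairingDr u v w : pairing u (v + w) = pairing u v * pairing u w.
Proof.
have E (z : GF) : pairing u z = r_ R p_pr 0 u (z *: g_ GF 0).
  by rewrite r_pairing coordZ gE eqxx mulr1.
by rewrite !E scalerDl charD.
Qed.

Lemma expi_neq1 (t : R) : 0 < t < 2 * pi -> expi t != 1.
Proof.
move=> /andP[t0 t2]; apply/eqP => -[ct _].
have : 0 < sin (t / 2) by apply: sin_gt0_pi; apply/andP; split; lra.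
have : cos t = 1 - sin (t / 2) ^+ 2 *+ 2.
  rewrite {1}(_ : t = (t / 2) *+ 2); last by rewrite -mulr_natr; lra.
  by rewrite cos_mulr2n cos2sin2; lra.
rewrite ct => E s0; have : 0 < sin (t / 2) ^+ 2 by rewrite exprn_gt0.
by lra.
Qed.

Lemma GF_coord_neq0 (w : GF) : w != 0 -> exists2 l : 'I_s, Defs.coord w l != 0 &
  exists u : GF, forall l', Defs.coord u l' = (l' == l)%:R.
Proof.
move=> w0; have [/irredp_neq0 h0 hm] := hI.
have sh : size (mk_monic h) = size h.
  by rewrite /mk_monic hm andbT; have [[->]] := hI.
have [l wl] : exists l : 'I_s, Defs.coord w l != 0.
  apply: contrapT => none; move/eqP: w0; apply; apply/npolyP => l /=.
  rewrite coef0; have [ls|ls] := ltnP l s; last by rewrite big_coef_npoly// sh.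
  by apply/eqP/negPn/negP => wl; apply: none; exists (Ordinal ls).
exists l => //; exists (npolyp _ 'X^l) => l'.
rewrite /Defs.coord coef_npolyp coefXn; case: ifP => // /negbT; rewrite sh -leqNgt => sl.
by rewrite gtn_eqF//; exact: leq_trans sl.
Qed.

(** For u the monomial t^l at a nonzero digit w_l, the value is exp(2 pi i w_l / p) with 0 < w_l <
    p. *)
Lemma pairing_nondegenerate w : w != 0 -> exists u, pairing u w != 1.
Proof.
move=> /GF_coord_neq0[l wl [u ul]]; exists u.
rewrite /pairing (bigD1 l)//= big1 => [|l' l'l]; last first.
  rewrite ul val_eqE (negPf l'l) [X in _ * X * _](_ : _ = 0)// mulr0 mul0r; exact: expi0.
rewrite mulr1 ul eqxx; apply: expi_neq1.
have p0 : 0 < (p%:R : R) by rewrite ltr0n prime_gt0.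
have -> : (1 : 'F_p) = 1%N :> nat by rewrite /= (modn_small (prime_gt1 _))// Fp_cast.
have wl0 : 0 < ((Defs.coord w l : nat)%:R : R).
  by rewrite ltr0n lt0n; apply: contra wl => /eqP E; apply/eqP/val_inj.
have wlp : ((Defs.coord w l : nat)%:R : R) < p%:R.
  by rewrite ltr_nat -[X in (_ < X)%N](Fp_cast p_pr); exact: ltn_ord.
have pi0 := pi_gt0 R; rewrite mulr1.
apply/andP; split; first by rewrite !mulr_gt0// invr_gt0.
by rewrite -mulrA gtr_pMr ?mulr_gt0// mulrC ltr_pdivrMr// mul1r.
Qed.

Lemma pairing_sum w : w != 0 -> \sum_u pairing u w = 0.
Proof.
move=> /pairing_nondegenerate[u uw].
have : \sum_v pairing v w = pairing u w * \sum_v pairing v w.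
  rewrite {1}(reindex_inj (addrI u)) mulr_sumr; apply: eq_bigr => v _.
  by rewrite !(pairingC _ w) pairingDr.
move/eqP; rewrite -subr_eq0 -{1}[\sum_v _]mul1r -mulrBl mulf_eq0 subr_eq0.
by rewrite eq_sym (negPf uw) => /eqP.
Qed.

(** Values on the span of g_(-1) and g_0 determine the pair (i, j), and K_(-1)^perp is trivial
    there, so different pairs represent different cosets. *)
Lemma tree_cosets_edge (e : rel GF) i j :
  tree_cosets p_pr e (r_ R p_pr (-1) i * r_ R p_pr 0 j)%g <->
  (i = 0 /\ j = 0) \/ away_edge e 0 j i.
Proof.
split; last first.
  case=> [[-> ->]|ji]; [left|right].
    by rewrite !(r0 pairing_norm pairingDr pairingC r_pairing) mulg1; exact: annihilator1.
  by exists i, j, 1%g; split => //; rewrite mul1g.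
pose rr := r_ R p_pr (hI := hI).
have val psi (u v a b : GF) : annihilator (-1) psi ->
    (psi * rr (-1) u * rr 0 v)%g (a *: g_ _ (-1) + b *: g_ _ 0) = pairing u a * pairing v b.
  move=> cpsi; rewrite !char_mulE cpsi; last first.
    by apply: ballKD; [|apply: (@ballK_le _ _ 0) => //]; exact: ballKZg.
  by rewrite mul1r !r_pairing !coordDE !coordZ !gE/= !mulr1 !mulr0 addr0 add0r.
have inj psi u v u' v' : annihilator (-1) psi -> 
    (rr (-1) u * rr 0 v = psi * rr (-1) u' * rr 0 v')%g -> u = u' /\ v = v'.
  move=> cpsi E; have E' a b : pairing u a * pairing v b = pairing u' a * pairing v' b.
    transitivity ((rr (-1) u * rr 0 v)%g (a *: g_ _ (-1) + b *: g_ _ 0)).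
      by rewrite -(val 1%g) -?mulgA ?mul1g//; exact: annihilator1.
    by rewrite E val.
  have e0 z := e0r pairing_norm pairingDr z.
  split; apply: (e_inj pairing_norm pairingDr pairingC pairing_sum) => a.
    by have := E' a 0; rewrite !e0 !mulr1.
  by have := E' 0 a; rewrite !e0 !mul1r.
case=> [ann|[i' [j' [psi [ji cpsi E]]]]]; [left|right].
  apply: (inj _ i j 0 0 ann); rewrite /rr !(r0 pairing_norm pairingDr pairingC r_pairing)
    !mulg1.
  by [].
by have [-> ->] := inj _ _ _ _ _ cpsi E.
Qed.

End Pairing.

Theorem theorem8p2 (R : realType) (p s : nat) (p_pr : prime p)
    (s_gt0 : (0 < s)%N) (ps_ge3 : (3 <= p ^ s)%N)
    (h : {poly 'F_p}) (hI : monic_irreducible_poly h) (size_h : size h = s.+1)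
    (mu : {measure set (local_field (GF hI)) -> \bar R})
    (nu : {measure set (character (GF hI) R) -> \bar R})
    (haar_mu : normalized_haarK mu) (haar_nu : normalized_haarX nu)
    (T : rel (GF hI)) (tree_T : is_tree T)
    (phi : local_field (GF hI) -> R[i])
    (phi_T : generated_by_tree p_pr mu nu T phi) :
  generates_orthogonal_MRA mu phi.
Proof.
have [Lphi [m0 [g [[m0_coset m0_one m0_edge m0_periodic] g_lim phi_g]]]] := phi_T.
pose e := @pairing R p h hI.
pose r := r_ R p_pr (hI := hI).
pose pa := parent T 0.
pose lam v := m0 (r (-1) v * r 0 (pa v))%g.
have e_norm : forall u w, `|e u w| = 1 by exact: pairing_norm.
have eDr : forall u v w, e u (v + w) = e u v * e u w by exact: pairingDr.
have eC : forall u w, e u w = e w u by exact: pairingC.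
have e_sum : forall w, w != 0 -> \sum_u e u w = 0 by exact: pairing_sum.
have rE : forall k u x, r k u x = e u (x k) by exact: r_pairing.
have pa0 : pa 0 = 0 by exact: parent_root.
have paD : forall v, iter #|GF hI| pa v = 0 by exact: iter_parent.
have r00 k : r k 0 = 1%g by exact: (r0 e_norm eDr eC rE).
have lam0 : lam 0 = 1 by rewrite /lam pa0 !r00 mulg1.
(* The additional coset K_(-1)^perp belongs to the pair (0, 0); through [pa 0 = 0] it counts as a
   loop at the root, so one equation describes all cosets. *)
have cosets u v : tree_cosets p_pr T (r (-1) u * r 0 v)%g <-> v = pa u.
  rewrite tree_cosets_edge parentP//; split=> [[[-> ->]|[]]//|->].
  by have [->|u0] := eqVneq u 0; [left|right].
have lam_norm v : `|lam v| = 1.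
  by have := m0_edge v (pa v); rewrite asboolT//; exact/cosets.
have m0_parent u v : m0 (r (-1) u * r 0 v)%g = if v == pa u then lam u else 0.
  have := m0_edge u v; rewrite (asbool_equiv_eq (cosets u v)).
  by case: eqVneq => [->|vu]; [|rewrite asboolF//; exact/eqP].
have hat M chi : annihilator M chi -> g chi = scaling_hat r pa lam #|GF hI| chi.
  (* The partial products are constant from N = |M| + 1 on, so the pointwise limit is attained. *)
  move=> cM; apply: (norm_cvg_unique (g_lim chi)); apply: cvg_near_cst.
  exists `|M|%N.+1 => // N /= MN.
  apply: (mask_product e_norm eDr eC e_sum rE pa0 paD lam0 m0_coset m0_one m0_parent
    m0_periodic MN).
  by apply: annihilator_le cM; lia.
apply: (@generates_MRA _ _ mu haar_mu (scaling_fun r pa lam #|GF hI|) #|GF hI|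
  (mask_coef e pa lam)) => //.
- exact: (L2_scaling_fun e_norm eDr rE).
- by move=> k k'; exact: (scaling_fun_orthonormal e_norm eDr eC).
- by move=> x; exact: (scaling_fun_partition e_norm eDr).
- by move=> x; exact: (scaling_fun_refinement e_norm eDr).
- exact: (scaling_fun_locally_constant e_norm eDr).
apply: (fourier_transform_ae haar_mu haar_nu e_norm eDr eC e_sum rE (g := g)) => //.
  exact: (L2_scaling_fun e_norm eDr rE).
move=> M n chi n1 cM; rewrite (hat M)//.
apply: (fourier_scaling_fun e_norm eDr rE) => //.
exact/(locally_constant_Cmeasurable (n := M))/char_locally_constant.
Qed.
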